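(* Let $\mathfrak g$ be a complete dg Lie algebra over a field $\Bbbk$ of characteristic zero, let $\overline{\mathfrak g}=\mathfrak g\oplus\Bbbk\delta$, and let $\mathfrak b$, $\phi$, $\partial^\phi$ be as defined in the context. Let $\lambda\in\mathfrak b$ be an element of degree $0$ and $f\in\mathfrak b$ an element of degree $1$ with $\partial^{\phi}(f)=\lambda$. Let $\alpha\in\mathfrak g_{-1}$ be a Maurer--Cartan element of $\mathfrak g$, and let $\lambda.\alpha\in\mathfrak g_{-1}$ and $f_i\in\mathfrak g_0$ ($i\ge 1$) be as defined in the context. Put \[ \xi=\sum_{n=1}^\infty\ \sum_{i_1,\dots,i_n\ge 1}\left[\frac1n\sum_{\substack{\rho\in S_n\\ \rho(1)=1}}\frac{(-1)^{\mathsf d(\rho^{-1})}}{\binom{n-1}{\mathsf d(\rho^{-1})}}\prod_{j=1}^{n}\frac{1}{i_{\rho(1)}+\cdots+i_{\rho(j)}}\right]\operatorname{ad}_{f_{i_n}}\operatorname{ad}_{f_{i_{n-1}}}\cdots\operatorname{ad}_{f_{i_2}}(f_{i_1})\in\mathfrak g_0 , \] where $\mathsf d(\tau)$ denotes the number of descents of a permutation $\tau$ (for $n=1$ the summand is $\sum_{i_1\ge1}\frac1{i_1}f_{i_1}$). Then, in $\overline{\mathfrak g}$, \[ \exp(\operatorname{ad}_\xi)(\delta+\alpha)=\delta+\lambda.\alpha . \]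
   Context: All chain complexes are graded homologically (differentials have degree $-1$), with the Koszul sign rule. $s$ is a formal symbol of degree $1$ and $sV=\Bbbk s\otimes V$; on $s\mathfrak g$ the differential is $d(sx)=-s\,dx$. Complete dg Lie algebra: a dg Lie algebra $(\mathfrak g,d,[-,-])$ with a descending filtration $\mathfrak g=F_1\mathfrak g\supseteq F_2\mathfrak g\supseteq\cdots$ with $d(F_i)\subseteq F_i$, $[F_i,F_j]\subseteq F_{i+j}$ and $\mathfrak g\cong\varprojlim\mathfrak g/F_n\mathfrak g$. A Maurer--Cartan element is $\alpha\in\mathfrak g_{-1}$ with $d\alpha+\frac12[\alpha,\alpha]=0$. $\overline{\mathfrak g}=\mathfrak g\oplus\Bbbk\delta$ is the graded Lie algebra extending $\mathfrak g$ with $\delta$ of degree $-1$, $[\delta,\delta]=0$ and $[\delta,x]=d(x)$ for $x\in\mathfrak g$. For $x\in\mathfrak g_0$, $\operatorname{ad}_x=[x,-]$. $\mathfrak b=\prod_{n\ge2}\operatorname{End}_{s\mathfrak g}(n)^{S_n}$: sequences $\mu=(\mu_n)_{n\ge2}$ of graded symmetric multilinear maps $\mu_n:(s\mathfrak g)^{\otimes n}\to s\mathfrak g$ compatible with the filtration ($\mu_n(sF_{j_1},\dots,sF_{j_n})\subseteq sF_{j_1+\cdots+j_n}$). The pre-Lie product is \[ (\mu\star\nu)_n(v_1,\dots,v_n)=\sum_{p+q=n+1}\ \sum_{\sigma}\pm\,\mu_p\big(\nu_q(v_{\sigma(1)},\dots,v_{\sigma(q)}),v_{\sigma(q+1)},\dots,v_{\sigma(n)}\big),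 \] the inner sum being over $(q,n-q)$-shuffles, with Koszul signs; the same formula is used when one also allows the identity map $\mathbb 1=\mathrm{id}_{s\mathfrak g}$ in arity one. $\mathfrak b$ carries the bracket $[\mu,\nu]=\mu\star\nu-(-1)^{|\mu||\nu|}\nu\star\mu$ and the differential $\partial$ induced by that of $s\mathfrak g$ (the graded commutator with $d$). $\phi\in\mathfrak b$ is the degree $-1$ element concentrated in arity two encoding the Lie bracket: $\phi(sx,sy)=(-1)^{|x|}s[x,y]$. The twisted differential is $\partial^\phi=\partial+[\phi,-]$. Write $r_\lambda(\mu)=\mu\star\lambda$, with $r_\lambda^i$ its $i$-th iterate ($r^0_\lambda=\mathrm{id}$). Put $e^\lambda=\sum_{n\ge0}\frac1{n!}r_\lambda^n(\mathbb 1)=\mathbb 1+\lambda+\frac12\lambda\star\lambda+\cdots$. The ambient action of $\lambda$ on $\alpha$ is the element $\lambda.\alpha\in\mathfrak g_{-1}$ determined by \[ s(\lambda.\alpha)=\sum_{n\ge1}\frac1{n!}(e^\lambda)_n(s\alpha,\dots,s\alpha). \] For $i\ge1$, $f_i\in\mathfrak g_0$ is determined by \[ s f_i=\frac1{(i-1)!}\sum_{n\ge2}\frac1{n!}\big(r_\lambda^{i-1}(f)\big)_n(s\alpha,\dots,s\alpha). \] One has $f_i\in F_{i+1}\mathfrak g$, so all infinite sums converge. A descent of $\tau\in S_n$ is an index $1\le k\le n-1$ with $\tau(k)>\tau(k+1)$. *)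

(* Defs.v *)
From HB Require Import structures.
From mathcomp Require Import all_boot all_order all_algebra all_fingroup.
From mathcomp Require Import boolp classical_sets.

Set Implicit Arguments.
Unset Strict Implicit.
Unset Printing Implicit Defensive.

Import GRing.Theory.

Local Open Scope ring_scope.

(* A graded vector space is the direct sum of its homogeneous components; the
   grading is given by the projections onto the components. *)
Record gradedModule (k : fieldType) := GradedModule {
  gm_sort :> lmodType k;
  gproj : int -> {linear gm_sort -> gm_sort};
  gprojK : forall i j x, gproj i (gproj j x) = if i == j then gproj j x else 0;
  gproj_fin : forall x, exists s : seq int,
    uniq s && (x == \sum_(i <- s) gproj i x) }.

Section Graded.

Variables (k : fieldType) (W : gradedModule k).

Definition homog (i : int) (x : W) : Prop := gproj W i x = x.

(* A finite list of degrees outside of which the components of x vanish. *)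
Definition degs (x : W) : seq int := xchoose (gproj_fin x).

(* The linear map x |-> (-1)^|x| x. *)
Definition sgn_deg (x : W) : W := \sum_(i <- degs x) (-1 : k) ^ i *: gproj W i x.

(* The even (b = false) or odd (b = true) part of x. *)
Definition parity_part (b : bool) (x : W) : W :=
  \sum_(i <- degs x | odd `|i|%N == b) gproj W i x.

(* Koszul sign of v_0,...,v_(n-1) |-> v_(sigma 0),...,v_(sigma (n-1)), where
   e i is the parity of |v_i|. *)
Definition koszul (n : nat) (e : 'I_n -> bool) (sigma : 'S_n) : k :=
  \prod_(i < n) \prod_(j < n | (i < j)%N && (sigma j < sigma i)%N)
    (-1) ^+ (e (sigma i) && e (sigma j)).

(* (q, n - q)-shuffles *)
Definition shuffle (n q : nat) (sigma : 'S_n) : bool :=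
  [forall i : 'I_n, forall j : 'I_n,
     ((i < j)%N && ((j < q)%N || (q <= i)%N)) ==> (sigma i < sigma j)%N].

(* A sequence (mu_n)_n of n-ary operations, encoded as one function on lists:
   mu_n is its restriction to the lists of length n. *)
Definition multiop := seq W -> W.

(* The sum over e expands every argument into its even and odd parts, so that
   the Koszul sign, which depends only on parities, makes sense for arbitrary
   arguments. *)
Definition prelie (mu nu : multiop) : multiop := fun v =>
  let n := size v in
  \sum_(1 <= q < n.+1) \sum_(sigma : 'S_n | shuffle q sigma)
    \sum_(e : {ffun 'I_n -> bool})
      let w := [seq parity_part (e (sigma i)) (nth 0 v (sigma i))
               | i <- enum 'I_n] in
      koszul e sigma *: mu (nu (take q w) :: drop q w).

Definition unary (g : W -> W) : multiop :=
  fun v => if v is [:: x] then g x else 0.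

Definition binary (g : W -> W -> W) : multiop :=
  fun v => if v is [:: x; y] then g x y else 0.

(* The graded commutator of mu of degree i and nu of degree j. *)
Definition commutator (i j : int) (mu nu : multiop) : multiop :=
  fun v => prelie mu nu v - (-1 : k) ^ (i * j) *: prelie nu mu v.

(* mu is a degree c element of prod_(n >= 2) End_W(n)^(S_n), where W carries
   the filtration F. *)
Record symop (F : nat -> W -> Prop) (c : int) (mu : multiop) : Prop := Symop {
  symop_arity : forall v, (size v < 2)%N -> mu v = 0;
  symop_linear : forall (v1 v2 : seq W) (a : k) (x y : W),
    mu (v1 ++ (a *: x + y) :: v2) = a *: mu (v1 ++ x :: v2) + mu (v1 ++ y :: v2);
  symop_homog : forall (n : nat) (d : 'I_n -> int) (v : 'I_n -> W),
    (forall i, homog (d i) (v i)) ->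
    homog (\sum_(i < n) d i + c) (mu [seq v i | i <- enum 'I_n]);
  symop_sym : forall (n : nat) (d : 'I_n -> int) (v : 'I_n -> W) (sigma : 'S_n),
    (forall i, homog (d i) (v i)) ->
    mu [seq v (sigma i) | i <- enum 'I_n] =
      koszul (fun i => odd `|d i|%N) sigma *: mu [seq v i | i <- enum 'I_n];
  symop_filt : forall (n : nat) (j : 'I_n -> nat) (v : 'I_n -> W),
    (forall i, F (j i) (v i)) ->
    F (\sum_(i < n) j i)%N (mu [seq v i | i <- enum 'I_n]) }.

End Graded.

Section Suspension.

Variables (k : fieldType) (V : gradedModule k).

Lemma susp_projK (i j : int) (x : V) :
  gproj V (i - 1) (gproj V (j - 1) x) = if i == j then gproj V (j - 1) x else 0.
Proof. by rewrite gprojK (inj_eq (addIr _)). Qed.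

Lemma susp_proj_fin (x : V) : exists s : seq int,
  uniq s && (x == \sum_(i <- s) gproj V (i - 1) x).
Proof.
have [s /andP[us /eqP xE]] := gproj_fin x.
exists [seq i + 1 | i <- s]; rewrite (map_inj_uniq (addIr _)) us /=.
by rewrite big_map {1}xE; apply/eqP/eq_bigr => i _; rewrite addrK.
Qed.

(* sV has the same underlying space as V, with degrees raised by one; the map
   x |-> sx is the identity on underlying spaces. *)
Definition susp : gradedModule k :=
  GradedModule (gproj := fun i => gproj V (i - 1)) susp_projK susp_proj_fin.

Definition s_ (x : V) : susp := x.
Definition s_inv (x : susp) : V := x.

End Suspension.

Record dgLie (k : fieldType) := DgLie {
  dgl_gm :> gradedModule k;
  dgd : {linear dgl_gm -> dgl_gm};
  lie : dgl_gm -> dgl_gm -> dgl_gm;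
  dgd_homog : forall i x, homog i x -> homog (i - 1) (dgd x);
  dgdK : forall x, dgd (dgd x) = 0;
  lie_linearl : forall y, linear (fun x => lie x y);
  lie_linearr : forall x, linear (lie x);
  lie_homog : forall i j x y, homog i x -> homog j y -> homog (i + j) (lie x y);
  lie_antisym : forall i j x y, homog i x -> homog j y ->
    lie x y = - ((-1 : k) ^ (i * j) *: lie y x);
  lie_jacobi : forall i j x y z, homog i x -> homog j y ->
    lie x (lie y z) = lie (lie x y) z + (-1 : k) ^ (i * j) *: lie y (lie x z);
  lie_leibniz : forall i x y, homog i x ->
    dgd (lie x y) = lie (dgd x) y + (-1 : k) ^ i *: lie x (dgd y) }.

(* filt n is F_n for n >= 1, with the convention F_0 = F_1.  As everything is
   graded, g = lim g/F_n is an isomorphism of graded vector spaces, i.e. it holds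
   in each degree: filt_sep is injectivity, and filt_complete is surjectivity,
   u n representing the component in g_i/F_n of an element of the limit. *)
Record completeDgLie (k : fieldType) := CompleteDgLie {
  cdgl_dgl :> dgLie k;
  filt : nat -> cdgl_dgl -> Prop;
  filt_top : forall n x, (n <= 1)%N -> filt n x;
  filt_desc : forall n x, filt n.+1 x -> filt n x;
  filt0 : forall n, filt n 0;
  filt_linear : forall n (a : k) x y,
    filt n x -> filt n y -> filt n (a *: x + y);
  filt_proj : forall n i x, filt n x -> filt n (gproj cdgl_dgl i x);
  filt_dgd : forall n x, filt n x -> filt n (dgd cdgl_dgl x);
  filt_lie : forall m n x y, filt m x -> filt n y -> filt (m + n) (lie x y);
  filt_sep : forall i x, homog i x -> (forall n, filt n x) -> x = 0;
  filt_complete : forall i (u : nat -> cdgl_dgl),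
    (forall n, homog i (u n)) -> (forall n, filt n (u n.+1 - u n)) ->
    exists2 x, homog i x & forall n, filt n (x - u n) }.

Section Sums.

Variables (W : zmodType) (F : nat -> W -> Prop).

(* x is the (unconditional) sum of the t i, P i, for the topology defined by F. *)
Definition has_sum (I : eqType) (P : pred I) (t : I -> W) (x : W) : Prop :=
  forall N : nat, exists s0 : seq I, forall s : seq I,
    uniq s -> {subset s0 <= s} -> F N (x - \sum_(i <- s | P i) t i).

(* The default value 0 is used when the sum does not converge. *)
Definition infsum (I : eqType) (P : pred I) (t : I -> W) : W :=
  xget 0 (fun x => has_sum P t x).

End Sums.

Section MaurerCartan.

Variables (k : fieldType) (g : completeDgLie k).

Definition maurer_cartan (alpha : g) : Prop :=
  homog (-1) alpha /\ dgd g alpha + 2%:R^-1 *: lie alpha alpha = 0.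

Definition sfilt (n : nat) (x : susp g) : Prop := filt n (s_inv x).

Definition in_b (c : int) (mu : multiop (susp g)) : Prop := symop sfilt c mu.

(* The differential of sg, as an element of arity one. *)
Definition sd : multiop (susp g) := unary (fun x => - s_ (dgd g (s_inv x))).

Definition phi : multiop (susp g) :=
  binary (fun x y => s_ (lie (sgn_deg (s_inv x)) (s_inv y))).

(* The differential d + [phi, -], on elements of degree c. *)
Definition twisted_diff (c : int) (mu : multiop (susp g)) : multiop (susp g) :=
  fun v => commutator (-1) c sd mu v + commutator (-1) c phi mu v.

Definition rmul (lambda mu : multiop (susp g)) : multiop (susp g) :=
  prelie mu lambda.

Definition prelie_exp (lambda : multiop (susp g)) : multiop (susp g) := fun v =>
  infsum sfilt predT
    (fun n : nat => n`!%:R^-1 *: iter n (rmul lambda) (unary id) v).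

Definition ambient_act (lambda : multiop (susp g)) (alpha : g) : g :=
  s_inv (infsum sfilt (fun n : nat => (1 <= n)%N)
    (fun n => n`!%:R^-1 *: prelie_exp lambda (nseq n (s_ alpha)))).

Definition f_ (lambda f : multiop (susp g)) (alpha : g) (i : nat) : g :=
  s_inv (i.-1`!%:R^-1 *: infsum sfilt (fun n : nat => (2 <= n)%N)
    (fun n => n`!%:R^-1 *: iter i.-1 (rmul lambda) f (nseq n (s_ alpha)))).

Definition descents (n : nat) (tau : 'S_n) : nat :=
  #|[pred j : 'I_n | [exists l : 'I_n, (l == j.+1 :> nat) && (tau l < tau j)%N]]|.

(* The coefficient in brackets, for n = m + 1 and i = (i_1, ..., i_n). *)
Definition xi_coef (m : nat) (i : m.+1.-tuple nat) : k :=
  m.+1%:R^-1 *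
  \sum_(rho : 'S_m.+1 | rho ord0 == ord0)
    ((-1) ^+ descents (rho^-1)%g / 'C(m, descents (rho^-1)%g)%:R *
     \prod_(j < m.+1)
       ((\sum_(l < m.+1 | (l <= j)%N) tnth i (rho l))%N%:R)^-1).

(* ad_(F i_n) ... ad_(F i_2) (F i_1) *)
Definition iterated_ad (F : nat -> g) (m : nat) (i : m.+1.-tuple nat) : g :=
  foldl (fun y l => lie (F l) y) (F (thead i)) (behead i).

Definition xi (lambda f : multiop (susp g)) (alpha : g) : g :=
  infsum (@filt k g) predT (fun m : nat =>
    infsum (@filt k g) (fun i : m.+1.-tuple nat => all (leq 1) i)
      (fun i => xi_coef i *: iterated_ad (f_ lambda f alpha) i)).

(* gbar = g (+) k delta; the term - y.2 *: ... comes from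
   [x, delta] = - (-1)^|x| [delta, x]. *)
Definition gbar : lmodType k := (g * k^o)%type.

Definition delta : gbar := (0, 1).
Definition to_gbar (x : g) : gbar := (x, 0).

Definition lie_bar (x y : gbar) : gbar :=
  (lie x.1 y.1 + x.2 *: dgd g y.1 - y.2 *: dgd g (sgn_deg x.1), 0).

Definition filt_bar (n : nat) (x : gbar) : Prop := filt n x.1 /\ x.2 = 0.

Definition exp_ad (x : g) (y : gbar) : gbar :=
  infsum filt_bar predT
    (fun n : nat => n`!%:R^-1 *: iter n (lie_bar (to_gbar x)) y).

End MaurerCartan.

(* Main.v *)
(** Let x' = λ(x), x(0) = α be the flow of the vector field attached to λ.  Taylor
    expansion along it gives x(1) = λ.α and f(x(t)) = Σ t^(i-1) f_i.
    Since λ = ∂^φ f and Maurer-Cartan elements are the zeros of the curvature,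
    a(t) = δ + x(t) satisfies the linear equation a' = [Σ t^(i-1) f_i, a], so
    that a(1) is obtained from a(0) = δ + α by a chronological exponential, and
    ξ has to be its logarithm.

    Let Y(u) be the chronological exponential on [u, 1] of A(t) = Σ t^(i-1) x_i,
    a noncommutative series in letters x_i, so that Y' = - Y A and Y(1) = 1.
    Its logarithm is the solution of Ω' = - ψ(ad Ω) A with Ω(1) = 0, where
    ψ(log Y) = Y log Y / (Y - 1) is the integral over s in [0, 1] of
    P_s = Y / (1 + s (Y - 1)).  As A(u) carries the smallest time, this writes
    Ω(0) as a sum of brackets in which the innermost letter has the smallest time.
    Finally P_s solves the Riccati equation P' = - P A (1 - s P), whose solution
    is the sum over all orderings of the times, weighted by (-s)^d (1-s)^(p-d)
    for d descents; integrating over s gives (-1)^d / ((p+1) binom(p, d)).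

    All identities in g are proved modulo each term of the filtration. *)

Require Import Defs.
From HB Require Import structures.
From mathcomp Require Import all_boot all_order all_algebra all_fingroup.
From mathcomp Require Import boolp classical_sets functions.
From mathcomp Require Import ring zify.

Set Implicit Arguments.
Unset Strict Implicit.
Unset Printing Implicit Defensive.

Import GRing.Theory.

Local Open Scope ring_scope.

(** * Noncommutative series *)

(** On elements of degree 0 of sg, an operation of arity at least N takes values in F_N. Modulo F_N
    the flow is therefore a polynomial function of t, over any field of characteristic zero, and
    primitives, Taylor's formula and uniqueness of solutions become algebra. The suspension puts sα
    in degree 0, where Koszul signs are trivial. Evaluating ∂^φ f = λ at x, with η = f(x), gives
    λ(x) = [η, x] - dη plus the derivative of f along the curvature; as [η, δ] = -dη, the first two
    terms are [η, δ + x]. Brackets of letters satisfy linear relations, so a bracket expansion of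
    log Y cannot be identified coefficient by coefficient. Instead Ω is defined by brackets, through
    Ω' = - ψ A with ψ computed from Y itself, and e^Ω = Y is proved by induction on the length of
    words. What makes this work is that a sum of brackets Ω, evaluated as a series at the operators
    ad x_i, is ad Ω. The same principle for the operators ad f_i on the extended algebra transfers
    the result to g. *)

Definition ncs (I : Type) (C : comNzRingType) := seq I -> C.

Section NcSeries.

Variables (I : Type) (C : comNzRingType).
Notation S := (ncs I C).

HB.instance Definition _ := GRing.Zmodule.copy S (seq I -> C).

Definition ncs_scale (a : C) (c : S) : S := fun w => a * c w.

Fact ncs_scaleA a b c : ncs_scale a (ncs_scale b c) = ncs_scale (a * b) c.
Proof. by apply/funext => w; rewrite /ncs_scale mulrA. Qed.
Fact ncs_scale1 c : ncs_scale 1 c = c.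
Proof. by apply/funext => w; rewrite /ncs_scale mul1r. Qed.
Fact ncs_scaleDr : right_distributive ncs_scale +%R.
Proof. by move=> a c c'; apply/funext => w; rewrite /ncs_scale mulrDr. Qed.
Fact ncs_scaleDl c : {morph ncs_scale^~ c : a b / a + b}.
Proof. by move=> a b; apply/funext => w; rewrite /ncs_scale mulrDl. Qed.

HB.instance Definition _ := GRing.Zmodule_isLmodule.Build C S
  ncs_scaleA ncs_scale1 ncs_scaleDr ncs_scaleDl.

Lemma ncsD (c c' : S) w : (c + c') w = c w + c' w. Proof. by []. Qed.
Lemma ncsN (c : S) w : (- c) w = - c w. Proof. by []. Qed.
Lemma ncsB (c c' : S) w : (c - c') w = c w - c' w. Proof. by []. Qed.
Lemma ncsZ a (c : S) w : (a *: c) w = a * c w. Proof. by []. Qed.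

Lemma ncs_sum (T : Type) (r : seq T) (P : pred T) (F : T -> S) w :
  (\sum_(i <- r | P i) F i) w = \sum_(i <- r | P i) F i w.
Proof. by elim/big_rec2: _ => [|i x y _ <-]. Qed.

Definition shift (j : I) (c : S) : S := fun w => c (j :: w).

(* Words list the letters in the order in which they act, so that (c c')(w) is the
   sum of c(w2) c'(w1) over the factorizations w = w1 w2. *)
Fixpoint ncs_mul (c c' : S) (w : seq I) : C :=
  if w is j :: w' then c w * c' [::] + ncs_mul c (shift j c') w'
  else c [::] * c' [::].

Definition ncs_one : S := fun w => if w is [::] then 1 else 0.

Fact ncs_mulDl : left_distributive (ncs_mul : S -> S -> S) +%R.
Proof.
move=> a b c; apply/funext => w; elim: w c => [|j w IH] c /=.
  by rewrite !ncsD mulrDl.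
by rewrite !ncsD IH /= mulrDl addrACA.
Qed.

Fact ncs_mulDr : right_distributive (ncs_mul : S -> S -> S) +%R.
Proof.
move=> a b c; apply/funext => w; elim: w b c => [|j w IH] b c /=.
  by rewrite !ncsD mulrDr.
by rewrite !ncsD (IH (shift j b) (shift j c)) mulrDr addrACA.
Qed.

Lemma ncs_mulZl a (c c' : S) : ncs_mul (a *: c) c' = a *: (ncs_mul c c' : S).
Proof.
apply/funext => w; elim: w c' => [|j w IH] c' /=; first by rewrite !ncsZ mulrA.
by rewrite !ncsZ IH /= mulrDr mulrA.
Qed.

Lemma ncs_mulZr a (c c' : S) : ncs_mul c (a *: c') = a *: (ncs_mul c c' : S).
Proof.
apply/funext => w; elim: w c' => [|j w IH] c' /=.
  by rewrite !ncsZ mulrCA.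
by rewrite !ncsZ (IH (shift j c')) /= mulrDr mulrCA.
Qed.

Lemma shift_mul j (c c' : S) :
  shift j (ncs_mul c c') = c' [::] *: shift j c + (ncs_mul c (shift j c') : S).
Proof. by apply/funext => w; rewrite /shift /= ncsD ncsZ mulrC. Qed.

Fact ncs_mulA : associative (ncs_mul : S -> S -> S).
Proof.
move=> a b c; apply/funext => w; elim: w c => [|j w IH] c /=; first exact: mulrA.
rewrite shift_mul ncs_mulDr !ncsD IH ncs_mulZr ncsZ mulrDl -!mulrA addrA.
by rewrite [c [::] * _]mulrC.
Qed.

Lemma ncs_mulr0 (c : S) : ncs_mul c 0 = 0.
Proof. by have := ncs_mulZr 0 c 0; rewrite !scale0r. Qed.

Fact ncs_mul1l : left_id ncs_one (ncs_mul : S -> S -> S).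
Proof.
move=> c; apply/funext => w; elim: w c => [|j w IH] c /=; first exact: mul1r.
by rewrite IH mul0r add0r.
Qed.

Fact ncs_mulr1 : right_id ncs_one (ncs_mul : S -> S -> S).
Proof.
move=> c; apply/funext => -[|j w] /=; first exact: mulr1.
by rewrite mulr1 (_ : shift j ncs_one = 0) // ncs_mulr0 addr0.
Qed.

Fact ncs_one_neq0 : (ncs_one : S) != 0.
Proof.
by apply/eqP => /(congr1 (fun c : S => c [::]))/eqP; rewrite /= oner_eq0.
Qed.

HB.instance Definition _ := GRing.Zmodule_isNzRing.Build S
  ncs_mulA ncs_mul1l ncs_mulr1 ncs_mulDl ncs_mulDr ncs_one_neq0.

Fact ncs_scalerAl a (c c' : S) : a *: (c * c') = (a *: c) * c'.
Proof. by rewrite [RHS]ncs_mulZl. Qed.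
HB.instance Definition _ := GRing.Lmodule_isLalgebra.Build C S ncs_scalerAl.
Fact ncs_scalerAr a (c c' : S) : a *: (c * c') = c * (a *: c').
Proof. by rewrite [RHS]ncs_mulZr. Qed.
HB.instance Definition _ := GRing.Lalgebra_isAlgebra.Build C S ncs_scalerAr.

Lemma ncs_nilM (c c' : S) : (c * c') [::] = c [::] * c' [::].
Proof. by []. Qed.

Lemma ncs_consM (c c' : S) j w :
  (c * c') (j :: w) = c (j :: w) * c' [::] + (c * shift j c') w.
Proof. by []. Qed.

Lemma ncs1E w : (1 : S) w = if w is [::] then 1 else 0.
Proof. by []. Qed.

Lemma shiftM j (c c' : S) :
  shift j (c * c') = c' [::] *: shift j c + c * shift j c'.
Proof. exact: shift_mul. Qed.

Lemma ncsME (c c' : S) w :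
  (c * c') w = \sum_(i < (size w).+1) c (drop i w) * c' (take i w).
Proof.
elim: w c' => [|j w IH] c'; first by rewrite big_ord_recl big_ord0 addr0.
by rewrite ncs_consM IH [RHS]big_ord_recl.
Qed.

(** The n-th power of the augmentation ideal, up to completion: congruences modulo [ordge n] play
    the role of truncation at length n. *)
Definition ordge (n : nat) (c : S) := forall w, (size w < n)%N -> c w = 0.

Lemma ordge0 c : ordge 0 c. Proof. by []. Qed.

Lemma ordge_zero n : ordge n 0. Proof. by []. Qed.

Lemma ordgeW m n c : (n <= m)%N -> ordge m c -> ordge n c.
Proof. by move=> nm h w wn; apply: h; apply: leq_trans nm. Qed.

Lemma ordgeP n a (c c' : S) : ordge n c -> ordge n c' -> ordge n (a *: c + c').
Proof. by move=> h h' w wn; rewrite ncsD ncsZ h // h' // mulr0 addr0. Qed.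

Lemma ordgeM m n c c' : ordge m c -> ordge n c' -> ordge (m + n) (c * c').
Proof.
move=> h h' w wmn; rewrite ncsME big1 // => i _.
have iw : (i <= size w)%N by rewrite -ltnS.
have [ni|ni] := ltnP i n; first by rewrite h' ?mulr0 // size_takel.
rewrite h ?mul0r // size_drop ltn_subLR //.
by rewrite addnC (leq_trans wmn) // leq_add2l.
Qed.

Lemma ordgeX n c m : ordge n c -> ordge (m * n) (c ^+ m).
Proof.
by move=> h; elim: m => [|m IH]; rewrite ?exprS ?mulSn //; apply: ordgeM.
Qed.

End NcSeries.

(** * Evaluation of series on filtered modules *)

Section Submod.

Variables (C : comNzRingType) (V : lmodType C).

(** Submodules as predicates, so that terms of a filtration, homogeneous components and ideals of
    series share one set of lemmas; a congruence is written [F (x - y)]. *)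
Definition submod (F : V -> Prop) :=
  F 0 /\ forall a x y, F x -> F y -> F (a *: x + y).

Variable F : V -> Prop.
Hypothesis hF : submod F.

Lemma submod0 : F 0. Proof. exact: hF.1. Qed.

Lemma submodD x y : F x -> F y -> F (x + y).
Proof. by move=> hx hy; rewrite -[x]scale1r; apply: hF.2. Qed.

Lemma submodZ a x : F x -> F (a *: x).
Proof. by move=> hx; rewrite -[_ *: x]addr0; apply: hF.2 => //; apply: submod0. Qed.

Lemma submodN x : F x -> F (- x).
Proof. by rewrite -scaleN1r; apply: submodZ. Qed.

Lemma submodB x y : F x -> F y -> F (x - y).
Proof. by move=> hx hy; apply: submodD => //; apply: submodN. Qed.

Lemma submodC x y : F (x - y) -> F (y - x).
Proof. by move/submodN; rewrite opprB. Qed.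

Lemma submod_trans y x z : F (x - y) -> F (y - z) -> F (x - z).
Proof. by move=> hx hy; rewrite -(subrK y x) -addrA; apply: submodD. Qed.

Lemma submod_eq x y : x = y -> F (x - y).
Proof. by move->; rewrite subrr; apply: submod0. Qed.

Lemma submod_congl x y : F (x - y) -> F y -> F x.
Proof. by move=> h hy; rewrite -(subrK y x); apply: submodD. Qed.

Lemma submod_congD x x' y y' : F (x - x') -> F (y - y') -> F (x + y - (x' + y')).
Proof. by move=> h h'; rewrite opprD addrACA; apply: submodD. Qed.

Lemma submod_congZ a x y : F (x - y) -> F (a *: x - a *: y).
Proof. by rewrite -scalerBr; apply: submodZ. Qed.

Lemma submod_sum (T : eqType) (r : seq T) (P : pred T) (G : T -> V) :
  (forall i, i \in r -> P i -> F (G i)) -> F (\sum_(i <- r | P i) G i).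
Proof.
move=> h; rewrite big_seq_cond; elim/big_rec: _ => [|i x /andP[ir Pi] hx].
  exact: submod0.
by apply: submodD => //; apply: h.
Qed.

Lemma submod_congsum (T : eqType) (r : seq T) (P : pred T) (G H : T -> V) :
  (forall i, i \in r -> P i -> F (G i - H i)) ->
  F (\sum_(i <- r | P i) G i - \sum_(i <- r | P i) H i).
Proof. by move=> h; rewrite -sumrB; apply: submod_sum. Qed.

End Submod.

Lemma ordge_submod (I : Type) (C : comNzRingType) n :
  submod (@ordge I C n).
Proof. by split; [apply: ordge_zero | move=> a x y; apply: ordgeP]. Qed.

Record filtration (C : comNzRingType) (V : lmodType C) (F : nat -> V -> Prop) :
    Prop := Filtration {
  fl_sub : forall n, submod (F n);
  fl_desc : forall n x, F n.+1 x -> F n x }.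

Lemma fl_leq (C : comNzRingType) (V : lmodType C) (F : nat -> V -> Prop) m n x :
  filtration F -> (m <= n)%N -> F n x -> F m x.
Proof.
move=> hF; elim: n => [|n IH]; first by rewrite leqn0 => /eqP->.
by rewrite leq_eqVlt => /predU1P[->//|]; rewrite ltnS => mn /(fl_desc hF); apply: IH.
Qed.

Lemma ordge_filtration (I : Type) (C : comNzRingType) :
  filtration (@ordge I C).
Proof.
split=> [n|n c h]; first exact: ordge_submod.
exact: ordgeW h.
Qed.

Section Evaluation.

Variables (I : finType) (C : comNzRingType) (V : lmodType C).
Variable (X : I -> {linear V -> V}).
Notation S := (ncs I C).

(* The sum of c(w) X_w v over the words w of length < n (see ev_words). *)
Fixpoint ev (n : nat) (c : S) (v : V) : V :=
  if n is n'.+1 then c [::] *: v + \sum_j ev n' (shift j c) (X j v) else 0.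

Lemma ev_linear n a (c c' : S) v : ev n (a *: c + c') v = a *: ev n c v + ev n c' v.
Proof.
elim: n c c' v => [|n IH] c c' v /=; first by rewrite scaler0 addr0.
rewrite ncsD ncsZ scalerDl scalerDr scalerA -!addrA; congr (_ + _).
rewrite addrCA; congr (_ + _); rewrite scaler_sumr -big_split /=.
by apply: eq_bigr => j _; rewrite -IH.
Qed.

Lemma ev_linearr n a c v w : ev n c (a *: v + w) = a *: ev n c v + ev n c w.
Proof.
elim: n c v w => [|n IH] c v w /=; first by rewrite scaler0 addr0.
rewrite !scalerDr !scalerA mulrC -!addrA; congr (_ + _).
rewrite addrCA; congr (_ + _); rewrite scaler_sumr -big_split /=.
by apply: eq_bigr => j _; rewrite linearP IH.
Qed.

Lemma ev0 n v : ev n 0 v = 0.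
Proof. by have := ev_linear n (-1) 0 0 v; rewrite scaler0 addr0 scaleN1r addNr. Qed.

Lemma evZ n a c v : ev n (a *: c) v = a *: ev n c v.
Proof. by rewrite -[a *: c]addr0 ev_linear ev0 addr0. Qed.

Lemma evD n c c' v : ev n (c + c') v = ev n c v + ev n c' v.
Proof. by rewrite -[c]scale1r ev_linear !scale1r. Qed.

Lemma evN n c v : ev n (- c) v = - ev n c v.
Proof. by rewrite -[- c]scaleN1r evZ scaleN1r. Qed.

Lemma evB n c c' v : ev n (c - c') v = ev n c v - ev n c' v.
Proof. by rewrite evD evN. Qed.

Lemma ev_sum n (T : Type) (r : seq T) (P : pred T) (G : T -> S) v :
  ev n (\sum_(i <- r | P i) G i) v = \sum_(i <- r | P i) ev n (G i) v.
Proof.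
by elim/big_rec2: _ => [|i x y _ <-]; rewrite ?ev0 ?evD.
Qed.

Lemma evr0 n c : ev n c 0 = 0.
Proof. by have := ev_linearr n (-1) c 0 0; rewrite scaler0 addr0 scaleN1r addNr. Qed.

Lemma evrZ n a c v : ev n c (a *: v) = a *: ev n c v.
Proof. by rewrite -[a *: v]addr0 ev_linearr evr0 addr0. Qed.

Lemma evrD n c v w : ev n c (v + w) = ev n c v + ev n c w.
Proof. by rewrite -[v]scale1r ev_linearr !scale1r. Qed.

Lemma evrN n c v : ev n c (- v) = - ev n c v.
Proof. by rewrite -[- v]scaleN1r evrZ scaleN1r. Qed.

Lemma evrB n c v w : ev n c (v - w) = ev n c v - ev n c w.
Proof. by rewrite evrD evrN. Qed.

Lemma evr_sum n c (T : Type) (r : seq T) (P : pred T) (G : T -> V) :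
  ev n c (\sum_(i <- r | P i) G i) = \sum_(i <- r | P i) ev n c (G i).
Proof.
by elim/big_rec2: _ => [|i x y _ <-]; rewrite ?evr0 ?evrD.
Qed.

Lemma ev_words n c v : ev n c v =
  \sum_(m < n) \sum_(w : m.-tuple I) c w *: foldl (fun y j => X j y) v w.
Proof.
elim: n c v => [|n IH] c v /=; first by rewrite big_ord0.
rewrite big_ord_recl; congr (_ + _).
  rewrite (big_pred1 [tuple]) //= => w; rewrite (tuple0 w) /=.
  by rewrite [RHS]eqxx.
under eq_bigr => j _ do rewrite IH.
rewrite exchange_big; apply: eq_bigr => m _ /=.
rewrite pair_big /=.
rewrite (reindex (fun w : (m.+1).-tuple I => (thead w, [tuple of behead w]))) /=.
  by apply: eq_bigr => w _; case/tupleP: w => j w.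
exists (fun p : I * m.-tuple I => [tuple of p.1 :: p.2]) => [w _|[j w] _] /=.
  by rewrite [RHS](tuple_eta w).
by congr pair; apply: val_inj.
Qed.

Lemma ev_one n v : ev n.+1 1 v = v.
Proof. by rewrite /= scale1r big1 ?addr0 // => j _; rewrite (_ : shift j 1 = 0) ?ev0. Qed.

Variable F : nat -> V -> Prop.
Hypothesis hF : filtration F.
Hypothesis FX : forall j n v, F n v -> F n.+1 (X j v).

Lemma ev_filt n c m p v : ordge p c -> F m v -> F (m + p) (ev n c v).
Proof.
elim: n c m p v => [|n IH] c m p v cp Fv /=; first exact: (submod0 (fl_sub hF _)).
apply: (submodD (fl_sub hF _)).
  case: p cp => [|p] cp; last by rewrite (cp [::]) // scale0r; apply: (submod0 (fl_sub hF _)).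
  by rewrite addn0; apply: submodZ => //; apply: fl_sub.
apply: (submod_sum (fl_sub hF _)) => j _ _.
case: p cp => [|p] cp.
  rewrite addn0; apply: (fl_desc hF); rewrite -[m.+1]addn0; apply: IH => //.
  exact: FX.
by rewrite addnS -addSn; apply: IH; [move=> w wp; apply: cp | apply: FX].
Qed.

Lemma ev_filt0 n c m v : F m v -> F m (ev n c v).
Proof. by move=> h; rewrite -[m]addn0; apply: ev_filt. Qed.

Lemma ev_more n p c m v : F m v -> F (m + n) (ev (n + p) c v - ev n c v).
Proof.
elim: n c m v => [|n IH] c m v Fv /=.
  by rewrite subr0 addn0; apply: ev_filt0.
rewrite opprD addrACA subrr add0r -sumrB.
apply: (submod_sum (fl_sub hF _)) => j _ _.
by rewrite addnS -addSn; apply: IH; apply: FX.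
Qed.

(** Truncation is not multiplicative: the composite also contains concatenations of length at least
    n of two shorter words. Each letter raises the filtration by one, so these lie in
    [F (m + n)]. *)
Lemma evM n c c' m v : F m v -> F (m + n) (ev n (c * c') v - ev n c (ev n c' v)).
Proof.
elim: n c' m v => [|n IH] c' m v Fv.
  by rewrite /= subrr; apply: (submod0 (fl_sub hF _)).
have -> : ev n.+1 c (ev n.+1 c' v) = c' [::] *: ev n.+1 c v +
    \sum_j ev n.+1 c (ev n (shift j c') (X j v)).
  by rewrite {2}/ev -/ev ev_linearr evr_sum.
have -> : ev n.+1 (c * c') v = c' [::] *: ev n.+1 c v +
    \sum_j ev n (c * shift j c') (X j v).
  rewrite /= scalerDr scalerA mulrC -addrA; congr (_ + _).
  rewrite scaler_sumr -big_split; apply: eq_bigr => j _ /=.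
  by rewrite shiftM ev_linear.
rewrite opprD addrACA subrr add0r -sumrB.
apply: (submod_sum (fl_sub hF _)) => j _ _.
have FXv := FX j Fv; rewrite addnS -addSn.
apply: (submod_trans (fl_sub hF _) (IH _ _ _ FXv)).
apply: (submodC (fl_sub hF _)); rewrite -(addn1 n).
by apply: ev_more; apply: ev_filt0.
Qed.

End Evaluation.

(** * Nested brackets of letters and their adjoint action *)

Section Letters.

Variables (I : finType) (C : comNzRingType).
Notation S := (ncs I C).

Definition letter (j : I) : S := fun w => if w is [:: i] then (i == j)%:R else 0.

Definition adl (j : I) (r : S) : S := letter j * r - r * letter j.

Fact adl_linear j : linear (adl j).
Proof.
move=> a x y; rewrite /adl mulrDl mulrDr -scalerAl -scalerAr opprD addrACA.
by rewrite -scalerBr.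
Qed.
HB.instance Definition _ j := GRing.isLinear.Build C S S *:%R (adl j) (adl_linear j).

Lemma ordge_letter j : ordge 1 (letter j).
Proof. by case. Qed.

Lemma ordge_adl j n r : ordge n r -> ordge n.+1 (adl j r).
Proof.
move=> h; apply: (submodB (@ordge_submod _ _ n.+1)); first exact: (ordgeM (@ordge_letter j)).
by rewrite -addn1; apply: (ordgeM h); apply: ordge_letter.
Qed.

Variables (V : lmodType C) (X : I -> {linear V -> V}).

Lemma ev_letter n j v : ev X n.+2 (letter j) v = X j v.
Proof.
rewrite /= scale0r add0r (bigD1 j) //= {1}/shift /= eqxx scale1r.
rewrite !big1 ?addr0 // => i.
  move=> ij; rewrite {1}/shift /= (negbTE ij) scale0r add0r big1 // => l _.
  by rewrite (_ : shift l _ = 0) ?ev0.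
by move=> _; rewrite (_ : shift i _ = 0) ?ev0.
Qed.

Variable F : nat -> V -> Prop.
Hypothesis hF : filtration F.
Hypothesis FX : forall j n v, F n v -> F n.+1 (X j v).

(** [rho] is an action of a Lie algebra L on V, [U j] the bracket with the j-th generator and [X j]
    the action of that generator. The predicate [E] singles out elements, such as those of degree 0,
    for which the Jacobi identity [rho_U] holds without sign. *)
Variables (L : lmodType C) (U : I -> {linear L -> L}) (rho : L -> V -> V).
Hypothesis rho_linear : forall a l l' v, rho (a *: l + l') v = a *: rho l v + rho l' v.
Variable E : L -> Prop.
Hypothesis EU : forall j l, E l -> E (U j l).
Hypothesis rho_U : forall j l v, E l -> rho (U j l) v = X j (rho l v) - rho l (X j v).

(* For rho = ad, the condition that the series b acts as the bracket with l. *)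
Definition represents M (b : S) (l : L) :=
  forall m v, F m v -> F (m + M) (ev X M b v - rho l v).

Lemma rho0 v : rho 0 v = 0.
Proof. by have := rho_linear (-1) 0 0 v; rewrite scaler0 addr0 scaleN1r addNr. Qed.

Lemma represents0 M : represents M 0 0.
Proof.
by move=> m v Fv; rewrite ev0 rho0 subrr; apply: (submod0 (fl_sub hF _)).
Qed.

Lemma representsP M a b b' l l' : represents M b l -> represents M b' l' ->
  represents M (a *: b + b') (a *: l + l').
Proof.
move=> h h' m v Fv; rewrite ev_linear rho_linear.
apply: (submod_congD (fl_sub hF _)); last exact: h'.
by apply: submod_congZ; [apply: fl_sub | apply: h].
Qed.

Lemma represents_sum M (T : Type) (r : seq T) (G : T -> S) (H : T -> L) :
  (forall i, represents M (G i) (H i)) ->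
  represents M (\sum_(i <- r) G i) (\sum_(i <- r) H i).
Proof.
move=> h; elim/big_rec2: _ => [|i x y _ hxy]; first exact: represents0.
by rewrite -[H i]scale1r -[G i]scale1r; apply: representsP.
Qed.

Lemma represents_adl M b l j : (1 < M)%N -> E l -> represents M b l ->
  represents M (adl j b) (U j l).
Proof.
move=> M1 El h m v Fv; rewrite evB rho_U //.
(* With [1 < M] the truncation keeps the words of length one. *)
have eX u : ev X M (letter j) u = X j u by case: M M1 {h} => [|[|M]] // _; apply: ev_letter.
have sF := fl_sub hF (m + M).
apply: (submod_congD sF).
  apply: (submod_trans sF (evM hF FX M _ _ Fv)).
  rewrite eX -linearB; apply: (fl_desc hF); apply: FX; exact: h.
rewrite -opprD; apply: (submodN sF).
apply: (submod_trans sF (evM hF FX M _ _ Fv)).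
rewrite eX; apply: (fl_desc hF); rewrite -addSn; apply: h; exact: FX.
Qed.

(** By the Jacobi identity, representability by a series survives bracketing with a generator. Hence
    the same nested brackets, formed among series and in L, correspond. This is used with L the
    algebra of series and with L = g. *)
Lemma represents_ev M b l n c : (1 < M)%N -> E l -> represents M b l ->
  represents M (ev adl n c b) (ev U n c l).
Proof.
move=> M1; elim: n c b l => [|n IH] c b l El h; first exact: represents0.
apply: representsP => //.
by apply: represents_sum => j; apply: IH; [apply: EU | apply: represents_adl].
Qed.

End Letters.

(** * Integration of polynomials and the logarithm *)

Section Char0.

Variables (k : fieldType) (char0 : [pchar k] =i pred0).

Lemma natr_neq0 n : (n.+1%:R : k) != 0.
Proof. by rewrite ((GRing.pcharf0P _).1 char0). Qed.

Lemma fact_neq0 n : (n`!%:R : k) != 0.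
Proof. by rewrite ((GRing.pcharf0P _).1 char0) -lt0n fact_gt0. Qed.

Lemma factVS n : n.+1%:R * n.+1`!%:R^-1 = n`!%:R^-1 :> k.
Proof. by rewrite factS natrM invfM mulrA divff ?mul1r ?natr_neq0. Qed.

(** The constant coefficient is a division by 0, hence 0: this is the primitive that vanishes at
    0. *)
Definition prim (p : {poly k}) : {poly k} :=
  \poly_(i < (size p).+1) (p`_i.-1 / i%:R).

Lemma coef_prim p i : (prim p)`_i = p`_i.-1 / i%:R.
Proof.
rewrite coef_poly; case: ltnP => // pi.
by case: i pi => // i pi; rewrite nth_default ?mul0r.
Qed.

Lemma deriv_prim p : (prim p)^`() = p.
Proof.
apply/polyP => i; rewrite coef_deriv coef_prim /= -[LHS]mulr_natr mulfVK //.
exact: natr_neq0.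
Qed.

Lemma prim0 p : (prim p).[0] = 0.
Proof. by rewrite horner_coef0 coef_prim invr0 mulr0. Qed.

Lemma deriv_eq0 (p : {poly k}) : p^`() = 0 -> p = (p`_0)%:P.
Proof.
move=> h; apply/polyP => -[|i]; rewrite coefC //=.
have := congr1 (fun q : {poly k} => q`_i) h.
by rewrite coef_deriv coef0 -mulr_natr => /eqP; rewrite mulf_eq0 (negbTE (natr_neq0 i)) orbF => /eqP.
Qed.

Lemma deriv_inj x (p q : {poly k}) : p^`() = q^`() -> p.[x] = q.[x] -> p = q.
Proof.
move=> hd hx; apply/eqP; rewrite -subr_eq0; apply/eqP.
have h : p - q = ((p - q)`_0)%:P by apply: deriv_eq0; rewrite derivB hd subrr.
have : (p - q).[x] = 0 by rewrite hornerD hornerN hx subrr.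
by rewrite h hornerC => ->.
Qed.

(* The integral of p from the variable to 1. *)
Definition itail (p : {poly k}) : {poly k} := (prim p).[1]%:P - prim p.

Lemma deriv_itail p : (itail p)^`() = - p.
Proof. by rewrite derivB derivC deriv_prim sub0r. Qed.

Lemma itail1 p : (itail p).[1] = 0.
Proof. by rewrite hornerD hornerN hornerC subrr. Qed.

Lemma itail_unique p q : q^`() = - p -> q.[1] = 0 -> q = itail p.
Proof. by move=> h h1; apply: (deriv_inj (x := 1)); rewrite ?deriv_itail ?itail1. Qed.

Lemma itail_linear : linear itail.
Proof.
move=> a p q; apply/esym/itail_unique.
  by rewrite derivD derivZ !deriv_itail scalerN opprD.
by rewrite hornerD hornerZ !itail1 mulr0 addr0.
Qed.

HB.instance Definition _ :=
  GRing.isLinear.Build k {poly k} {poly k} *:%R itail itail_linear.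

Lemma dvdXn_coefP m (p : {poly k}) :
  reflect (forall i, (i < m)%N -> p`_i = 0) ('X^m %| p).
Proof.
apply: (iffP idP) => [/dvdpP[q ->] i im|h]; first by rewrite coefMXn im.
rewrite -(poly_take_drop m p) (_ : take_poly m p = 0) ?add0r ?dvdp_mull //.
by apply/polyP => i; rewrite coef_take_poly coef0; case: ifP => // /h.
Qed.

Lemma dvdXn_deriv m (p : {poly k}) : 'X^m %| p^`() -> p`_0 = 0 -> 'X^(m.+1) %| p.
Proof.
move=> /dvdXn_coefP h p0; apply/dvdXn_coefP => -[|i] im //.
have /eqP := h i im; rewrite coef_deriv -mulr_natr mulf_eq0.
by rewrite (negbTE (natr_neq0 i)) orbF => /eqP.
Qed.

Definition expp M : {poly k} := \sum_(n < M) n`!%:R^-1 *: 'X^n.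

(* Truncations of (1 - e^-X) / X and, for psip, of its inverse
   e^X log(e^X) / (e^X - 1). *)
Definition phip M : {poly k} := \sum_(b < M) b.+1`!%:R^-1 *: (- 'X) ^+ b.

Definition psip M : {poly k} :=
  \sum_(j < M) ((-1) ^+ j / j.+1%:R) *: ((expp M - 1) ^+ j * expp M).

Lemma deriv_expp M : (expp M.+1)^`() = expp M.
Proof.
rewrite /expp raddf_sum big_ord_recl /= expr0 derivZ derivC scaler0 add0r.
apply: eq_bigr => i _; rewrite derivZ derivXn /= -scaler_nat scalerA mulrC.
by rewrite factVS.
Qed.

Lemma expp_cong M : 'X^M %| expp M.+1 - expp M.
Proof. by rewrite /expp big_ord_recr /= addrAC subrr add0r dvdpZr ?invr_eq0 ?fact_neq0. Qed.

Lemma coef0_expp M : (expp M.+1)`_0 = 1.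
Proof.
rewrite /expp big_ord_recl coefD coef_sum big1 ?addr0 => [|i _].
  by rewrite coefZ coefXn mulr1 invr1.
by rewrite coefZ coefXn mulr0.
Qed.

(** The derivative of e^X e^(-X) is zero up to the top term that truncation loses under
    differentiation, which is divisible by X^M. *)
Lemma expp_opp M : 'X^(M.+1) %| expp M.+1 * (expp M.+1 \Po (- 'X)) - 1.
Proof.
apply: dvdXn_deriv; last first.
  rewrite -horner_coef0 !hornerE horner_comp !hornerE oppr0 horner_coef0 coef0_expp.
  by rewrite mulr1 subrr.
rewrite derivB derivC subr0 derivM deriv_comp derivN derivX mulrN1 deriv_expp.
have -> : expp M * (expp M.+1 \Po - 'X) + expp M.+1 * - (expp M \Po - 'X) =
   expp M.+1 * ((expp M.+1 - expp M) \Po - 'X) - (expp M.+1 - expp M) * (expp M.+1 \Po - 'X).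
  rewrite comp_polyB; ring.
apply: dvdp_sub; last by apply: dvdp_mulr; apply: expp_cong.
apply: dvdp_mull; have /dvdpP[q ->] := expp_cong M.
by rewrite comp_polyM comp_Xn_poly exprNn mulrA dvdp_mull.
Qed.

Lemma X_phip M : 'X * phip M = 1 - (expp M.+1 \Po - 'X).
Proof.
rewrite /expp raddf_sum big_ord_recl /= comp_polyZ expr0 comp_polyC.
rewrite invr1 scale1r opprD addrA subrr add0r -sumrN mulr_sumr.
apply: eq_bigr => i _; rewrite comp_polyZ comp_Xn_poly exprS mulNr scalerN opprK.
by rewrite scalerAr.
Qed.

Lemma geometric_expp M n :
  expp M * \sum_(j < n) (-1) ^+ j *: (expp M - 1) ^+ j = 1 - (1 - expp M) ^+ n.
Proof.
have -> : \sum_(j < n) (-1) ^+ j *: (expp M - 1) ^+ j = \sum_(j < n) (1 - expp M) ^+ j.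
  apply: eq_bigr => j _; rewrite -[1 - expp M]opprB [RHS]exprNn -mul_polyC.
  by rewrite polyC_exp polyCN polyC1.
by rewrite -[RHS]opprB subrX1 -mulNr; congr (_ * _); ring.
Qed.

Lemma dvdX_expp M : 'X %| 1 - expp M.+1.
Proof.
by rewrite -['X]expr1; apply/dvdXn_coefP => -[|//] _; rewrite coefB coef1 coef0_expp subrr.
Qed.

(** The sum is log(e^X). Its derivative is e^X times a geometric sum for e^(-X), that is 1 up to a
    power of 1 - e^X, and X divides 1 - e^X. *)
Lemma log_expp M :
  'X^(M.+1) %| \sum_(j < M.+1) ((-1) ^+ j / j.+1%:R) *: (expp M.+1 - 1) ^+ j.+1 - 'X.
Proof.
apply: dvdXn_deriv; last first.
  rewrite coefB coefX subr0 coef_sum big1 // => i _.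
  rewrite coefZ exprS -horner_coef0 hornerM hornerD hornerN hornerC horner_coef0.
  by rewrite coef0_expp subrr mul0r mulr0.
rewrite derivB derivX raddf_sum.
have -> : \sum_(j < M.+1) (((-1) ^+ j / j.+1%:R) *: (expp M.+1 - 1) ^+ j.+1)^`() =
    expp M * \sum_(j < M.+1) (-1) ^+ j *: (expp M.+1 - 1) ^+ j.
  rewrite mulr_sumr; apply: eq_bigr => j _.
  rewrite derivZ deriv_exp derivB derivC subr0 deriv_expp /= -scaler_nat scalerA.
  by rewrite mulfVK ?natr_neq0 // scalerAr.
set L := \sum_(_ < _) _.
have -> : expp M * L - 1 = (expp M.+1 * L - 1) - (expp M.+1 - expp M) * L by ring.
rewrite geometric_expp; apply: dvdp_sub; last by rewrite dvdp_mulr ?expp_cong.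
rewrite addrAC subrr sub0r -mulN1r exprSr dvdp_mull // dvdp_mulr //.
exact/dvdp_exp2r/dvdX_expp.
Qed.

(** Multiplied by X, the claim reads (1 - e^(-X)) e^X L = (e^X - 1) L = log(e^X) = X modulo X^(M+1);
    cancelling X costs one power. *)
Lemma phip_psip M : exists r, phip M.+1 * psip M.+1 = 1 + 'X^M * r.
Proof.
suff /dvdpP[r hr] : 'X^M %| phip M.+1 * psip M.+1 - 1.
  by exists r; rewrite ['X^M * r]mulrC -hr addrC subrK.
rewrite -(dvdp_mul2l _ _ (negbT (polyX_eq0 k))) -exprS mulrBr mulr1 mulrA X_phip.
have -> : psip M.+1 = expp M.+1 * \sum_(j < M.+1) ((-1) ^+ j / j.+1%:R) *: (expp M.+1 - 1) ^+ j.
  by rewrite mulr_sumr; apply: eq_bigr => j _; rewrite [RHS]mulrC -scalerAl.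
set e := expp M.+1; set L := \sum_(_ < _) _.
have eL : (e - 1) * L = \sum_(j < M.+1) ((-1) ^+ j / j.+1%:R) *: (e - 1) ^+ j.+1.
  by rewrite mulr_sumr; apply: eq_bigr => j _; rewrite exprS scalerAr.
have -> : (1 - (expp M.+2 \Po - 'X)) * (e * L) - 'X =
  ((e - 1) * L - 'X) - (e * (e \Po - 'X) - 1) * L - (e * L) * ((expp M.+2 - e) \Po - 'X).
  rewrite comp_polyB; ring.
apply: dvdp_sub; first apply: dvdp_sub.
- by rewrite eL; apply: log_expp.
- by apply: dvdp_mulr; apply: expp_opp.
apply: dvdp_mull; have /dvdpP[q ->] := expp_cong M.+1.
by rewrite comp_polyM comp_Xn_poly exprNn mulrA dvdp_mull.
Qed.

End Char0.

(** * Orderings weighted by their descents *)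

Section Descents.

Variables (k : fieldType) (char0 : [pchar k] =i pred0).

(* The integral of t_1^w_1 ... t_n^w_n over u < t_1 < ... < t_n < 1, as a polynomial
   in u. *)
Fixpoint simplex (w : seq nat) : {poly k} :=
  if w is j :: w' then itail ('X^j * simplex w') else 1.

Lemma simplex1 w : w != [::] -> (simplex w).[1] = 0.
Proof. by case: w => // j w _; apply: itail1. Qed.

Lemma deriv_simplex j w : (simplex (j :: w))^`() = - ('X^j * simplex w).
Proof. exact: deriv_itail. Qed.

(** The product of the inverses of i_1 + ... + i_j, in terms of the exponents i - 1 of the times:
    integrating t^c gives the exponent c + 1, which is then added to the next one. *)
Fixpoint partial_sums (c : nat) (w : seq nat) : k :=
  c.+1%:R^-1 * (if w is j :: w' then partial_sums (c + j).+1 w' else 1).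

(** Integration by parts on the smallest time. The boundary terms vanish: at 1 because [simplex] of
    a nonempty word does, at 0 because of the factor t^(c+1). *)
Lemma simplex0 c w : (itail ('X^c * simplex w)).[0] = partial_sums c w.
Proof.
rewrite hornerD hornerN prim0 hornerC subr0.
elim: w c => [|j w IH] c.
  have -> : prim ('X^c * 1) = c.+1%:R^-1 *: 'X^(c.+1) :> {poly k}.
    apply: (deriv_inj char0 (x := 0)).
      rewrite (deriv_prim char0) derivZ derivXn /= mulr1 -scaler_nat scalerA.
      by rewrite mulVf ?scale1r ?natr_neq0.
    by rewrite prim0 hornerZ hornerXn exprS mul0r mulr0.
  by rewrite /= hornerZ hornerXn expr1n.
set p := simplex (j :: w).
have -> : prim ('X^c * p) =
    c.+1%:R^-1 *: ('X^(c.+1) * p + prim ('X^((c + j).+1) * simplex w)).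
  apply: (deriv_inj char0 (x := 0)); last first.
    by rewrite prim0 hornerZ hornerD hornerM hornerXn prim0 exprS mul0r mul0r addr0 mulr0.
  rewrite derivZ derivD !(deriv_prim char0) derivM derivXn deriv_simplex /=.
  rewrite mulrN mulrA -exprD addSn subrK -scaler_nat -scalerAl scalerA.
  by rewrite mulVf ?scale1r ?natr_neq0.
by rewrite hornerZ hornerD hornerM simplex1 // mulr0 add0r IH.
Qed.

Variables (x y : k).

(* The list t enumerates positions by increasing times: a descent of the inverse
   permutation is a position preceded in t by its successor. *)
Definition adj_weight (a b : nat) : k :=
  (if a == b.+1 then x else 1) * (if b == a.+1 then y else 1).

Fixpoint order_weight (t : seq nat) : k :=
  if t is a :: t' then (\prod_(b <- t') adj_weight a b) * order_weight t' else 1.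

Definition order_sum (h : nat -> nat) (s : seq nat) : {poly k} :=
  \sum_(t <- permutations s) order_weight t *: simplex (map h t).

Lemma order_sum_nil h : order_sum h [::] = 1.
Proof. by rewrite /order_sum /permutations /= big_seq1 scale1r. Qed.

(** The orderings are sorted by their first entry, the position of the smallest time. *)
Lemma order_sumE h s : uniq s -> s != [::] -> order_sum h s =
  \sum_(a <- s) (\prod_(b <- s | b != a) adj_weight a b) *:
    itail ('X^(h a) * order_sum h [seq b <- s | b != a]).
Proof.
move=> us s0; rewrite /order_sum (perm_big _ (permutationsE _)) /=; last by case: (s) s0.
rewrite big_allpairs_dep /= undup_id // big_seq [RHS]big_seq.
apply: eq_bigr => a sa; rewrite rem_filter //.
rewrite mulr_sumr raddf_sum scaler_sumr /= big_seq [RHS]big_seq.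
apply: eq_bigr => t; rewrite mem_permutations => ts.
rewrite (perm_big _ ts) big_filter -scalerAr linearZ /= scalerA.
by congr (_ *: _).
Qed.

Lemma order_sum1 h s : uniq s -> s != [::] -> (order_sum h s).[1] = 0.
Proof.
move=> us s0; rewrite order_sumE // horner_sum big1 // => a _.
by rewrite hornerZ itail1 mulr0.
Qed.

(* Differentiating removes the smallest time. *)
Lemma deriv_order_sum h s : uniq s -> (order_sum h s)^`() =
  - \sum_(a <- s) (\prod_(b <- s | b != a) adj_weight a b) *:
    ('X^(h a) * order_sum h [seq b <- s | b != a]).
Proof.
have [->|s0 us] := eqVneq s [::].
  by rewrite order_sum_nil derivC big_nil oppr0.
rewrite order_sumE // raddf_sum -sumrN /=; apply: eq_bigr => a _.
by rewrite derivZ (deriv_itail char0) scalerN.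
Qed.

Lemma size_filter_neq (s : seq nat) a : uniq s -> a \in s ->
  size [seq b <- s | b != a] = (size s).-1.
Proof. by move=> us sa; rewrite -rem_filter // size_rem. Qed.

(** An ordering of the union is a shuffle of two orderings, and no weight links them, so this is the
    shuffle product of iterated integrals. Shuffles are avoided: both sides have the same
    derivative, by induction on the size, and the same value at 1. *)
Lemma order_sum_cat h s1 s2 : uniq (s1 ++ s2) ->
  (forall a b, a \in s1 -> b \in s2 -> adj_weight a b = 1 /\ adj_weight b a = 1) ->
  order_sum h (s1 ++ s2) = order_sum h s1 * order_sum h s2.
Proof.
have [n] := ubnP (size (s1 ++ s2)); elim: n s1 s2 => // n IH s1 s2 sn us sep.
have := us; rewrite cat_uniq => /and3P[u1 /hasPn dis u2].
apply: (deriv_inj char0 (x := 1)); last first.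
  rewrite hornerM; case: (eqVneq s1 [::]) => [->|s10].
    by rewrite order_sum_nil hornerC mul1r.
  rewrite (order_sum1 h u1 s10) mul0r order_sum1 //.
  by case: (s1) s10.
have n1 a : a \in s1 -> [seq b <- s2 | b != a] = s2.
  move=> sa; apply/all_filterP/allP => b sb; apply/eqP => ba; subst b.
  by have := dis _ sb; rewrite sa.
have n2 a : a \in s2 -> [seq b <- s1 | b != a] = s1.
  move=> sa; apply/all_filterP/allP => b sb; apply/eqP => ba; subst b.
  by have := dis _ sa; rewrite sb.
rewrite derivM !deriv_order_sum // big_cat /= opprD mulNr mulrN.
congr (- _ - _).
  rewrite mulr_suml big_seq [RHS]big_seq; apply: eq_bigr => a sa.
  rewrite filter_cat n1 // big_cat /= -[RHS]scalerAl -[in RHS]mulrA; congr (_ *: (_ * _)).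
    rewrite [X in _ * X]big_seq_cond [X in _ * X]big1 ?mulr1 // => b /andP[sb _].
    by have [] := sep a b sa sb.
  apply: IH.
  - have := sn; rewrite !size_cat size_filter_neq // ltnS.
    by case: (s1) sa.
  - by rewrite cat_uniq filter_uniq // u2 andbT; apply/hasPn => b /dis; rewrite mem_filter => /negbTE ->; rewrite andbF.
  by move=> c b; rewrite mem_filter => /andP[_ sc] sb; apply: sep.
rewrite mulr_sumr big_seq [RHS]big_seq; apply: eq_bigr => a sa.
rewrite filter_cat n2 // big_cat /= -[RHS]scalerAr mulrCA; congr (_ *: (_ * _)).
  rewrite [X in X * _]big_seq_cond [X in X * _]big1 ?mul1r // => b /andP[sb _].
  by have [] := sep b a sb sa.
apply: IH.
- have := sn; rewrite !size_cat size_filter_neq // ltnS.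
  by case: (s2) sa => //= b r _; rewrite addnS.
- rewrite cat_uniq u1 filter_uniq // andbT; apply/hasPn => b.
  by rewrite mem_filter => /andP[_ /dis].
by move=> c b sc; rewrite mem_filter => /andP[_ sb]; apply: sep.
Qed.

Lemma order_sum_shift h a s : uniq s ->
  order_sum h (map (addn a) s) = order_sum (fun i => h (a + i)%N) s.
Proof.
have [n] := ubnP (size s); elim: n s => // n IH s sn us.
have [->|s0] := eqVneq s [::]; first by rewrite /= !order_sum_nil.
have s0' : map (addn a) s != [::] by case: (s) s0.
rewrite !order_sumE // ?(map_inj_uniq (@addnI a)) // big_map big_seq [RHS]big_seq.
apply: eq_bigr => b sb; rewrite big_map filter_map.
congr (_ *: itail (_ * _)).
  apply: eq_big => [c|c _]; first by rewrite /= eqn_add2l.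
  by rewrite /adj_weight -!addnS !eqn_add2l.
rewrite (eq_filter (a2 := fun c => c != b)) => [|c]; last by rewrite /= eqn_add2l.
apply: IH; last by rewrite filter_uniq.
rewrite size_filter_neq //; case: (s) sn sb => //.
Qed.

Lemma eq_order_sum h h' s : {in s, h =1 h'} -> order_sum h s = order_sum h' s.
Proof.
move=> hh; rewrite /order_sum big_seq [RHS]big_seq; apply: eq_bigr => t.
rewrite mem_permutations => ts; congr (_ *: simplex _); apply/eq_in_map => b.
by rewrite (perm_mem ts); apply: hh.
Qed.

(** Removing the position q of the smallest time leaves two blocks without adjacent positions, to
    which [order_sum_cat] applies. Position q comes before q - 1, which costs a factor x, and before
    q + 1, which costs a factor y. *)
Lemma deriv_order_sum_iota h n : (order_sum h (iota 0 n))^`() =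
  - \sum_(q < n) ((if (0 < q)%N then x else 1) * (if (q.+1 < n)%N then y else 1)) *:
    ('X^(h q) * (order_sum h (iota 0 q) * order_sum h (iota q.+1 (n - q.+1)))).
Proof.
rewrite deriv_order_sum ?iota_uniq //; congr (- _).
rewrite -{1}(subn0 n) -/(index_iota 0 n) big_mkord; apply: eq_bigr => -[q qn] _ /=.
have En : iota 0 n = iota 0 q ++ q :: iota q.+1 (n - q.+1).
  have {1}-> : n = (q + (n - q.+1).+1)%N by lia.
  by rewrite iotaD add0n.
have Ef : [seq b <- iota 0 n | b != q] = iota 0 q ++ iota q.+1 (n - q.+1).
  rewrite En filter_cat /= eqxx /=; congr (_ ++ _); apply/all_filterP/allP => b.
    by rewrite mem_iota; lia.
  by rewrite mem_iota; lia.
rewrite Ef order_sum_cat; last first.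
- by move=> a b; rewrite !mem_iota /adj_weight => ha hb; split; rewrite !ifN ?mulr1 //; lia.
- by rewrite -Ef filter_uniq ?iota_uniq.
congr (_ *: _).
rewrite -big_filter Ef big_cat /=; congr (_ * _).
  case: (posnP q) => [->|q0]; first by rewrite big_nil.
  rewrite (bigD1_seq q.-1) ?iota_uniq //=; last by rewrite mem_iota; lia.
  rewrite big_seq_cond big1 ?mulr1 => [|b]; last first.
    by rewrite mem_iota /adj_weight => hb; rewrite !ifN ?mulr1 //; lia.
  by rewrite /adj_weight prednK // eqxx ifN ?mulr1 //; lia.
case: ltnP => nq; last by rewrite (_ : n - q.+1 = 0)%N ?big_nil //; lia.
rewrite (bigD1_seq q.+1) ?iota_uniq //=; last by rewrite mem_iota; lia.
rewrite big_seq_cond big1 ?mulr1 => [|b]; last first.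
  by rewrite mem_iota /adj_weight => hb; rewrite !ifN ?mulr1 //; lia.
by rewrite /adj_weight eqxx ifN ?mul1r //; lia.
Qed.

(** The factor y is the weight of an additional position in front of the word with a time smaller
    than all others: the innermost letter of the bracket. *)
Definition descent_sum (w : seq nat) : {poly k} :=
  if w is [::] then 1 else y *: order_sum (nth 0%N w) (iota 0 (size w)).

Lemma descent_sum1 w : w != [::] -> (descent_sum w).[1] = 0.
Proof.
case: w => // j w _.
by rewrite /descent_sum hornerZ order_sum1 ?iota_uniq // mulr0.
Qed.

(** The overall factor y goes to the left-hand word, whose own [descent_sum] absorbs it unless that
    word is empty. For x = -s and y = 1 - s the last factor is thus in both cases the coefficient of
    1 - s P_s, as in the Riccati equation. *)
Lemma deriv_descent_sum w : (descent_sum w)^`() =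
  - \sum_(q < size w) descent_sum (drop q.+1 w) * 'X^(nth 0%N w q) *
     (if take q w is [::] then y%:P else x *: descent_sum (take q w)).
Proof.
case: w => [|j w']; first by rewrite derivC big_ord0 oppr0.
set w := j :: w'; rewrite /(descent_sum w) derivZ deriv_order_sum_iota scalerN.
congr (- _); rewrite scaler_sumr; apply: eq_bigr => q _.
have Et : order_sum (nth 0%N w) (iota 0 q) = order_sum (nth 0%N (take q w)) (iota 0 (size (take q w))).
  rewrite size_takel; last by apply: ltnW; apply: ltn_ord.
  by apply: eq_order_sum => i; rewrite mem_iota => /andP[_ iq]; rewrite nth_take.
have Ed : order_sum (nth 0%N w) (iota q.+1 (size w - q.+1)) =
    order_sum (nth 0%N (drop q.+1 w)) (iota 0 (size (drop q.+1 w))).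
  rewrite size_drop -{1}(addn0 q.+1) iotaDl order_sum_shift ?iota_uniq //.
  by apply: eq_order_sum => i _; rewrite nth_drop.
have sd : size (drop q.+1 w) = (size w - q.+1)%N by rewrite size_drop.
have st : size (take q w) = q by rewrite size_takel //; apply: ltnW; apply: ltn_ord.
rewrite Et Ed -[(q.+1 < size w)%N]subn_gt0 -sd -[X in (0 < X)%N]st.
case: (take q w) => [|a u]; case: (drop q.+1 w) => [|b v] /=;
  rewrite ?order_sum_nil -?mul_polyC ?polyCM ?mul1r ?mulr1; ring.
Qed.

End Descents.

Lemma geometric_sumr (R : nzRingType) (z : R) n :
  (\sum_(j < n) z ^+ j) * (1 - z) = 1 - z ^+ n.
Proof.
elim: n => [|n IH]; first by rewrite big_ord0 mul0r subrr.
by rewrite big_ord_recr mulrDl IH mulrBr mulr1 -exprSr addrA subrK.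
Qed.

(** * Series with coefficients polynomial in time, and their differential equations *)

Section SeriesOverPoly.

Variables (k : fieldType) (char0 : [pchar k] =i pred0) (I : finType) (wt : I -> nat).
Notation S := (ncs I {poly k}).

Definition nderiv (c : S) : S := fun w => (c w)^`().

Fact nderiv_additive : additive nderiv.
Proof. by move=> c c'; apply/funext => w; rewrite /nderiv ncsB derivB. Qed.
HB.instance Definition _ := GRing.isZmodMorphism.Build S S nderiv nderiv_additive.

Lemma nderivB c c' : nderiv (c - c') = nderiv c - nderiv c'.
Proof. exact: raddfB. Qed.
Lemma nderivD c c' : nderiv (c + c') = nderiv c + nderiv c'.
Proof. exact: raddfD. Qed.
Lemma nderiv_sum (T : Type) (r : seq T) (P : pred T) (G : T -> S) :
  nderiv (\sum_(i <- r | P i) G i) = \sum_(i <- r | P i) nderiv (G i).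
Proof. exact: raddf_sum. Qed.

Lemma shift_nderiv j c : shift j (nderiv c) = nderiv (shift j c).
Proof. by []. Qed.

Lemma nderivM (c c' : S) : nderiv (c * c') = nderiv c * c' + c * nderiv c'.
Proof.
apply/funext => w; elim: w c' => [|j w IH] c'.
  by rewrite ncsD !ncs_nilM /nderiv ncs_nilM derivM.
rewrite ncsD !ncs_consM shift_nderiv {1}/nderiv ncs_consM derivD derivM.
have := IH (shift j c'); rewrite {1}/nderiv ncsD => ->.
by rewrite addrACA.
Qed.

Lemma nderivZ (a : k) c : nderiv (a%:P *: c) = a%:P *: nderiv c.
Proof. by apply/funext => w; rewrite /nderiv !ncsZ derivM derivC mul0r add0r. Qed.

Lemma nderiv1 : nderiv 1 = 0.
Proof. by apply/funext => -[|j w]; rewrite /nderiv ncs1E derivC. Qed.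

Definition neval (u : k) (c : S) : ncs I k := fun w => (c w).[u].

Fact neval_additive u : additive (neval u).
Proof. by move=> c c'; apply/funext => w; rewrite /neval !ncsB hornerD hornerN. Qed.
HB.instance Definition _ u := GRing.isZmodMorphism.Build S (ncs I k) (neval u) (neval_additive u).

Fact neval_multiplicative u : monoid_morphism (neval u).
Proof.
split; first by apply/funext => -[|j w]; rewrite /neval !ncs1E hornerC.
move=> c c'; apply/funext => w; elim: w c' => [|j w IH] c'.
  by rewrite /neval !ncs_nilM hornerM.
by rewrite {1}/neval !ncs_consM hornerD hornerM -(IH (shift j c')).
Qed.
HB.instance Definition _ u := GRing.isMonoidMorphism.Build S (ncs I k) (neval u) (neval_multiplicative u).

Lemma nevalB u c c' : neval u (c - c') = neval u c - neval u c'.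
Proof. exact: raddfB. Qed.
Lemma nevalD u c c' : neval u (c + c') = neval u c + neval u c'.
Proof. exact: raddfD. Qed.
Lemma nevalM u c c' : neval u (c * c') = neval u c * neval u c'.
Proof. exact: rmorphM. Qed.
Lemma neval_sum u (T : Type) (r : seq T) (P : pred T) (G : T -> S) :
  neval u (\sum_(i <- r | P i) G i) = \sum_(i <- r | P i) neval u (G i).
Proof. exact: raddf_sum. Qed.

Lemma nevalZ u (a : {poly k}) c : neval u (a *: c) = a.[u] *: neval u c.
Proof. by apply/funext => w; rewrite /neval !ncsZ hornerM. Qed.

Lemma ordge_nderiv n c : neval 1 c = 0 -> ordge n (nderiv c) -> ordge n c.
Proof.
move=> c1 h w wn; apply: (deriv_inj char0 (x := 1)); first by rewrite derivC; apply: h.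
by rewrite hornerC -[LHS]/(neval 1 c w) c1.
Qed.

(** As b has no constant term, the derivative of a coefficient of c involves only coefficients of
    shorter words, so c vanishes by induction on the length. *)
Lemma nderiv_unique (c b : S) : ordge 1 b -> neval 1 c = 0 ->
  nderiv c = - (c * b) -> c = 0.
Proof.
move=> b1 c1 dc; have h n : ordge n c.
  elim: n => [//|n IH]; apply: ordge_nderiv => //; rewrite dc.
  by apply: (submodN (@ordge_submod _ _ _)); rewrite -addn1; apply: ordgeM.
by apply/funext => w; apply: (h (size w).+1).
Qed.

(** [generator], [chrono] and [chrono_desc s] are the series A, Y and P_s, with [wt i] the exponent
    of the time attached to the letter i. *)
Definition generator : S := fun w => if w is [:: j] then 'X^(wt j) else 0.

Definition chrono : S := fun w => simplex k (map wt w).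

Definition chrono_desc (s : k) : S := fun w => descent_sum (- s) (1 - s) (map wt w).

Lemma ordge_generator : ordge 1 generator. Proof. by case. Qed.

Lemma mul_generator (c : S) j w : (c * generator) (j :: w) = c w * 'X^(wt j).
Proof.
rewrite ncs_consM mulr0 add0r.
suff -> : shift j generator = 'X^(wt j) *: 1 by rewrite -scalerAr mulr1 ncsZ mulrC.
by apply/funext => -[|i u]; rewrite ncsZ ncs1E ?mulr1 ?mulr0.
Qed.

Lemma nderiv_chrono : nderiv chrono = - (chrono * generator).
Proof.
apply/funext => -[|j w]; first by rewrite /nderiv ncsN ncs_nilM /= mulr0 oppr0 derivC.
by rewrite ncsN mul_generator /nderiv /chrono /= (deriv_itail char0) mulrC.
Qed.

Lemma neval1_chrono : neval 1 chrono = 1.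
Proof.
apply/funext => -[|j w]; rewrite /neval /chrono ?ncs1E ?hornerC //.
exact: simplex1.
Qed.

Lemma neval1_chrono_desc s : neval 1 (chrono_desc s) = 1.
Proof.
apply/funext => -[|j w]; rewrite /neval ncs1E; first by rewrite hornerC.
exact: descent_sum1.
Qed.

(* The position of the smallest time cuts a word into two independent subwords. *)
Lemma nderiv_chrono_desc s : nderiv (chrono_desc s) =
  - (chrono_desc s * generator * (1 - s%:P *: chrono_desc s)).
Proof.
apply/funext => w; rewrite /nderiv ncsN ncsME /chrono_desc deriv_descent_sum //.
congr (- _); rewrite size_map big_ord_recr /= drop_size ncs_nilM mulr0 mul0r addr0.
apply: eq_bigr => -[q qw] _ /=.
have [j jE] : exists j, drop q w = j :: drop q.+1 w /\ nth 0%N (map wt w) q = wt j.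
  case: w qw => [//|j0 w] qw; exists (nth j0 (j0 :: w) q).
  by rewrite (nth_map j0) // -drop_nth.
rewrite jE.1 jE.2 mul_generator -map_drop; congr (_ * _).
rewrite ncsB ncs1E ncsZ -map_take; case: (take q w) => [|i u] /=.
  by rewrite mulr1 polyCB.
by rewrite sub0r -mul_polyC -mulNr polyCN.
Qed.

(** The Riccati equation linearizes: the difference D of the two sides satisfies D' = - D A (1 - s
    P_s) and vanishes at 1. *)
Lemma chrono_descE s : (1 + s%:P *: (chrono - 1)) * chrono_desc s = chrono.
Proof.
apply/eqP; rewrite -subr_eq0; apply/eqP.
set P := chrono_desc s; set Y := chrono; set A := generator.
apply: (@nderiv_unique _ (A * (1 - s%:P *: P))).
- by rewrite -[1%N]addn0; apply: ordgeM; first exact: ordge_generator.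
- rewrite rmorphB rmorphM rmorphD /= nevalZ rmorphB rmorph1 /= neval1_chrono.
  by rewrite [neval 1 P]neval1_chrono_desc mulr1 rmorph1 subrr scaler0 addr0 subrr.
rewrite nderivB nderivM nderivD nderivZ nderivB nderiv1 add0r subr0.
rewrite nderiv_chrono nderiv_chrono_desc -/Y -/A -/P.
set T := 1 + _; set R := 1 - _.
have hR : Y * A * R = Y * A - s%:P *: (Y * A * P) by rewrite mulrBr mulr1 -scalerAr.
rewrite mulrBl opprB [Y * (A * R)]mulrA hR scalerN mulNr -scalerAl mulrN opprK !mulrA.
by rewrite [LHS]addrC addrA.
Qed.

(** Geometric series for the inverse of 1 + s (Y - 1); the remainder has order M because Y - 1 has
    no constant term. *)
Lemma chrono_desc_expand s M : ordge M
  (chrono_desc s - \sum_(j < M) ((- s) ^+ j)%:P *: ((chrono - 1) ^+ j * chrono)).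
Proof.
set P := chrono_desc s; pose z := - (s%:P *: (chrono - 1)).
have -> : \sum_(j < M) ((- s) ^+ j)%:P *: ((chrono - 1) ^+ j * chrono) =
    (1 - z ^+ M) * P.
  rewrite -geometric_sumr -mulrA /z opprK chrono_descE mulr_suml.
  apply: eq_bigr => j _; rewrite scalerAl -scaleNr exprZn.
  by rewrite polyC_exp polyCN.
rewrite mulrBl mul1r opprB addrC subrK.
suff hz : ordge 1 z.
  by have := ordgeM (ordgeX (m := M) hz) (@ordge0 _ _ P); rewrite muln1 addn0.
apply: (submodN (@ordge_submod _ _ _)); apply: (submodZ (@ordge_submod _ _ _)).
by case=> // _; rewrite ncsB ncs1E /chrono /= subrr.
Qed.

End SeriesOverPoly.

(** * From orderings of the times to permutations and their descents *)

Section PermSums.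

Definition perm_list n (rho : 'S_n) : seq nat := [seq val (rho i) | i <- enum 'I_n].

Lemma size_perm_list n (rho : 'S_n) : size (perm_list rho) = n.
Proof. by rewrite size_map size_enum_ord. Qed.

Lemma nth_perm_list n (rho : 'S_n) (i : 'I_n) : nth 0%N (perm_list rho) i = rho i.
Proof. by rewrite (nth_map i) ?size_enum_ord // nth_ord_enum. Qed.

Lemma perm_list_inj n : injective (@perm_list n).
Proof.
move=> r r' h; apply/permP => i; apply: val_inj.
by rewrite /= -!nth_perm_list h.
Qed.

Lemma perm_list_permutations n :
  perm_eq [seq perm_list rho | rho : 'S_n] (permutations (iota 0 n)).
Proof.
apply: uniq_perm; rewrite ?permutations_uniq ?(map_inj_uniq (@perm_list_inj n)) ?enum_uniq //.
move=> t; rewrite mem_permutations; apply/mapP/idP => [[rho _ ->]|pt].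
  rewrite -val_enum_ord /perm_list (map_comp val rho); apply: perm_map.
  apply: uniq_perm; rewrite ?enum_uniq ?(map_inj_uniq perm_inj) ?enum_uniq //.
  by move=> i; rewrite mem_enum -[i](permKV rho) mem_map ?mem_enum //; apply: perm_inj.
have st : size t = n by rewrite (perm_size pt) size_iota.
have tn i : (i < n)%N -> (nth 0%N t i < n)%N.
  by move=> i_n; have := perm_mem pt (nth 0%N t i); rewrite mem_nth ?st // mem_iota add0n.
have inj : injective (fun i : 'I_n => Ordinal (tn i (ltn_ord i))).
  move=> i j /(congr1 val) /= /eqP; rewrite nth_uniq ?st // => [/eqP/val_inj //|].
  by rewrite (perm_uniq pt) iota_uniq.
exists (perm inj); first by rewrite mem_enum.
apply: (@eq_from_nth _ 0%N) => [|i]; rewrite ?size_perm_list // st => i_n.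
by rewrite (nth_perm_list _ (Ordinal i_n)) permE.
Qed.

Lemma sum_perm_fix0 (V : nmodType) m (Phi : seq nat -> V) :
  \sum_(rho : 'S_m.+1 | rho ord0 == ord0) Phi (perm_list rho) =
  \sum_(t <- permutations (iota 1 m)) Phi (0%N :: t).
Proof.
transitivity (\sum_(t <- permutations (iota 0 m.+1) | nth 0%N t 0 == 0%N) Phi t).
  rewrite -(perm_big _ (perm_list_permutations _)) big_map big_enum_cond /=.
  by apply: eq_bigl => rho; rewrite (nth_perm_list rho ord0).
rewrite (perm_big _ (permutationsE _)) // undup_id ?iota_uniq //.
rewrite big_mkcond big_allpairs_dep /= big_cons eqxx /= addrC big_seq big1 ?add0r => [//|a].
by rewrite mem_iota => ha; apply: big1 => t _; rewrite /= ifN //; lia.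
Qed.

Lemma prod_if_succ (R : comNzRingType) n (P : pred 'I_n) (c : nat) (z : R) :
  \prod_(l < n | P l) (if l == c.+1 :> nat then z else 1) =
  if [exists l : 'I_n, (l == c.+1 :> nat) && P l] then z else 1.
Proof.
case: existsP => [[l0 /andP[/eqP l0c Pl0]]|h].
  rewrite (bigD1 l0) //= l0c eqxx big1 ?mulr1 // => l /andP[_ ll0].
  by rewrite ifN // -l0c; apply: contra ll0 => /eqP /val_inj ->.
by apply: big1 => l Pl; case: ifP => // lc; case: h; exists l; rewrite lc.
Qed.

Variables (k : fieldType) (x y : k).

Lemma order_weightE t : order_weight x y t =
  \prod_(0 <= i < size t) \prod_(0 <= l < size t | (i < l)%N)
    adj_weight x y (nth 0%N t i) (nth 0%N t l).
Proof.
elim: t => [|a t IH]; first by rewrite big_nil.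
rewrite /= IH big_nat_recl //; congr (_ * _).
  rewrite [RHS]big_mkcond big_nat_recl //= mul1r -/(order_weight _ _ _).
  by rewrite (big_nth 0%N); apply: eq_bigr.
by apply: eq_bigr => i _; rewrite [RHS]big_mkcond big_nat_recl //= mul1r -big_mkcond.
Qed.

(** [tau a] is the rank of position a in the ordering. Each of the m pairs of neighbours b, b + 1
    contributes x if [tau] has a descent at b and y otherwise, so that the exponents add up to m. *)
Lemma order_weight_perm m (rho : 'S_m.+1) :
  let d := descents (rho^-1)%g in
  order_weight x y (perm_list rho) = x ^+ d * y ^+ (m - d) /\ (d <= m)%N.
Proof.
set tau := (rho^-1)%g => d.
have -> : order_weight x y (perm_list rho) =
    \prod_(a < m.+1) \prod_(b < m.+1 | (tau a < tau b)%N) adj_weight x y a b.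
  rewrite order_weightE size_perm_list big_mkord (reindex_inj (@perm_inj _ tau)) /=.
  apply: eq_bigr => a _; rewrite big_mkord (reindex_inj (@perm_inj _ tau)) /=.
  by apply: eq_bigr => b _; rewrite !nth_perm_list !permKV.
under eq_bigr => a _ do rewrite big_split /=.
rewrite big_split (exchange_big_dep xpredT) //=.
pose A := [set b : 'I_m.+1 | [exists l : 'I_m.+1, (l == b.+1 :> nat) && (tau l < tau b)%N]].
pose B := [set a : 'I_m.+1 | [exists l : 'I_m.+1, (l == a.+1 :> nat) && (tau a < tau l)%N]].
under eq_bigr => b _ do rewrite prod_if_succ.
under [X in _ * X]eq_bigr => b _ do rewrite prod_if_succ.
rewrite -!big_mkcond !prodr_const /=.
have dA : d = #|A| by apply: eq_card => b; rewrite !inE.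
have dB : (#|A| + #|B| = m)%N.
  rewrite -cardsUI (_ : A :&: B = finset.set0) ?cards0 ?addn0; last first.
    apply/setP => b; rewrite !inE; apply/negP => /andP[/existsP[l /andP[/eqP lb h]]].
    move=> /existsP[l' /andP[/eqP lb' h']].
    have el : l = l' by apply: val_inj; rewrite /= lb lb'.
    by move: h'; rewrite -el ltnNge ltnW.
  have -> : A :|: B = finset.setC [set ord_max].
    apply/setP => b; rewrite !inE; apply/idP/idP.
      case/orP => /existsP[l /andP[/eqP lb _]]; apply/negP => /eqP bm;
      by have := ltn_ord l; rewrite lb bm /= ltnn.
    move=> bm; have b1 : (b.+1 < m.+1)%N.
      rewrite ltnS ltn_neqAle -ltnS ltn_ord andbT.
      by apply: contra bm => /eqP h; apply/eqP/val_inj.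
    have : tau (Ordinal b1) != tau b.
      by apply/negP => /eqP/perm_inj/(congr1 val)/= h; move: (ltnn b); rewrite -{2}h ltnSn.
    rewrite -(inj_eq val_inj) neq_ltn => /orP[h|h]; apply/orP; [left|right];
    by apply/existsP; exists (Ordinal b1); rewrite eqxx.
  by rewrite cardsC1 card_ord.
have dm : (d <= m)%N by have := leq_addr #|B| #|A|; rewrite dB dA.
have -> : (m - d = #|B|)%N by have := addKn #|A| #|B|; rewrite dB dA.
split=> //; rewrite dA.
by congr (_ ^+ _ * _ ^+ _); apply: eq_card => b; rewrite !inE.
Qed.

End PermSums.

(** * The coefficients of ξ as integrals over s *)

Section Coefficients.

Variables (k : fieldType) (char0 : [pchar k] =i pred0).

(** The outer integral runs over the time at position 0, smaller than all the others; this is the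
    origin of the condition that rho fixes the first index. *)
Lemma itail_descent_sum (x y : k) m h :
  itail ('X^(h 0%N) * descent_sum x y (map h (iota 1 m))) =
  \sum_(rho : 'S_m.+1 | rho ord0 == ord0)
    (x ^+ descents (rho^-1)%g * y ^+ (m - descents (rho^-1)%g)) *:
      simplex k (map h (perm_list rho)).
Proof.
transitivity (\sum_(t <- permutations (iota 1 m))
    order_weight x y (0%N :: t) *: simplex k (map h (0%N :: t))); last first.
  rewrite -(sum_perm_fix0 m (fun t => order_weight x y t *: simplex k (map h t))).
  by apply: eq_bigr => rho _; have [-> _] := order_weight_perm x y rho.
have -> : descent_sum x y (map h (iota 1 m)) =
    (\prod_(b <- iota 1 m) adj_weight x y 0 b) *: order_sum x y h (iota 1 m).
  case: m => [|m]; first by rewrite /= big_nil scale1r order_sum_nil.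
  rewrite big_cons [X in _ * X]big_seq big1 => [|b]; last first.
    by rewrite mem_iota /adj_weight => hb; rewrite !ifN ?mulr1 //; lia.
  rewrite [in RHS]/adj_weight mul1r mulr1 /=.
  rewrite -[1%N :: _]/(iota (1 + 0) m.+1) iotaDl order_sum_shift ?iota_uniq //.
  congr (_ *: _); rewrite size_map size_iota -/(iota 0 m.+1).
  apply: eq_order_sum => i; rewrite mem_iota add0n => /andP[_ im].
  rewrite -[_ :: _]/(map h (iota 1 m.+1)) (nth_map 0%N) ?size_iota // nth_iota //.
rewrite -scalerAr linearZ /= mulr_sumr raddf_sum scaler_sumr /= big_seq [RHS]big_seq.
apply: eq_bigr => t; rewrite mem_permutations => pt.
by rewrite -scalerAr linearZ /= scalerA (perm_big _ pt).
Qed.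

Lemma partial_sumsE c w : partial_sums k c w =
  \prod_(0 <= j < (size w).+1)
    ((c.+1 + \sum_(0 <= l < j) (nth 0%N w l).+1)%N%:R)^-1.
Proof.
elim: w c => [|i w IH] c.
  by rewrite /= big_nat1 big_geq // addn0 mulr1.
rewrite /= big_nat_recl // big_geq // addn0; congr (_ * _).
rewrite IH; apply: eq_bigr => j _; rewrite big_nat_recl //=.
by congr (_%:R^-1); lia.
Qed.

Lemma simplex_at0 v : v != [::] -> all (leq 1) v -> (simplex k (map predn v)).[0] =
  \prod_(0 <= j < size v) ((\sum_(0 <= l < j.+1) nth 0%N v l)%N%:R)^-1.
Proof.
case: v => // i v _ /= /andP[i0 v0]; rewrite simplex0 // partial_sumsE size_map.
rewrite big_nat [RHS]big_nat; apply: eq_bigr => j /andP[_ jv].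
rewrite big_nat_recl //= prednK //; congr ((_ + _)%:R^-1).
rewrite big_nat [RHS]big_nat; apply: eq_bigr => l /andP[_ lj].
have lv : (l < size v)%N by apply: leq_trans lj _.
by rewrite (nth_map 0%N) // prednK //; apply: (allP v0); apply: mem_nth.
Qed.

Definition int01 (p : {poly k}) : k := (itail p).[0].

Fact int01_scalar : scalar int01.
Proof. by move=> a p q; rewrite /int01 linearP hornerD hornerZ. Qed.
HB.instance Definition _ :=
  GRing.isLinear.Build k {poly k} k *%R int01 int01_scalar.

Lemma int01_deriv p : int01 p^`() = p.[1] - p.[0].
Proof.
rewrite /int01 hornerD hornerN prim0 subr0 hornerC.
have -> : prim p^`() = p - p.[0]%:P.
  apply: (deriv_inj char0 (x := 0)); first by rewrite deriv_prim // derivB derivC subr0.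
  by rewrite prim0 hornerD hornerN hornerC subrr.
by rewrite hornerD hornerN hornerC.
Qed.

Lemma int01_Xn j : int01 'X^j = j.+1%:R^-1.
Proof. by rewrite -['X^j]mulr1 /int01 (simplex0 char0 j [::]) /= mulr1. Qed.

(** Beta integral, by induction on d: the polynomial X^(d+1) (1 - X)^(e+1) vanishes at both ends, so
    its derivative has integral zero. *)
Lemma int01_beta d e : int01 ('X^d * (1 - 'X) ^+ e) =
  ((d + e).+1%:R * 'C(d + e, d)%:R)^-1.
Proof.
elim: d e => [|d IH] e.
  rewrite bin0 mulr1 add0n expr0 mul1r; apply: (mulfI (natr_neq0 char0 e)).
  rewrite mulfV ?natr_neq0 //.
  transitivity (int01 (e.+1%:R *: (1 - 'X) ^+ e)); first by rewrite linearZ.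
  have -> : e.+1%:R *: (1 - 'X) ^+ e = (- (1 - 'X) ^+ e.+1)^`() :> {poly k}.
    rewrite derivN deriv_exp derivB derivC derivX sub0r mulN1r mulNrn opprK.
    by rewrite scaler_nat.
  rewrite int01_deriv !hornerE subrr subr0 expr1n exprS mul0r oppr0 sub0r opprK //.
have := int01_deriv ('X^(d.+1) * (1 - 'X) ^+ e.+1).
rewrite derivM derivXn deriv_exp derivB derivC derivX sub0r mulN1r /=.
rewrite !hornerE subrr !exprS !mul0r !mulr0 subrr -!exprS.
rewrite mulNrn mulrN -!scaler_nat -scalerAl -scalerAr linearB !linearZ /= IH => /eqP.
rewrite subr_eq0 eq_sym => /eqP h.
apply: (mulfI (natr_neq0 char0 e)); rewrite h addnS -addSn.
have e1 : 'C((d + e).+1, d.+1)%:R != 0 :> k.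
  by rewrite ((GRing.pcharf0P _).1 char0) -lt0n bin_gt0; lia.
have e2 : 'C((d + e).+1, d)%:R != 0 :> k.
  by rewrite ((GRing.pcharf0P _).1 char0) -lt0n bin_gt0; lia.
have n0 := natr_neq0 char0.
have := mul_bin_left (d + e).+1 d; rewrite (_ : (d + e).+1 - d = e.+1)%N; last by lia.
move/(congr1 (fun n => n%:R : k)); rewrite !natrM => hb.
rewrite addSn !invfM !mulrA.
have -> : d.+1%:R = (e.+1%:R * 'C((d + e).+1, d)%:R) / 'C((d + e).+1, d.+1)%:R :> k.
  by rewrite -hb mulfK.
by field; rewrite e1 e2 -natrD -(natrD _ 2) n0.
Qed.

Lemma poly_eq_points (p q : {poly k}) : (forall s, p.[s] = q.[s]) -> p = q.
Proof.
move=> h; apply/eqP; rewrite -subr_eq0; apply/eqP.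
apply: (@roots_geq_poly_eq0 _ _ [seq i%:R | i <- iota 0 (size (p - q))]).
- by apply/allP => z _; rewrite /root hornerD hornerN h subrr.
- rewrite map_inj_uniq ?iota_uniq // => a b /eqP.
  wlog ab : a b / (a <= b)%N.
    by move=> W; case: (leqP a b) => [/W//|/ltnW/W]; rewrite eq_sym => h' /h' ->.
  by rewrite eq_sym -subr_eq0 -natrB // ((GRing.pcharf0P _).1 char0); lia.
by rewrite size_map size_iota.
Qed.

(* The bracketed coefficient of the theorem is an integral over s in [0, 1], computed
   termwise on both sides of the polynomial identity in s. *)
Lemma xi_coefE m (i : m.+1.-tuple nat) M (q : nat -> k) : all (leq 1) i ->
  (forall s : k, (itail ('X^((thead i).-1) *
     descent_sum (- s) (1 - s) (map predn (behead i)))).[0] =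
     \sum_(j < M) (- s) ^+ j * q j) ->
  xi_coef k i = \sum_(j < M) ((-1) ^+ j / j.+1%:R) * q j.
Proof.
move=> i0 hq; pose h j := (nth 0%N i j).-1.
pose c (rho : 'S_m.+1) : k := (simplex k (map h (perm_list rho))).[0].
pose D (rho : 'S_m.+1) := descents (rho^-1)%g.
have E : \sum_(rho : 'S_m.+1 | rho ord0 == ord0) ((-1) ^+ D rho * c rho) *:
    ('X^(D rho) * (1 - 'X) ^+ (m - D rho)) =
    \sum_(j < M) ((-1) ^+ j * q j) *: 'X^j :> {poly k}.
  apply: poly_eq_points => s.
  rewrite !horner_sum.
  transitivity (\sum_(j < M) (- s) ^+ j * q j); last first.
    apply: eq_bigr => j _; rewrite hornerZ hornerXn (exprNn s); ring.
  rewrite -hq.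
  have -> : map predn (behead i) = map h (iota 1 m).
    case/tupleP: i @h @c {hq i0} => a i h c /=.
    rewrite -[in LHS](mkseq_nth 0%N i) size_tuple /mkseq -map_comp.
    by rewrite -[1%N]/(1 + 0)%N iotaDl -map_comp.
  have -> : (thead i).-1 = h 0%N by rewrite /h nth0 /thead (tnth_nth 0%N).
  rewrite itail_descent_sum horner_sum; apply: eq_bigr => rho _.
  by rewrite !hornerE /= [in RHS]exprNn -/(D rho) /c; ring.
have := congr1 int01 E; rewrite !linear_sum /= => F.
rewrite /xi_coef.
transitivity (\sum_(j < M) int01 (((-1) ^+ j * q j) *: 'X^j)); last first.
  apply: eq_bigr => j _; rewrite linearZ /= int01_Xn; ring.
rewrite -F mulr_sumr; apply: eq_bigr => rho _.
have [_ dm] := order_weight_perm (1 : k) 1 rho.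
rewrite linearZ /= int01_beta subnKC // invfM -/(D rho).
suff -> : \prod_(j < m.+1) (\sum_(l < m.+1 | (l <= j)%N) tnth i (rho l))%N%:R^-1 = c rho by ring.
pose v := [seq tnth i (rho l) | l <- enum 'I_m.+1].
have sv : size v = m.+1 by rewrite size_map size_enum_ord.
have -> : c rho = (simplex k (map predn v)).[0].
  rewrite /c /v -!map_comp; congr (simplex k _).[0]; apply: eq_map => l /=.
  by rewrite /h (tnth_nth 0%N).
rewrite simplex_at0 ?sv.
- rewrite big_mkord; apply: eq_bigr => j _; congr (_%:R^-1).
  rewrite big_mkord (big_ord_widen_cond m.+1 xpredT (fun l => nth 0%N v l)) //=.
  apply: eq_big => // l _; rewrite /v (nth_map l) ?size_enum_ord //.
  by rewrite nth_ord_enum.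
- by rewrite -size_eq0 sv.
apply/allP => _ /mapP[l _ ->]; apply: (allP i0); exact: mem_tnth.
Qed.

End Coefficients.

(** * The logarithm of the chronological exponential *)

Section OrdgeMore.
Variables (I : Type) (C : comNzRingType).
Implicit Types c : ncs I C.

Lemma ordgeMl n c c' : ordge n c -> ordge n (c' * c).
Proof. by move=> h; apply: (@ordgeM _ _ 0 n). Qed.

Lemma ordgeMr n c c' : ordge n c -> ordge n (c * c').
Proof. by move=> h; have := ordgeM h (@ordge0 _ _ c'); rewrite addn0. Qed.

Lemma ordge_congM n c1 c2 c3 c4 : ordge n (c1 - c2) -> ordge n (c3 - c4) ->
  ordge n (c1 * c3 - c2 * c4).
Proof.
move=> h h'; have -> : c1 * c3 - c2 * c4 = (c1 - c2) * c3 + c2 * (c3 - c4).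
  by rewrite mulrBl mulrBr addrA subrK.
by apply: (submodD (@ordge_submod _ _ _)); [apply: ordgeMr | apply: ordgeMl].
Qed.

Lemma ordge_congX n c1 c2 m : ordge n (c1 - c2) -> ordge n (c1 ^+ m - c2 ^+ m).
Proof.
move=> h; elim: m => [|m IH]; first by rewrite !expr0 subrr.
by rewrite !exprS; apply: ordge_congM.
Qed.
End OrdgeMore.

Section MoreEv.
Variables (I : finType) (k : fieldType).
Notation C := {poly k}.
Notation S := (ncs I C).

Lemma nderiv_letter (j : I) : nderiv (letter C j) = 0.
Proof.
by apply/funext => -[|i [|l w]]; rewrite /nderiv ?deriv0 // /letter /= -polyC_natr derivC.
Qed.

Lemma nderiv_adl j (r : S) : nderiv (adl j r) = adl j (nderiv r).
Proof.
by rewrite /adl nderivB !nderivM nderiv_letter mul0r add0r mulr0 addr0.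
Qed.

Lemma nderivZp (a : C) (c : S) : nderiv (a *: c) = a^`() *: c + a *: nderiv c.
Proof. by apply/funext => w; rewrite /nderiv ncsD !ncsZ derivM. Qed.

Lemma nderiv_ev n (c r : S) :
  nderiv (ev (@adl I C) n c r) = ev (@adl I C) n (nderiv c) r + ev (@adl I C) n c (nderiv r).
Proof.
elim: n c r => [|n IH] c r /=; first by rewrite addr0 raddf0.
rewrite nderivD nderivZp nderiv_sum -!addrA; congr (_ + _).
rewrite addrCA; congr (_ + _); rewrite -big_split /=; apply: eq_bigr => j _.
by rewrite IH nderiv_adl.
Qed.

Lemma neval_letter u (j : I) : neval u (letter C j) = letter k j.
Proof.
apply/funext => -[|i [|l w]]; rewrite /neval ?horner0 // /letter.
by rewrite -polyC_natr hornerC.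
Qed.

Lemma neval_adl u j (r : S) : neval u (adl j r) = adl j (neval u r).
Proof. by rewrite /adl nevalB !nevalM neval_letter. Qed.

Lemma neval_ev u n (c r : S) :
  neval u (ev (@adl I C) n c r) = ev (@adl I k) n (neval u c) (neval u r).
Proof.
elim: n c r => [|n IH] c r /=; first by rewrite raddf0.
rewrite nevalD nevalZ neval_sum; congr (_ + _); apply: eq_bigr => j _.
by rewrite IH neval_adl.
Qed.
End MoreEv.

Lemma zmod_jacobi (V : zmodType) (a b c d e f : V) :
  a - b - (c - d) = a - e - (f - d) - (b - f - (e - c)).
Proof.
rewrite !opprB [RHS]addrACA !addrA !subrK -!addrA; congr (_ + _).
by rewrite addrCA [RHS]addrCA [- b - c]addrC.
Qed.

Section Magnus.

Variables (k : fieldType) (char0 : [pchar k] =i pred0) (I : finType) (wt : I -> nat).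
Variable L : nat.
Hypothesis L0 : (0 < L)%N.
Notation M := L.+1.
Notation C := {poly k}.
Notation S := (ncs I C).
Notation Y := (chrono k wt).
Notation A := (generator k wt).
Notation evS := (ev (@adl I C) M).

(* The integral over s of Y / (1 + s (Y - 1)), expanded in powers of Y - 1. *)
Definition magnus_coef : S :=
  \sum_(j < M) ((-1) ^+ j / j.+1%:R)%:P *: ((Y - 1) ^+ j * Y).

(** The equation Ω' = - ψ(ad Ω) A integrated from u to 1, one letter of A at a time: the word w acts
    by brackets on the innermost letter i, whose time is the variable of integration. *)
Definition magnus_tail (i : I) : S := fun w => itail ('X^(wt i) * magnus_coef w).

Definition magnus : S := \sum_i evS (magnus_tail i) (letter C i).

Definition magnus_exp : S := \sum_(n < M) (n`!%:R^-1)%:P *: magnus ^+ n.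

Lemma generatorE : A = \sum_i 'X^(wt i) *: letter C i.
Proof.
apply/funext => w; rewrite ncs_sum; case: w => [|j [|l w]] /=; last first.
- by rewrite big1 // => i _; rewrite ncsZ mulr0.
- rewrite (bigD1 j) //= ncsZ /letter eqxx mulr1 big1 ?addr0 // => i ij.
  by rewrite ncsZ eq_sym (negbTE ij) mulr0.
by rewrite big1 // => i _; rewrite ncsZ mulr0.
Qed.

Lemma ordge_adlS j n (r : S) : ordge n r -> ordge n.+1 (adl j r).
Proof. exact: ordge_adl. Qed.

Let hO := ordge_submod I C.
Let hF := ordge_filtration I C.
Let FX := ordge_adlS.

Lemma ordge_magnus : ordge 1 magnus.
Proof.
apply: (submod_sum (@hO 1)) => i _ _; apply: (ev_filt0 hF) => //.
exact: ordge_letter.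
Qed.

Lemma neval1_magnus : neval 1 magnus = 0.
Proof.
rewrite neval_sum big1 // => i _; rewrite neval_ev.
have -> : neval 1 (magnus_tail i) = 0 by apply/funext => w; exact: itail1.
exact: ev0.
Qed.

Lemma nderiv_magnus : nderiv magnus = - evS magnus_coef A.
Proof.
rewrite nderiv_sum generatorE evr_sum -sumrN; apply: eq_bigr => i _.
rewrite nderiv_ev nderiv_letter evr0 addr0 evrZ -evZ -evN; congr (evS _ _).
by apply/funext => w; rewrite ncsN ncsZ -(deriv_itail char0).
Qed.

Definition brac (a r : S) := a * r - r * a.

(* As a sum of brackets of letters, the series magnus evaluated at ad is ad magnus. *)
Lemma magnus_brac m r : ordge m r -> ordge (m + M) (evS magnus r - brac magnus r).
Proof.
pose rep := @represents I C S (@adl I C) (@ordge I C) S brac M.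
have rho_linear a l l' v : brac (a *: l + l') v = a *: brac l v + brac l' v.
  by rewrite /brac mulrDl mulrDr -scalerAl -scalerAr opprD addrACA -scalerBr.
have rho_U j l v : True -> brac (adl j l) v = adl j (brac l v) - brac l (adl j v).
  by move=> _; rewrite /brac /adl !mulrBl !mulrBr !mulrA; apply: zmod_jacobi.
suff : rep magnus magnus by apply.
apply: (represents_sum hF rho_linear) => i.
apply: (represents_ev hF FX rho_linear (fun _ _ _ => Logic.I) rho_U) => // n v Fv.
by rewrite -(prednK L0) ev_letter // subrr.
Qed.

(** The operator - ad Ω, whose sign matches that of X in [phip]. *)
Definition nbrac (r : S) := r * magnus - magnus * r.

(** All powers of Ω are collected on the left: moving Ω to the left past (- ad Ω)^b Ω' produces the
    next iterate, and Pascal's rule gives the binomial coefficients. *)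
Lemma nderivX n : nderiv (magnus ^+ n) =
  \sum_(b < n) (magnus ^+ (n - b.+1) * iter b nbrac (nderiv magnus)) *+ 'C(n, b.+1).
Proof.
set D := fun b => iter b nbrac (nderiv magnus).
elim: n => [|n IH]; first by rewrite big_ord0 nderiv1.
have hD b : D b * magnus = magnus * D b + D b.+1 by rewrite /D /= addrC subrK.
rewrite exprSr nderivM IH mulr_suml.
under eq_bigr => b _ do rewrite mulrnAl -mulrA hD mulrDr mulrA -exprSr mulrnDl.
rewrite big_split /=.
have -> : \sum_(b < n.+1) (magnus ^+ (n.+1 - b.+1) * D b) *+ 'C(n.+1, b.+1) =
    \sum_(b < n.+1) (magnus ^+ (n.+1 - b.+1) * D b) *+ 'C(n, b.+1) +
    \sum_(b < n.+1) (magnus ^+ (n.+1 - b.+1) * D b) *+ 'C(n, b).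
  by rewrite -big_split; apply: eq_bigr => b _; rewrite binS mulrnDr.
rewrite -addrA; congr (_ + _).
  rewrite big_ord_recr /= bin_small // addr0; apply: eq_bigr => b _.
   by rewrite subSS subnSK.
by rewrite [RHS]big_ord_recl /= bin0 subSS subn0 addrC; congr (_ + _).
Qed.

Lemma ordge_nbrac n r : ordge n r -> ordge n.+1 (nbrac r).
Proof.
move=> h; apply: (submodB (@hO _)).
  by rewrite -addn1; apply: ordgeM => //; apply: ordge_magnus.
by rewrite -add1n; apply: ordgeM => //; apply: ordge_magnus.
Qed.

Lemma nderiv_magnus1 : ordge 1 (nderiv magnus).
Proof.
move=> w w1; rewrite /nderiv.
by rewrite (ordge_magnus w1) deriv0.
Qed.

Lemma ordge_iter_nbrac b : ordge b.+1 (iter b nbrac (nderiv magnus)).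
Proof.
by elim: b => [|b IH] /=; [apply: nderiv_magnus1 | apply: ordge_nbrac].
Qed.

(** Starting from Ω' = - ψ A, every further - ad Ω may be replaced by the series -Ω evaluated at the
    operators ad x_i, by [magnus_brac], and [evM] merges the two evaluations. One more order is
    gained because A has order 1. *)
Lemma iter_nbrac_cong b :
  ordge M.+1 (iter b nbrac (nderiv magnus) + evS ((- magnus) ^+ b * magnus_coef) A).
Proof.
have FA : ordge 1 A by apply: ordge_generator.
elim: b => [|b IH]; first by rewrite expr0 mul1r /= nderiv_magnus addNr.
set v := evS _ _ in IH; have Fv : ordge 1 v by apply: (ev_filt0 hF FX).
rewrite iterS; set d := iter _ _ _ in IH *.
rewrite exprS -mulrA.
have e1 := evM hF FX M (- magnus) ((- magnus) ^+ b * magnus_coef) FA.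
have e2 := magnus_brac Fv; rewrite add1n in e1 e2.
rewrite -/v evN in e1.
rewrite -[X in ordge _ (_ + X)](subrK (- evS magnus v)) addrCA.
apply: (submodD (@hO _) e1).
rewrite -[evS magnus v](subrK (brac magnus v)) opprD addrCA.
apply: (submodD (@hO _)); first exact: (submodN (@hO _)).
have -> : nbrac d - brac magnus v = nbrac (d + v).
  by rewrite /nbrac /brac opprB addrACA -mulrDl -opprD -mulrDr.
by apply: ordgeW (ordge_nbrac IH).
Qed.

Definition subst (p : {poly k}) : S := horner_alg magnus (map_poly polyC p).

Lemma substM p q : subst (p * q) = subst p * subst q.
Proof. by rewrite /subst !rmorphM. Qed.
Lemma substZ a p : subst (a *: p) = a%:P *: subst p.
Proof. by rewrite /subst map_polyZ -mul_polyC rmorphM /= horner_algC mulr_algl. Qed.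
Lemma subst1 : subst 1 = 1. Proof. by rewrite /subst !rmorph1. Qed.
Lemma substX p n : subst (p ^+ n) = subst p ^+ n.
Proof. by rewrite /subst !rmorphXn. Qed.
Lemma substD p q : subst (p + q) = subst p + subst q.
Proof. by rewrite /subst !rmorphD. Qed.
Lemma substN p : subst (- p) = - subst p.
Proof. by rewrite /subst !rmorphN. Qed.
Lemma subst_sum (T : Type) (r : seq T) (P : pred T) (G : T -> {poly k}) :
  subst (\sum_(i <- r | P i) G i) = \sum_(i <- r | P i) subst (G i).
Proof. by apply: (big_morph subst substD); rewrite /subst !rmorph0. Qed.
Lemma subst_var : subst 'X = magnus.
Proof. by rewrite /subst map_polyX horner_algX. Qed.

Lemma subst_expp : subst (expp k M) = magnus_exp.
Proof.
by rewrite subst_sum; apply: eq_bigr => n _; rewrite substZ substX subst_var.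
Qed.

(** As far as e^Ω agrees with Y, [magnus_coef] is [psip] evaluated at Ω, which [phip] inverts modulo
    X^L; hence the bound [N <= L]. *)
Lemma phip_magnus_coef N : (N <= L)%N -> ordge N (magnus_exp - Y) ->
  ordge N (subst (phip k M) * magnus_coef - 1).
Proof.
move=> NL h; have [r hr] := phip_psip char0 L.
have -> : subst (phip k M) * magnus_coef - 1 =
    subst (phip k M) * (magnus_coef - subst (psip k M)) + magnus ^+ L * subst r.
  rewrite mulrBr -substM hr substD subst1 substM substX subst_var.
  by rewrite opprD addrA subrK.
apply: (submodD (@hO N)); last first.
  apply: ordgeMr; apply: (@ordgeW _ _ L) => //.
  by have := ordgeX (m := L) ordge_magnus; rewrite muln1.
apply: ordgeMl; rewrite subst_sum.
apply: (submod_congsum (@hO N)) => j _ _; rewrite substZ.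
apply: (submod_congZ (@hO N)); rewrite substM substX substD substN subst1 subst_expp.
have h' : ordge N (Y - magnus_exp) by apply: (submodC (@hO N)).
apply: ordge_congM => //; apply: ordge_congX.
by rewrite opprB addrA subrK.
Qed.

(** Differential of the exponential: e^(-Ω) (e^Ω)' is (1 - e^(-ad Ω)) / ad Ω applied to Ω'. The
    binomials of [nderivX] split 1/n! into 1/a! and 1/(b+1)!, with a + b + 1 = n; the pairs that
    truncation leaves unmatched have order at least M. *)
Lemma nderiv_magnus_exp : ordge M (nderiv magnus_exp -
  magnus_exp * \sum_(b < M) (b.+1`!%:R^-1)%:P *: iter b nbrac (nderiv magnus)).
Proof.
set D := fun b => iter b nbrac (nderiv magnus).
pose G (a b : nat) : S := ((a`!%:R^-1)%:P * (b.+1`!%:R^-1)%:P) *: (magnus ^+ a * D b).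
have -> : nderiv magnus_exp = \sum_(b < M) \sum_(a < M | (a + b.+1 < M)%N) G a b.
  rewrite nderiv_sum.
  transitivity (\sum_(n < M) \sum_(b < M | (b < n)%N) G (n - b.+1)%N b).
    apply: eq_bigr => n _; rewrite nderivZ nderivX scaler_sumr.
    rewrite (big_ord_widen M (fun b => (n`!%:R^-1)%:P *:
      ((magnus ^+ (n - b.+1) * D b) *+ 'C(n, b.+1)))) /=; last exact/ltnW/ltn_ord.
    apply: eq_bigr => b bn; rewrite -scaler_nat scalerA; congr (_ *: _).
    rewrite -polyC_natr -!polyCM; congr (_%:P).
    have f0 := fact_neq0 char0.
    rewrite -(bin_fact bn) !natrM !invfM mulrAC mulVf ?mul1r; first by rewrite mulrC.
    by rewrite ((GRing.pcharf0P _).1 char0) -lt0n bin_gt0.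
  rewrite (exchange_big_dep xpredT) //=; apply: eq_bigr => b _.
  rewrite -(big_mkord (fun n => (b < n)%N) (fun n => G (n - b.+1)%N b)).
  rewrite -(big_mkord (fun a => (a + b.+1 < M)%N) (fun a => G a b)).
  transitivity (\sum_(b.+1 <= n < M) G (n - b.+1)%N b).
    by rewrite [RHS](big_nat_widenl _ 0%N).
  rewrite -{1}[b.+1]add0n big_addn.
  rewrite [LHS](big_nat_widen _ _ M) /=; last exact: leq_subr.
  by apply: eq_big => [a|a _]; rewrite ?addnK // ltn_subRL addnC.
have -> : magnus_exp * \sum_(b < M) (b.+1`!%:R^-1)%:P *: D b =
    \sum_(b < M) \sum_(a < M) G a b.
  rewrite mulr_sumr; apply: eq_bigr => b _; rewrite mulr_suml; apply: eq_bigr => a _.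
  by rewrite -scalerAl -scalerAr scalerA.
rewrite -sumrB; apply: (submod_sum (@hO M)) => b _ _.
rewrite [X in _ - X](bigID (fun a : 'I_M => (a + b.+1 < M)%N)) /= opprD addrA subrr add0r.
apply: (submodN (@hO M)); apply: (submod_sum (@hO M)) => a _ ab.
apply: (submodZ (@hO M)); apply: (@ordgeW _ _ (a + b.+1)); first by rewrite leqNgt.
apply: ordgeM; last exact: ordge_iter_nbrac.
by have := ordgeX (m := a) ordge_magnus; rewrite muln1.
Qed.

Lemma neval1_magnus_exp : neval 1 magnus_exp = 1.
Proof.
rewrite neval_sum big_ord_recl big1 => [|i _].
  by rewrite nevalZ hornerC invr1 scale1r expr0 rmorph1 addr0.
by rewrite nevalZ rmorphXn /= neval1_magnus expr0n scaler0.
Qed.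

(* If the exponential agrees with Y in length < N, then it satisfies the equation of Y
   in length <= N, because A has order 1. *)
Lemma magnus_exp_cong N : (N <= M)%N -> ordge N (magnus_exp - Y).
Proof.
elim: N => [//|N IH] NM; have {}IH := IH (ltnW NM).
have FA : ordge 1 A by apply: ordge_generator.
apply: ordge_nderiv => //.
  by rewrite nevalB neval1_magnus_exp neval1_chrono subrr.
have e1 : ordge N.+1 (evS (subst (phip k M) * magnus_coef) A - A).
  rewrite -{2}(ev_one (@adl I C) L A) -evB -add1n.
  by apply: (ev_filt hF FX) => //; apply: phip_magnus_coef.
have e2 : ordge N.+1 (\sum_(b < M) (b.+1`!%:R^-1)%:P *: iter b nbrac (nderiv magnus) + A).
  set X := (X in ordge _ (X + _)); set V := evS _ A in e1 *.
  have -> : X + A = (X + V) - (V - A) by rewrite opprB addrACA subrr addr0.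
  apply: (submodB (@hO _)) e1; rewrite /X /V {X V}.
  rewrite subst_sum mulr_suml ev_sum -big_split.
  apply: (submod_sum (@hO _)) => b _ _; cbv beta.
  rewrite substZ substX substN subst_var -scalerAl evZ.
  rewrite -[X in ordge _ X]scalerDr; apply: (submodZ (@hO _)); apply: (@ordgeW _ _ M.+1); first by rewrite ltnW.
  exact: iter_nbrac_cong.
rewrite nderivB (nderiv_chrono char0) opprK.
apply: (submod_congl (@hO _) (y := magnus_exp * (- A) + Y * A)); last first.
  have -> : magnus_exp * - A + Y * A = - ((magnus_exp - Y) * A).
    by rewrite mulrBl opprB addrC mulrN.
  by apply: (submodN (@hO _)); rewrite -addn1; apply: ordgeM.
rewrite opprD addrACA subrr addr0.
apply: (submod_trans (@hO _) (ordgeW NM nderiv_magnus_exp)).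
by rewrite -mulrBr; apply: ordgeMl; rewrite opprK.
Qed.

End Magnus.

(** * The logarithm at time 0 and its bracket coefficients *)

Section MagnusAt0.

Variables (k : fieldType) (char0 : [pchar k] =i pred0) (I : finType) (wt : I -> nat).
Variable L : nat.
Hypothesis L0 : (0 < L)%N.
Notation M := L.+1.

Definition magnus_tail0 (i : I) : ncs I k := neval 0 (magnus_tail k wt L i).

Definition magnus0 : ncs I k :=
  \sum_i ev (@adl I k) M (magnus_tail0 i) (letter k i).

Lemma magnus0E : magnus0 = neval 0 (magnus k wt L).
Proof.
rewrite neval_sum; apply: eq_bigr => i _.
by rewrite neval_ev neval_letter.
Qed.

Lemma magnus0_exp : ordge M
  ((\sum_(n < M) n`!%:R^-1 *: magnus0 ^+ n) - neval 0 (chrono k wt)).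
Proof.
have -> : \sum_(n < M) n`!%:R^-1 *: magnus0 ^+ n = neval 0 (magnus_exp k wt L).
  rewrite neval_sum; apply: eq_bigr => n _.
  by rewrite nevalZ hornerC magnus0E rmorphXn.
move=> w wM; rewrite -nevalB /neval (magnus_exp_cong char0 wt L0 (leqnn _) wM).
by rewrite horner0.
Qed.

(** With q_j the integral of the coefficient of (Y - 1)^j Y, P_s yields the sum of (-s)^j q_j and
    [magnus_coef] that of (-1)^j q_j / (j+1), the pair of expansions related by [xi_coefE]. As
    [m < M], the truncation does not affect the word t. Successors appear because [wt] is an
    exponent i - 1. *)
Lemma magnus_tail0E m (t : m.-tuple I) i : (m < M)%N ->
  magnus_tail0 i t = xi_coef k [tuple of [seq (wt j).+1 | j <- i :: t]].
Proof.
move=> mM; pose q j := int01 ('X^(wt i) * ((chrono k wt - 1) ^+ j * chrono k wt) t).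
rewrite (@xi_coefE _ char0 _ _ M q).
- rewrite /magnus_tail0 /neval /magnus_tail -/(int01 _) /magnus_coef ncs_sum.
  rewrite mulr_sumr linear_sum; apply: eq_bigr => j _.
  by rewrite ncsZ mulrCA mul_polyC linearZ.
- by apply/allP => _ /mapP[j _ ->].
move=> s; rewrite [thead _]/= /=.
have -> : [seq i.-1 | i <- [seq (wt j).+1 | j <- t]] = map wt t.
  by rewrite -map_comp; apply: eq_map.
have := chrono_desc_expand char0 wt s (M := M) (w := t); rewrite size_tuple => /(_ mM).
rewrite ncsB => /eqP; rewrite subr_eq0 /chrono_desc => /eqP->.
rewrite -/(int01 _) ncs_sum mulr_sumr linear_sum; apply: eq_bigr => j _.
by rewrite ncsZ mulrCA mul_polyC linearZ.
Qed.

End MagnusAt0.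

(** * Polynomial functions *)

Section PolyFun.

Variables (k : fieldType) (char0 : [pchar k] =i pred0).

(* p is a polynomial function with values in V, and p' is its derivative. *)
Definition pfderiv (V : lmodType k) (p p' : k -> V) := exists n (w : nat -> V),
  (forall t, p t = \sum_(m < n) t ^+ m *: w m) /\
  (forall t, p' t = \sum_(m < n) (m%:R * t ^+ m.-1) *: w m).

Section OneSpace.
Variable V : lmodType k.
Implicit Types (p q : k -> V) (F : V -> Prop) (v : V).

(** The Vandermonde matrix at 0, ..., n - 1, points that are distinct in characteristic zero, is
    inverted to write the coefficients as combinations of values. *)
Lemma submod_coef F n (w : nat -> V) : submod F ->
  (forall t, F (\sum_(m < n) t ^+ m *: w m)) -> forall m, (m < n)%N -> F (w m).
Proof.
move=> hF h m mn; pose a : 'rV[k]_n := \row_j j%:R.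
have Vu : Vandermonde n a \in unitmx.
  rewrite unitmxE det_Vandermonde unitfE; apply/prodf_neq0 => i _.
  apply/prodf_neq0 => j ij; rewrite !mxE -natrB ?(ltnW ij) //.
  by rewrite ((GRing.pcharf0P _).1 char0) subn_eq0 -ltnNge.
pose B := invmx (Vandermonde n a); pose m' := Ordinal mn.
have -> : w m = \sum_j B j m' *: \sum_(i < n) (a 0 j) ^+ i *: w i.
  under eq_bigr => j _ do rewrite scaler_sumr.
  rewrite exchange_big /= (bigD1 m') //= [X in _ + X]big1 => [|i im].
    rewrite addr0; under eq_bigr => j _ do rewrite scalerA mulrC.
    rewrite -scaler_suml; have := congr1 (fun A : 'M_n => A m' m') (mulmxV Vu).
    rewrite !mxE eqxx => E; rewrite (_ : \sum_(i < n) _ = 1) ?scale1r //.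
    by rewrite -[RHS]E; apply: eq_bigr => j _; rewrite [Vandermonde _ _ _ _]mxE.
  under eq_bigr => j _ do rewrite scalerA mulrC.
  rewrite -scaler_suml; have := congr1 (fun A : 'M_n => A i m') (mulmxV Vu).
  rewrite !mxE (negbTE im) => E; rewrite (_ : \sum_(i < n) _ = 0) ?scale0r //.
  by rewrite -[RHS]E; apply: eq_bigr => j _; rewrite [Vandermonde _ _ _ _]mxE.
by apply: (submod_sum hF) => j _ _; apply: (submodZ hF).
Qed.

Lemma pfderiv_submod F p p' : submod F -> pfderiv p p' ->
  (forall t, F (p t)) -> forall t, F (p' t).
Proof.
move=> hF [n [w [hp hp']]] h t; rewrite hp'.
have hw : forall m, (m < n)%N -> F (w m).
  by apply: submod_coef => // u; rewrite -hp.
by apply: (submod_sum hF) => m _ _; apply: (submodZ hF); apply: hw.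
Qed.

(** Uniqueness of primitives modulo F: the coefficients m w_m of the derivative lie in F, and m is
    invertible for m > 0. *)
Lemma pfderiv_cst_mod F p p' : submod F -> pfderiv p p' ->
  (forall t, F (p' t)) -> forall t, F (p t - p 0).
Proof.
move=> hF [n [w [hp hp']]] h t.
have hw m : (m < n)%N -> (0 < m)%N -> F (w m).
  case: n hp hp' => // n hp hp'; case: m => // m mn _.
  have := @submod_coef F n (fun m => m.+1%:R *: w m.+1) hF _ m mn.
  move=> /(_ _)/(submodZ hF m.+1%:R^-1); rewrite scalerA mulVf ?natr_neq0 //.
  rewrite scale1r; apply => u; have := h u; rewrite hp' big_ord_recl mul0r scale0r add0r.
  by congr F; apply: eq_bigr => i _; rewrite scalerA mulrC.
rewrite !hp -sumrB; apply: (submod_sum hF) => -[[|m] mn] _ _ /=.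
  by rewrite !expr0 subrr; apply: submod0.
rewrite exprS [0 ^+ _]exprS mul0r scale0r subr0; apply: (submodZ hF); exact: hw.
Qed.

Lemma pfderiv_ext p q p' q' : p =1 q -> p' =1 q' -> pfderiv p p' -> pfderiv q q'.
Proof.
move=> h h' [n [w [hp hp']]]; exists n, w.
by split=> t; rewrite -?h -?h'.
Qed.

Lemma pfderiv_cst v : pfderiv (fun=> v) (fun=> 0).
Proof.
exists 1%N, (fun=> v); split=> t; rewrite big_ord1 ?scale1r //.
by rewrite mul0r scale0r.
Qed.

Lemma pfderiv_wide p p' : pfderiv p p' -> exists n, forall n', (n <= n')%N ->
  exists w : nat -> V,
  (forall t, p t = \sum_(m < n') t ^+ m *: w m) /\
  (forall t, p' t = \sum_(m < n') (m%:R * t ^+ m.-1) *: w m).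
Proof.
move=> [n [w [hp hp']]]; exists n => n' nn'.
exists (fun m => if (m < n)%N then w m else 0); split=> t.
  rewrite hp (big_ord_widen n' (fun m => t ^+ m *: w m)) //.
  by rewrite [LHS]big_mkcond; apply: eq_bigr => m _; case: ifP; rewrite ?scaler0.
rewrite hp' (big_ord_widen n' (fun m => (m%:R * t ^+ m.-1) *: w m)) //.
by rewrite [LHS]big_mkcond; apply: eq_bigr => m _; case: ifP; rewrite ?scaler0.
Qed.

Lemma pfderivD p p' q q' : pfderiv p p' -> pfderiv q q' ->
  pfderiv (fun t => p t + q t) (fun t => p' t + q' t).
Proof.
move=> /pfderiv_wide[n1 h1] /pfderiv_wide[n2 h2].
have [w1 [hp hp']] := h1 (maxn n1 n2) (leq_maxl _ _).
have [w2 [hq hq']] := h2 (maxn n1 n2) (leq_maxr _ _).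
exists (maxn n1 n2), (fun m => w1 m + w2 m); split=> t.
  by rewrite hp hq -big_split; apply: eq_bigr => m _; rewrite scalerDr.
by rewrite hp' hq' -big_split; apply: eq_bigr => m _; rewrite scalerDr.
Qed.

Lemma pfderiv_sum (T : Type) (r : seq T) (P : pred T) (p p' : T -> k -> V) :
  (forall i, P i -> pfderiv (p i) (p' i)) ->
  pfderiv (fun t => \sum_(i <- r | P i) p i t) (fun t => \sum_(i <- r | P i) p' i t).
Proof.
move=> h; elim: r => [|i r IH].
  apply: (pfderiv_ext (p := fun=> 0) (p' := fun=> 0)) (pfderiv_cst 0) => t;
  by rewrite big_nil.
case: (boolP (P i)) => Pi; last first.
  by apply: pfderiv_ext IH => t; rewrite big_cons (negbTE Pi).
apply: pfderiv_ext (pfderivD (h i Pi) IH) => t; by rewrite big_cons Pi.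
Qed.

Lemma pfderiv_monom m (v : V) :
  pfderiv (fun t => t ^+ m *: v) (fun t => (m%:R * t ^+ m.-1) *: v).
Proof.
exists m.+1, (fun i => if i == m then v else 0); split=> t.
  rewrite big_ord_recr /= eqxx big1 ?add0r // => i _.
  by rewrite ifN ?scaler0 // neq_ltn ltn_ord.
rewrite big_ord_recr /= eqxx big1 ?add0r // => i _.
by rewrite ifN ?scaler0 // neq_ltn ltn_ord.
Qed.

Lemma pfderiv_poly (c : {poly k}) v :
  pfderiv (fun t => c.[t] *: v) (fun t => c^`().[t] *: v).
Proof.
have h i : pfderiv (fun t => t ^+ i *: (c`_i *: v)) (fun t => (i%:R * t ^+ i.-1) *: (c`_i *: v)).
  exact: pfderiv_monom.
apply: pfderiv_ext (pfderiv_sum (index_enum 'I_(size c)) (P := xpredT) (fun i _ => h i)) => t.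
  rewrite horner_coef scaler_suml; apply: eq_bigr => i _.
  by rewrite scalerA mulrC.
rewrite -[in RHS](coefK c) poly_def raddf_sum /= horner_sum scaler_suml.
apply: eq_bigr => i _; rewrite derivZ derivXn hornerZ hornerMn hornerXn scalerA.
by rewrite mulr_natl mulrC.
Qed.

Lemma pfderiv_pscale (c : {poly k}) p p' : pfderiv p p' ->
  pfderiv (fun t => c.[t] *: p t) (fun t => c^`().[t] *: p t + c.[t] *: p' t).
Proof.
move=> [n [w [hp hp']]].
have h i := pfderiv_poly (c * 'X^i) (w i).
apply: pfderiv_ext (pfderiv_sum (index_enum 'I_n) (P := xpredT) (fun i _ => h i)) => t.
  rewrite hp scaler_sumr; apply: eq_bigr => i _.
  by rewrite hornerM hornerXn scalerA.
rewrite hp hp' !scaler_sumr -big_split; apply: eq_bigr => i _ /=.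
rewrite derivM derivXn hornerD !hornerM hornerXn hornerMn hornerXn.
by rewrite !scalerA scalerDl mulr_natl.
Qed.

Lemma pfderivZ (a : k) p p' : pfderiv p p' ->
  pfderiv (fun t => a *: p t) (fun t => a *: p' t).
Proof.
move=> h; apply: pfderiv_ext (pfderiv_pscale a%:P h) => t; rewrite hornerC //.
by rewrite derivC horner0 scale0r add0r.
Qed.

Lemma pfderivN p p' : pfderiv p p' -> pfderiv (fun t => - p t) (fun t => - p' t).
Proof.
by move=> h; apply: pfderiv_ext (pfderivZ (-1) h) => t; rewrite scaleN1r.
Qed.

Lemma pfderivB p p' q q' : pfderiv p p' -> pfderiv q q' ->
  pfderiv (fun t => p t - q t) (fun t => p' t - q' t).
Proof. by move=> h h'; apply: pfderivD => //; apply: pfderivN. Qed.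

Lemma pfderiv_prim E p p' v : submod E -> pfderiv p p' -> E v ->
  (forall t, E (p t)) -> exists P, [/\ pfderiv P p, P 0 = v & forall t, E (P t)].
Proof.
move=> hE [n [w [hp _]]] Ev Ep.
have Ew m : (m < n)%N -> E (w m).
  by move: m; apply: submod_coef => // t; rewrite -hp.
exists (fun t => v + \sum_(m < n) t ^+ m.+1 *: (m.+1%:R^-1 *: w m)); split.
- have h m := pfderiv_monom m.+1 (m.+1%:R^-1 *: w m).
  apply: pfderiv_ext (pfderivD (pfderiv_cst v)
    (pfderiv_sum (index_enum 'I_n) (P := xpredT) (fun i _ => h i))) => t //.
  rewrite add0r hp; apply: eq_bigr => i _.
  by rewrite scalerA mulrAC mulfV ?mul1r ?natr_neq0.
- by rewrite big1 ?addr0 // => m _; rewrite exprS mul0r scale0r.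
move=> t; apply: (submodD hE) => //; apply: (submod_sum hE) => m _ _.
by do 2 apply: (submodZ hE); apply: Ew.
Qed.

(** Taylor's formula for functions that are successive derivatives only modulo F; no remainder is
    left because the n-th one lies in F. *)
Lemma taylor_mod F n (p : nat -> k -> V) : submod F ->
  (forall j, exists2 q, pfderiv (p j) q & forall t, F (q t - p j.+1 t)) ->
  (forall t, F (p n t)) ->
  forall t, F (p 0%N t - \sum_(j < n) (t ^+ j / j`!%:R) *: p j 0).
Proof.
move=> hF; elim: n p => [|n IH] p hd hn t.
  by rewrite big_ord0 subr0.
have {}IH := IH (fun j => p j.+1) (fun j => hd j.+1) hn.
have [q hq Fq] := hd 0%N.
have hs j : pfderiv (fun t => (t ^+ j / j`!%:R) *: p j 0)
    (fun t => (j%:R * t ^+ j.-1 / j`!%:R) *: p j 0).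
  apply: pfderiv_ext (pfderiv_monom j (j`!%:R^-1 *: p j 0)) => u.
    by rewrite scalerA.
  by rewrite scalerA.
have h := pfderivB hq (pfderiv_sum (index_enum 'I_n.+1) (P := xpredT) (fun j _ => hs j)).
have := pfderiv_cst_mod hF h _ t; set r0 := (X in _ - X) => /(_ _).
have -> : r0 = 0.
  rewrite /r0 big_ord_recl big1 => [|i _]; last by rewrite exprS !mul0r scale0r.
  by rewrite expr0 invr1 mulr1 scale1r addr0 subrr.
rewrite subr0; apply => u; rewrite big_ord_recl /= !mul0r scale0r add0r.
apply: (submod_trans hF (Fq u)).
have := IH u; congr (F (_ - _)); apply: eq_bigr => i _.
by rewrite /= [in RHS]mulrAC (factVS char0) [in RHS]mulrC.
Qed.

End OneSpace.

Lemma pfderiv_lin (V W : lmodType k) (f : V -> W) p p' :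
  (forall a x y, f (a *: x + y) = a *: f x + f y) ->
  pfderiv p p' -> pfderiv (fun t => f (p t)) (fun t => f (p' t)).
Proof.
move=> hf [n [w [hp hp']]].
have f0 : f 0 = 0 by have := hf (-1) 0 0; rewrite scaler0 addr0 scaleN1r addNr.
have fs (c : nat -> k) : f (\sum_(m < n) c m *: w m) = \sum_(m < n) c m *: f (w m).
  by elim/big_rec2: _ => [//|i x y _ <-]; rewrite hf.
exists n, (fun m => f (w m)); split=> t; first by rewrite hp (fs (fun m => t ^+ m)).
by rewrite hp' (fs (fun m => m%:R * t ^+ m.-1)).
Qed.

(** Leibniz rule for maps that are linear only on a submodule E, such as the elements of degree 0.
    The coefficients of p lie in E by [submod_coef], so linearity may be applied to its
    expansion. *)
Lemma pfderiv_app (V U : lmodType k) (E : V -> Prop) (G G' : V -> k -> U) p p' :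
  submod E -> pfderiv p p' -> (forall t, E (p t)) ->
  (forall a x y t, E x -> E y -> G (a *: x + y) t = a *: G x t + G y t) ->
  (forall a x y t, E x -> E y -> G' (a *: x + y) t = a *: G' x t + G' y t) ->
  (forall v, E v -> pfderiv (G v) (G' v)) ->
  pfderiv (fun t => G (p t) t) (fun t => G (p' t) t + G' (p t) t).
Proof.
move=> hE [n [w [hp hp']]] Ep Glin Glin' hG.
have Ew m : (m < n)%N -> E (w m).
  by move: m; apply: submod_coef => // t; rewrite -hp.
have sums (H : V -> U) : (forall a x y, E x -> E y -> H (a *: x + y) = a *: H x + H y) ->
    forall c : nat -> k, H (\sum_(m < n) c m *: w m) = \sum_(m < n) c m *: H (w m).
  move=> hH c; have H0 : H 0 = 0.
    have := hH (-1) 0 0 (submod0 hE) (submod0 hE).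
    by rewrite scaler0 addr0 scaleN1r addNr.
  have [_ //] : E (\sum_(m < n) c m *: w m) /\
    H (\sum_(m < n) c m *: w m) = \sum_(m < n) c m *: H (w m).
  elim/big_rec2: _ => [|i x y _ [Ex IH]]; first by split; [exact: submod0|].
  have Ewi := Ew i (ltn_ord i).
  by split; [apply: hE.2 | rewrite hH // IH].
have h (m : 'I_n) := pfderiv_pscale 'X^m (hG _ (Ew m (ltn_ord m))).
apply: pfderiv_ext (pfderiv_sum (index_enum 'I_n) (P := xpredT) (fun i _ => h i)) => t.
  rewrite hp (sums (G^~ t)); last by move=> *; apply: Glin.
  by apply: eq_bigr => m _; rewrite hornerXn.
rewrite hp' hp (sums (G^~ t) _ (fun m => m%:R * t ^+ m.-1)); last by move=> *; apply: Glin.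
rewrite (sums (G'^~ t) _ (fun m => t ^+ m)); last by move=> *; apply: Glin'.
rewrite -big_split; apply: eq_bigr => m _.
by rewrite derivXn hornerMn !hornerXn mulr_natl.
Qed.

Lemma pfderiv_bilin (V W U : lmodType k) (B : V -> W -> U) p p' q q' :
  (forall a x y z, B (a *: x + y) z = a *: B x z + B y z) ->
  (forall a x y z, B z (a *: x + y) = a *: B z x + B z y) ->
  pfderiv p p' -> pfderiv q q' ->
  pfderiv (fun t => B (p t) (q t)) (fun t => B (p' t) (q t) + B (p t) (q' t)).
Proof.
move=> Bl Br hp hq.
apply: (@pfderiv_app _ _ xpredT (fun v t => B v (q t)) (fun v t => B v (q' t))) => //.
by move=> v _; apply: pfderiv_lin hq => *; apply: Br.
Qed.

End PolyFun.

(** * Infinite sums in a complete dg Lie algebra *)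

Section Graded.
Variables (k : fieldType) (W : gradedModule k).

Lemma homog_gproj i (x : W) : homog i (gproj W i x).
Proof. by rewrite /homog gprojK eqxx. Qed.

Lemma homog_submod i : submod (@homog k W i).
Proof.
split=> [|a x y hx hy]; rewrite /homog ?raddf0 //.
by rewrite linearP hx hy.
Qed.

Lemma gproj_homog i j (x : W) : homog j x -> gproj W i x = if i == j then x else 0.
Proof. by move=> hx; rewrite -{1}hx gprojK hx. Qed.

Lemma degsP (x : W) : uniq (degs x) /\ x = \sum_(i <- degs x) gproj W i x.
Proof. by have /andP[-> /eqP] := xchooseP (gproj_fin x). Qed.

Lemma sum_degs (V : lmodType k) i (x : W) (f : int -> W -> V) : homog i x ->
  (forall j, f j 0 = 0) -> \sum_(j <- degs x) f j (gproj W j x) = f i x.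
Proof.
move=> hx f0; have [ud xE] := degsP x.
have E (U : lmodType k) (h : int -> W -> U) : (forall j, h j 0 = 0) ->
    \sum_(j <- degs x) h j (gproj W j x) = if i \in degs x then h i x else 0.
  move=> h0; case: ifP => di.
    rewrite (bigD1_seq i) //= (gproj_homog _ hx) eqxx big1 ?addr0 // => j ij.
    by rewrite (gproj_homog _ hx) (negbTE ij).
  rewrite big_seq big1 // => j dj; rewrite (gproj_homog _ hx) ifN //.
  by apply: contraTneq dj => ->; rewrite di.
rewrite E //; case: ifP => // di.
have : x = 0 by rewrite xE (E W (fun _ => id)) ?di.
by move->; rewrite f0.
Qed.

Lemma sgn_deg_homog i (x : W) : homog i x -> sgn_deg x = (-1 : k) ^ i *: x.
Proof.
by move=> hx; rewrite /sgn_deg (sum_degs (f := fun i x => (-1 : k) ^ i *: x) hx) // => j; rewrite scaler0.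
Qed.

Lemma parity_part_homog b i (x : W) : homog i x ->
  parity_part b x = if odd `|i|%N == b then x else 0.
Proof.
move=> hx; rewrite /parity_part big_mkcond /=.
rewrite (sum_degs (f := fun i x => if odd `|i|%N == b then x else 0) hx) // => j.
by case: ifP.
Qed.

End Graded.

Lemma sum_diff (V : zmodType) (T : eqType) (s s' : seq T) (P : pred T) (G : T -> V) :
  uniq s -> uniq s' -> {subset s <= s'} ->
  \sum_(i <- s' | P i) G i - \sum_(i <- s | P i) G i =
  \sum_(i <- s' | P i && (i \notin s)) G i.
Proof.
move=> us us' ss; rewrite (bigID (mem s)) /= addrAC.
suff -> : \sum_(i <- s' | P i && (i \in s)) G i = \sum_(i <- s | P i) G i.
  by rewrite subrr add0r.
rewrite (eq_bigl (fun i => (i \in s) && P i)) => [|i]; last by rewrite andbC.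
rewrite -big_filter_cond; apply: perm_big.
apply: uniq_perm; rewrite ?filter_uniq // => i; rewrite mem_filter.
by apply/andP/idP => [[]//|si]; split=> //; apply: ss.
Qed.

Section CompleteSums.

Variables (k : fieldType) (g : completeDgLie k).

Lemma filt_submod n : submod (@filt k g n).
Proof. by split=> [|a x y]; [apply: filt0 | apply: filt_linear]. Qed.

Lemma filt_filtration : filtration (@filt k g).
Proof. by split=> [n|n x]; [apply: filt_submod | apply: filt_desc]. Qed.

Lemma filt_separated (x : g) : (forall n, filt n x) -> x = 0.
Proof.
move=> h; have [_ ->] := degsP x; rewrite big1 // => i _.
by apply: (@filt_sep _ _ i); [apply: homog_gproj | move=> n; apply: filt_proj].
Qed.

Variables (I : eqType) (P : pred I).

Lemma has_sum_unique (t : I -> g) x y :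
  has_sum (@filt k g) P t x -> has_sum (@filt k g) P t y -> x = y.
Proof.
move=> hx hy; apply/eqP; rewrite -subr_eq0; apply/eqP/filt_separated => n.
have [s1 h1] := hx n; have [s2 h2] := hy n.
pose s := undup (s1 ++ s2).
apply: (submod_trans (filt_submod n) (y := \sum_(i <- s | P i) t i)).
  by apply: h1; rewrite ?undup_uniq // => i is1; rewrite mem_undup mem_cat is1.
apply: (submodC (filt_submod n)).
by apply: h2; rewrite ?undup_uniq // => i is1; rewrite mem_undup mem_cat is1 orbT.
Qed.

Variables (d : int) (t : I -> g).
Hypothesis td : forall i, P i -> homog d (t i).
Hypothesis tsmall : forall N, exists s : seq I, forall i, i \notin s -> P i -> filt N (t i).

(** The sums over the sets S N form a sequence to which completeness in degree d applies. *)
Lemma has_sum_exists : exists2 x, homog d x & has_sum (@filt k g) P t x.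
Proof.
pose s_ N : seq I := sval (cid (tsmall N)).
have hs N i : i \notin s_ N -> P i -> filt N (t i) by rewrite /s_; case: cid => s h; apply: h.
(* The union over all j up to N makes the index sets increase with N. *)
pose S N := undup (flatten [seq s_ j | j <- iota 0 N.+1]).
have Ssub N j : (j <= N)%N -> {subset s_ j <= S N}.
  move=> jN i ij; rewrite mem_undup; apply/flattenP; exists (s_ j) => //.
  by apply: map_f; rewrite mem_iota add0n ltnS.
have SS N : {subset S N <= S N.+1}.
  move=> i; rewrite mem_undup => /flattenP[r /mapP[j jN ->{r}] ij].
  have {}jN : (j < N.+1)%N by move: jN; rewrite mem_iota.
  by apply: (Ssub _ j) ij; apply: ltnW.
pose u N := \sum_(i <- S N | P i) t i.
have near N s : uniq s -> {subset S N <= s} -> filt N (\sum_(i <- s | P i) t i - u N).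
  move=> us ss; rewrite sum_diff ?undup_uniq //.
  apply: (submod_sum (filt_submod N)) => i _ /andP[Pi iS]; apply: hs => //.
  by apply: contra iS; apply: Ssub.
have [||x xd hx] := @filt_complete _ g d u.
- move=> N; rewrite /u; apply: (submod_sum (homog_submod g d)) => i _; exact: td.
- by move=> N; apply: near; [apply: undup_uniq | apply: SS].
exists x => // N; exists (S N) => s us ss.
apply: (submod_trans (filt_submod N) (hx N)); apply: (submodC (filt_submod N)).
exact: near.
Qed.

Lemma infsum_has_sum : has_sum (@filt k g) P t (infsum (@filt k g) P t).
Proof.
by apply: (@xgetPex _ 0 (has_sum (@filt k g) P t)); have [x _ hx] := has_sum_exists; exists x.
Qed.

Lemma infsum_homog : homog d (infsum (@filt k g) P t).
Proof.
have [x xd hx] := has_sum_exists.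
by rewrite (has_sum_unique infsum_has_sum hx).
Qed.

Lemma infsum_cong N s : uniq s -> (forall i, i \notin s -> P i -> filt N (t i)) ->
  filt N (infsum (@filt k g) P t - \sum_(i <- s | P i) t i).
Proof.
move=> us hs; have [s0 h0] := infsum_has_sum N.
pose s' := undup (s ++ s0).
apply: (submod_trans (filt_submod N) (y := \sum_(i <- s' | P i) t i)).
  by apply: h0; rewrite ?undup_uniq // => i is1; rewrite mem_undup mem_cat is1 orbT.
rewrite sum_diff ?undup_uniq //; last by move=> i is1; rewrite mem_undup mem_cat is1.
by apply: (submod_sum (filt_submod N)) => i _ /andP[Pi iS]; apply: hs.
Qed.

End CompleteSums.

(** * Pre-Lie products on elements of degree 0 *)

Section Shuffles.

Variable n : nat.
Implicit Types (b : {set 'I_n}) (sigma : 'S_n).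

Definition ordlt (i j : 'I_n) := (i < j)%N.

Lemma enum_ordlt_sorted b : sorted ordlt (enum b).
Proof.
rewrite (_ : enum b = filter (mem b) (enum 'I_n)); last by rewrite [in RHS]/enum_mem filter_predT.
apply: sorted_filter => [i j l|]; first exact: ltn_trans.
rewrite (_ : ordlt = relpre val ltn) // -sorted_map val_enum_ord.
exact: iota_ltn_sorted.
Qed.

Definition perm_seq sigma : seq 'I_n := [seq sigma i | i <- enum 'I_n].

Lemma size_perm_seq sigma : size (perm_seq sigma) = n.
Proof. by rewrite size_map size_enum_ord. Qed.

Lemma nth_perm_seq sigma x (i : 'I_n) : nth x (perm_seq sigma) i = sigma i.
Proof. by rewrite (nth_map i) ?size_enum_ord // nth_ord_enum. Qed.

Lemma uniq_perm_seq sigma : uniq (perm_seq sigma).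
Proof. by rewrite map_inj_uniq ?enum_uniq //; apply: perm_inj. Qed.

Lemma perm_seq_inj : injective perm_seq.
Proof.
by move=> s t h; apply/permP => i; rewrite -(nth_perm_seq s i i) h nth_perm_seq.
Qed.

Definition split_seq b := enum b ++ enum (~: b).

Lemma perm_split_seq b : perm_eq (split_seq b) (enum 'I_n).
Proof.
apply: uniq_perm; rewrite ?enum_uniq // ?cat_uniq ?enum_uniq ?andbT /=.
  by apply/hasPn => i; rewrite !mem_enum inE.
by move=> i; rewrite mem_cat !mem_enum !inE; case: (i \in b).
Qed.

Lemma split_perm_exists b : exists sigma, perm_seq sigma == split_seq b.
Proof.
have /tuple_permP[p hp] : perm_eq (split_seq b) (ord_tuple n) by rewrite perm_split_seq.
by exists p; apply/eqP; rewrite hp /perm_seq; apply: eq_map => i; rewrite tnth_ord_tuple.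
Qed.

Definition split_perm b : 'S_n := xchoose (split_perm_exists b).

Lemma split_permE b : perm_seq (split_perm b) = split_seq b.
Proof. exact: (eqP (xchooseP (split_perm_exists b))). Qed.

Definition first_set q sigma : {set 'I_n} := [set sigma i | i : 'I_n & (i < q)%N].

Lemma mem_first_set q sigma (i : 'I_n) : (q <= n)%N ->
  (i \in first_set q sigma) = (i \in take q (perm_seq sigma)).
Proof.
move=> qn; apply/imsetP/idP => [[j]|].
  rewrite inE => jq ->; rewrite -[sigma j](nth_perm_seq sigma j j).
  rewrite -(nth_take j jq); apply: mem_nth; by rewrite size_takel // size_perm_seq.
move=> /(nthP i)[j]; rewrite size_takel ?size_perm_seq // => jq <-.
have jn := leq_trans jq qn; exists (Ordinal jn); first by rewrite inE.
by rewrite nth_take // (nth_perm_seq sigma i (Ordinal jn)).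
Qed.

Lemma card_first_set q sigma : (q <= n)%N -> #|first_set q sigma| = q.
Proof.
move=> qn; transitivity #|take q (perm_seq sigma)|; last first.
  by move/card_uniqP: (take_uniq q (uniq_perm_seq sigma)) => ->; rewrite size_takel ?size_perm_seq.
by apply: eq_card => i; apply: mem_first_set.
Qed.

Lemma ordlt_trans : transitive ordlt. Proof. by move=> i j l; apply: ltn_trans. Qed.
Lemma ordlt_irr : irreflexive ordlt. Proof. by move=> i; apply: ltnn. Qed.

(** A shuffle lists each of its two blocks in increasing order, and an increasing list is determined
    by its set of entries. *)
Lemma shuffle_split q sigma : (q <= n)%N -> shuffle q sigma ->
  perm_seq sigma = split_seq (first_set q sigma).
Proof.
move=> qn /forallP sh.
have srt (s : seq 'I_n) : (forall x (i j : nat), (i < j)%N -> (j < size s)%N ->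
    ordlt (nth x s i) (nth x s j)) -> sorted ordlt s.
  case: s => // x0 s h; apply/(sortedP x0) => i hi; exact: h.
rewrite -(cat_take_drop q (perm_seq sigma)); congr (_ ++ _).
  apply: (irr_sorted_eq ordlt_trans ordlt_irr _ (enum_ordlt_sorted _)) => [|i].
    apply: srt => x i j ij; rewrite size_takel ?size_perm_seq // => jq.
    have jn := leq_trans jq qn; have i_n := ltn_trans ij jn.
    rewrite !nth_take ?(ltn_trans ij jq) // (nth_perm_seq sigma x (Ordinal i_n)).
    rewrite (nth_perm_seq sigma x (Ordinal jn)).
    by have /forallP/(_ (Ordinal jn)) := sh (Ordinal i_n); rewrite /= ij jq.
  by rewrite mem_enum mem_first_set.
apply: (irr_sorted_eq ordlt_trans ordlt_irr _ (enum_ordlt_sorted _)) => [|i].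
  apply: srt => x i j ij; rewrite size_drop size_perm_seq ltn_subRL => jn.
  have i_n : (q + i < n)%N by apply: leq_ltn_trans jn; rewrite leq_add2l ltnW.
  rewrite !nth_drop (nth_perm_seq sigma x (Ordinal i_n)).
  rewrite (nth_perm_seq sigma x (Ordinal jn)).
  have /forallP/(_ (Ordinal jn)) := sh (Ordinal i_n).
  by rewrite /= ltn_add2l ij leq_addr orbT.
rewrite mem_enum inE mem_first_set //.
have := uniq_perm_seq sigma; rewrite -{1}(cat_take_drop q (perm_seq sigma)) cat_uniq.
move=> /and3P[_ /hasPn dis _].
have : i \in perm_seq sigma by rewrite -[i](permKV sigma) map_f ?mem_enum.
rewrite -{1}(cat_take_drop q (perm_seq sigma)) mem_cat.
by case: (boolP (i \in drop q _)) => [/dis/negbTE->|_]; rewrite ?orbF // => ->.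
Qed.

Lemma split_shuffle b : shuffle #|b| (split_perm b).
Proof.
apply/forallP => i; apply/forallP => j; apply/implyP => /andP[ij h].
have sb : size (enum b) = #|b| by rewrite cardE.
rewrite -(nth_perm_seq (split_perm b) i i) -(nth_perm_seq (split_perm b) i j) split_permE.
rewrite /split_seq !nth_cat sb; case/orP: h => [jq|qi].
  rewrite jq (ltn_trans ij jq).
  have := sorted_ltn_nth ordlt_trans i (enum_ordlt_sorted b) (val i) (val j).
  by rewrite !inE sb; apply=> //; apply: ltn_trans ij jq.
rewrite [(i < #|b|)%N]ltnNge qi [(j < #|b|)%N]ltnNge (leq_trans qi (ltnW ij)) /=.
have sc : size (enum (~: b)) = (n - #|b|)%N by rewrite -cardE cardsCs finset.setCK card_ord.
have hj := ltn_ord j; have qj := leq_trans qi (ltnW ij).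
apply: (sorted_ltn_nth ordlt_trans i (enum_ordlt_sorted (~: b))).
- by rewrite inE sc ltn_sub2r // (leq_ltn_trans qj).
- by rewrite inE sc ltn_sub2r // (leq_ltn_trans qj).
by rewrite ltn_sub2r // (leq_ltn_trans qi ij).
Qed.

Lemma first_set_split b : first_set #|b| (split_perm b) = b.
Proof.
have bn : (#|b| <= n)%N by rewrite -[n in (_ <= n)%N]card_ord max_card.
apply/setP => i; rewrite mem_first_set // split_permE /split_seq.
by rewrite cardE take_size_cat // mem_enum.
Qed.

(** Subsets are easier to handle than shuffles: permutations of the arguments act on them by direct
    image, and counting them gives the binomial coefficients. *)
Lemma sum_shuffles (V : nmodType) q (G : seq 'I_n -> seq 'I_n -> V) : (q <= n)%N ->
  \sum_(sigma | shuffle q sigma) G (take q (perm_seq sigma)) (drop q (perm_seq sigma)) =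
  \sum_(b : {set 'I_n} | #|b| == q) G (enum b) (enum (~: b)).
Proof.
move=> qn.
rewrite (reindex_onto split_perm (first_set q)) => [|sigma sh]; last first.
  by apply: perm_seq_inj; rewrite split_permE -shuffle_split.
apply: eq_big => [b|b /andP[_ /eqP hb]].
  apply/andP/eqP => [[_ /eqP <-]|<-]; first exact: card_first_set.
  by rewrite split_shuffle first_set_split.
have cb : size (enum b) = q by rewrite -cardE -{1}hb card_first_set.
by rewrite split_permE /split_seq take_size_cat // drop_size_cat.
Qed.

End Shuffles.

Section Good.

Variables (k : fieldType) (W : gradedModule k).
Implicit Types (mu nu : multiop W) (l : seq W).

Definition deg0 l := forall x, x \in l -> homog 0 x.

Lemma deg0_cons x l : homog 0 x -> deg0 l -> deg0 (x :: l).
Proof. by move=> hx hl y; rewrite inE => /predU1P[->|/hl]. Qed.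

Lemma deg0_cat l1 l2 : deg0 l1 -> deg0 l2 -> deg0 (l1 ++ l2).
Proof. by move=> h1 h2 y; rewrite mem_cat => /orP[/h1|/h2]. Qed.

Lemma deg0_nseq n x : homog 0 x -> deg0 (nseq n x).
Proof. by move=> hx y /nseqP[->]. Qed.

Lemma deg0_map (T : eqType) (u : T -> W) s : (forall i, homog 0 (u i)) -> deg0 (map u s).
Proof. by move=> h _ /mapP[i _ ->]. Qed.

Definition vanishing mu := forall l1 l2, mu (l1 ++ 0 :: l2) = 0.

Lemma vanishingP mu l : vanishing mu -> 0 \in l -> mu l = 0.
Proof. by move=> h /splitPr[l1 l2]; apply: h. Qed.

(** The odd parts of the arguments are zero, so that only the constant choice e = false survives,
    with Koszul sign 1. *)
Lemma prelie_deg0 mu nu v : vanishing mu -> vanishing nu -> deg0 v ->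
  prelie mu nu v =
  \sum_(1 <= q < (size v).+1) \sum_(b : {set 'I_(size v)} | #|b| == q)
    mu (nu [seq nth 0 v (val i) | i <- enum b] ::
        [seq nth 0 v (val i) | i <- enum (~: b)]).
Proof.
move=> mu0 nu0 hv; rewrite /prelie; apply: eq_big_nat => q /andP[_ qn].
set n := size v in qn *; pose u (i : 'I_n) := nth 0 v i.
have hu i : homog 0 (u i) by apply/hv/mem_nth.
rewrite -(sum_shuffles (fun s1 s2 => mu (nu (map u s1) :: map u s2))) //.
apply: eq_bigr => sigma _.
rewrite (bigD1 [ffun=> false]) //= [X in _ + X]big1 ?addr0 => [|e e0].
  rewrite /koszul big1 ?scale1r => [|i _]; last first.
    by apply: big1 => j _; rewrite !ffunE expr0.
  rewrite map_take map_drop /perm_seq; set w := [seq _ | _ <- _].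
  suff -> : w = map (u \o sigma) (enum 'I_n) by rewrite map_comp.
  by apply: eq_map => i; rewrite /= ffunE (parity_part_homog _ (hu (sigma i))).
have [i0 hi0] : exists i, e i.
  apply/existsP; apply: contraNT e0; rewrite negb_exists => /forallP h.
  by apply/eqP/ffunP => i; rewrite ffunE; apply/negbTE.
set w := [seq _ | _ <- _].
have w0 : 0 \in w.
  apply/mapP; exists ((sigma^-1)%g i0); first by rewrite mem_enum.
  by rewrite permKV hi0 (parity_part_homog _ (hu i0)).
rewrite -(cat_take_drop q w) mem_cat in w0.
by case/orP: w0 => w0; rewrite (vanishingP (l := _ :: _) mu0) ?scaler0 // inE ?w0 ?orbT // (vanishingP nu0) ?eqxx.
Qed.

Lemma prelie_vanishing mu nu : vanishing mu -> vanishing nu -> vanishing (prelie mu nu).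
Proof.
move=> mu0 nu0 l1 l2; set v := l1 ++ 0 :: l2.
rewrite /prelie big1 // => q _; rewrite big1 // => sigma _; rewrite big1 // => e _.
set w := [seq _ | _ <- _].
have w0 : 0 \in w.
  have pn : (size l1 < size v)%N by rewrite /v size_cat /= addnS ltnS leq_addr.
  apply/mapP; exists ((sigma^-1)%g (Ordinal pn)); first by rewrite mem_enum.
  rewrite permKV /v nth_cat ltnn subnn /=.
  by rewrite (parity_part_homog _ (submod0 (homog_submod W 0))); case: ifP.
rewrite -(cat_take_drop q w) mem_cat in w0.
by case/orP: w0 => w0; rewrite (vanishingP (l := _ :: _) mu0) ?scaler0 // inE ?w0 ?orbT // (vanishingP nu0) ?eqxx.
Qed.

Lemma prelie_nseq mu nu n x : vanishing mu -> vanishing nu -> homog 0 x ->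
  prelie mu nu (nseq n x) =
  \sum_(1 <= q < n.+1) mu (nu (nseq q x) :: nseq (n - q) x) *+ 'C(n, q).
Proof.
move=> mu0 nu0 hx; rewrite prelie_deg0 //; last exact: deg0_nseq.
rewrite size_nseq; apply: eq_big_nat => q /andP[_ qn].
have E (s : seq 'I_n) : [seq nth 0 (nseq n x) (val i) | i <- s] = nseq (size s) x.
  by elim: s => //= i s ->; rewrite nth_nseq ltn_ord.
transitivity (\sum_(b : {set 'I_n} | #|b| == q) mu (nu (nseq q x) :: nseq (n - q) x)).
  apply: eq_bigr => b /eqP bq; rewrite !E -!cardE bq.
  by rewrite cardsCs finset.setCK card_ord bq.
rewrite sumr_const; congr (_ *+ _).
by rewrite -[in RHS](card_ord n) -card_draws cardsE.
Qed.

(* The part of symop that concerns arguments of degree 0, where all the Koszul signs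
   are trivial.  It is stable under the pre-Lie product with an operation of degree 0. *)
Record good (F : nat -> W -> Prop) (c : int) mu : Prop := Good {
  good_vanishing : vanishing mu;
  good_linear : forall l1 l2 a x y, deg0 l1 -> deg0 l2 -> homog 0 x -> homog 0 y ->
    mu (l1 ++ (a *: x + y) :: l2) = a *: mu (l1 ++ x :: l2) + mu (l1 ++ y :: l2);
  good_sym : forall l l', deg0 l -> perm_eq l l' -> mu l = mu l';
  good_homog : forall l, deg0 l -> homog c (mu l);
  good_filt : forall l js, deg0 l -> size js = size l ->
    (forall i, F (nth 0%N js i) (nth 0 l i)) -> F (sumn js) (mu l) }.

Lemma symop_vanishing F c mu : symop F c mu -> vanishing mu.
Proof.
move=> h l1 l2; have := symop_linear h l1 l2 (-1) 0 0.
by rewrite scaler0 addr0 scaleN1r addNr.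
Qed.

Lemma seq_ordE l : l = [seq nth 0 l (val i) | i <- enum 'I_(size l)].
Proof.
by rewrite -[LHS](mkseq_nth 0) /mkseq -val_enum_ord -map_comp.
Qed.

Lemma symop_filt_seq F c mu l js : symop F c mu -> size js = size l ->
  (forall i, F (nth 0%N js i) (nth 0 l i)) -> F (sumn js) (mu l).
Proof.
move=> h sj hj.
have := symop_filt h (j := fun i : 'I_(size l) => nth 0%N js (val i))
  (v := fun i : 'I_(size l) => nth 0 l (val i)) (fun i => hj _).
rewrite -seq_ordE -(big_mkord xpredT (nth 0%N js)) -sj.
by rewrite -(big_nth 0%N xpredT id) -sumnE.
Qed.

Lemma symop_good F c mu : symop F c mu -> good F c mu.
Proof.
move=> h; have hn l (i : 'I_(size l)) : deg0 l -> homog 0 (nth 0 l (val i)).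
  by move=> hl; apply: hl; apply: mem_nth; apply: ltn_ord.
split.
- exact: symop_vanishing h.
- by move=> *; apply: (symop_linear h).
- move=> l l' hl; rewrite perm_sym => /(@tuple_permP _ _ _ (in_tuple l))[p ->].
  rewrite {1}(seq_ordE l).
  have := symop_sym h (v := fun i : 'I_(size l) => nth 0 l (val i)) (d := fun=> 0) p.
  move=> /(_ (fun i => hn l i hl)).
  rewrite {1}/koszul big1 ?scale1r => [<-|i _]; last by apply: big1.
  by congr mu; apply: eq_map => i; rewrite (tnth_nth 0).
- move=> l hl; have := symop_homog h (d := fun=> 0) (fun i => hn l i hl).
  by rewrite big1 // add0r -seq_ordE.
by move=> l js _; apply: (symop_filt_seq h).
Qed.

(** The identity has arity one and lies outside 𝔟; since [good] does not restrict the arity, the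
    iterates that define e^λ are covered by the same lemmas as those of f. *)
Lemma good_unary_id F : (forall n, F n 0) -> good F 0 (unary id).
Proof.
move=> F0; split.
- by move=> [|u [|u' l1]] [|v l2].
- case=> [|u [|u' l1]] [|v l2] a x y //= *; rewrite ?scaler0 ?addr0 //.
- move=> [|u [|u' l]] l' _ hp.
  + by rewrite perm_sym in hp; rewrite (perm_nilP hp).
  + by move: hp; rewrite perm_sym => /perm_small_eq ->.
  have := perm_size hp; case: l' {hp} => [|? [|? ?]] //.
- move=> [|u [|u' l]] hl; rewrite /=; try exact: (submod0 (homog_submod _ _)).
  by apply: hl; rewrite mem_head.
move=> [|u [|u' l]] [|j [|j' js]] //= hl _ hj.
by rewrite addn0; apply: (hj 0%N).
Qed.

Lemma prelie_deg0_ord n mu nu v : size v = n -> vanishing mu -> vanishing nu -> deg0 v ->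
  prelie mu nu v =
  \sum_(1 <= q < n.+1) \sum_(b : {set 'I_n} | #|b| == q)
    mu (nu [seq nth 0 v (val i) | i <- enum b] ::
        [seq nth 0 v (val i) | i <- enum (~: b)]).
Proof. by move=> <-; apply: prelie_deg0. Qed.

Lemma linear_slot n mu (w : 'I_n -> W) (p : 'I_n) (s : seq 'I_n) a x y :
  (forall l1 l2 a x y, deg0 l1 -> deg0 l2 -> homog 0 x -> homog 0 y ->
    mu (l1 ++ (a *: x + y) :: l2) = a *: mu (l1 ++ x :: l2) + mu (l1 ++ y :: l2)) ->
  (forall i, homog 0 (w i)) -> homog 0 x -> homog 0 y -> uniq s -> p \in s ->
  let u z i := if i == p then z else w i in
  mu (map (u (a *: x + y)) s) = a *: mu (map (u x) s) + mu (map (u y) s).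
Proof.
move=> hlin hw hx hy us ps u; case/splitPr: ps us => s1 s2.
rewrite cat_uniq => /and3P[_ h1 /andP[h2 _]].
have e z : map (u z) (s1 ++ p :: s2) = map w s1 ++ z :: map w s2.
  rewrite map_cat /= {2}/u eqxx; congr (_ ++ _ :: _); apply/eq_in_map => i si; rewrite /u ifN //.
    by apply: contraNneq h1 => ip; apply/hasP; exists p; rewrite ?mem_head // -ip.
  by apply: contraNneq h2 => <-.
by rewrite !e hlin //; apply: deg0_map.
Qed.

Lemma const_slot n (w : 'I_n -> W) (p : 'I_n) (s : seq 'I_n) z : p \notin s ->
  [seq (if i == p then z else w i) | i <- s] = map w s.
Proof.
by move=> ps; apply/eq_in_map => i si; rewrite ifN //; apply: contraNneq ps => <-.
Qed.

Lemma good_prelie F c mu nu : (forall n, submod (F n)) ->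
  good F c mu -> good F 0 nu -> good F c (prelie mu nu).
Proof.
move=> hF hmu hnu; have mu0 := good_vanishing hmu; have nu0 := good_vanishing hnu.
split; first exact: prelie_vanishing.
- move=> l1 l2 a x y h1 h2 hx hy; pose n := (size l1 + (size l2).+1)%N.
  have sz z : size (l1 ++ z :: l2) = n by rewrite size_cat.
  have pn : (size l1 < n)%N by rewrite /n addnS ltnS leq_addr.
  pose p : 'I_n := Ordinal pn; pose w (i : 'I_n) := nth 0 (l1 ++ 0 :: l2) i.
  have hw i : homog 0 (w i).
    apply: (deg0_cat h1 (deg0_cons (submod0 (homog_submod W 0)) h2)).
    by apply: mem_nth; rewrite sz.
  pose u z (i : 'I_n) := if i == p then z else w i.
  have hu z (s : seq 'I_n) : [seq nth 0 (l1 ++ z :: l2) (val i) | i <- s] = map (u z) s.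
    apply: eq_map => i; rewrite /u /w /= !nth_cat.
    rewrite -(inj_eq val_inj) /=; case: ltngtP => // [il|->]; last by rewrite subnn.
    by have := ltn_ord i; case: (i - size l1)%N (subn_gt0 (size l1) i) => [|m]; rewrite ?il.
  have hxy : homog 0 (a *: x + y) by apply: (homog_submod W 0).2.
  have hu0 z : homog 0 z -> forall i, homog 0 (u z i).
    by move=> hz i; rewrite /u; case: ifP.
  have dg z : homog 0 z -> deg0 (l1 ++ z :: l2) by move=> hz; apply: deg0_cat => //; apply: deg0_cons.
  rewrite !(prelie_deg0_ord (n := n)) //; try exact: dg.
  rewrite scaler_sumr -big_split; apply: eq_bigr => q _ /=.
  rewrite scaler_sumr -big_split; apply: eq_bigr => b _ /=.
  rewrite !hu; case: (boolP (p \in b)) => pb.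
    rewrite (linear_slot a (good_linear hnu)) ?mem_enum ?enum_uniq // -/(u x) -/(u y).
    rewrite !(const_slot w (s := enum (~: b))) ?mem_enum ?inE ?pb //.
    apply: (good_linear hmu (l1 := [::])) => //; first exact: deg0_map.
      by apply: (good_homog hnu); apply: deg0_map; apply: (hu0 _ hx).
    by apply: (good_homog hnu); apply: deg0_map; apply: (hu0 _ hy).
  rewrite !(const_slot w (s := enum b)) ?mem_enum //.
  have hX : homog 0 (nu (map w (enum b))) by apply: (good_homog hnu); apply: deg0_map.
  apply: (linear_slot (mu := fun l => mu (nu (map w (enum b)) :: l))); rewrite ?enum_uniq ?mem_enum ?inE //.
  move=> l1' l2' a' x' y' *; apply: (good_linear hmu (l1 := _ :: l1')) => //.
  exact: deg0_cons.
- move=> l l' hl hp; have hl' : deg0 l' by move=> x; rewrite -(perm_mem hp); apply: hl.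
  have sl : size l' = size l by rewrite (perm_size hp).
  rewrite (prelie_deg0_ord (n := size l)) // [RHS](prelie_deg0_ord (n := size l)) //.
  have /(@tuple_permP _ _ _ (in_tuple l))[p pE] : perm_eq l' l by rewrite perm_sym.
  have nE i : nth 0 l' (val i) = nth 0 l (val (p i)).
    by rewrite pE -tnth_nth tnth_mktuple (tnth_nth 0).
  apply: eq_bigr => q _.
  (* A permutation p of the arguments is absorbed by replacing b with its direct image under p. *)
  rewrite (reindex_inj (imset_inj (@perm_inj _ p))) /=.
  apply: eq_big => [b|b _]; first by rewrite card_imset //; apply: perm_inj.
  have pmap (b' : {set 'I_(size l)}) : perm_eq [seq nth 0 l (val i) | i <- enum (p @: b')]
      [seq nth 0 l' (val i) | i <- enum b'].
    under [X in perm_eq _ X]eq_map => i do rewrite nE.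
    rewrite (map_comp (fun i => nth 0 l (val i)) p); apply: perm_map.
    apply: uniq_perm; rewrite ?enum_uniq ?(map_inj_uniq perm_inj) ?enum_uniq //.
    move=> i; rewrite mem_enum; apply/imsetP/mapP => -[j jb ->]; exists j => //.
      by rewrite mem_enum.
    by rewrite mem_enum in jb.
  have d0 (b' : {set 'I_(size l)}) : deg0 [seq nth 0 l (val i) | i <- enum b'].
    by apply: deg0_map => i; apply: hl; apply: mem_nth; apply: ltn_ord.
  rewrite (good_sym hnu (d0 _) (pmap b)).
  have -> : ~: (p @: b) = p @: (~: b).
    apply/setP => i; rewrite !inE -[i](permKV p) !(mem_imset _ _ perm_inj) inE //.
  apply: (good_sym hmu); last by rewrite perm_cons.
  apply: deg0_cons => //; apply: (good_homog hnu); apply: deg0_map => i.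
  by apply: hl'; apply: mem_nth; rewrite sl; apply: ltn_ord.
- move=> l hl; rewrite prelie_deg0 //.
  apply: (submod_sum (homog_submod W c)) => q _ _.
  apply: (submod_sum (homog_submod W c)) => b _ _.
  have d0 (b' : {set 'I_(size l)}) : deg0 [seq nth 0 l (val i) | i <- enum b'].
    by apply: deg0_map => i; apply: hl; apply: mem_nth; apply: ltn_ord.
  by apply: (good_homog hmu); apply: deg0_cons => //; apply: (good_homog hnu).
move=> l js hl sj hj; rewrite prelie_deg0 //.
apply: (submod_sum (hF _)) => q _ _; apply: (submod_sum (hF _)) => b _ _.
have d0 (b' : {set 'I_(size l)}) : deg0 [seq nth 0 l (val i) | i <- enum b'].
  by apply: deg0_map => i; apply: hl; apply: mem_nth; apply: ltn_ord.
pose J (b' : {set 'I_(size l)}) := [seq nth 0%N js (val i) | i <- enum b'].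
have hJ (b' : {set 'I_(size l)}) i : F (nth 0%N (J b') i) (nth 0 [seq nth 0 l (val i) | i <- enum b'] i).
  case: (ltnP i (size (enum b'))) => hi; last first.
    by rewrite !nth_default ?size_map //; apply: (submod0 (hF _)).
  have x0 : 'I_(size l) by case: (enum b') hi.
  by rewrite !(nth_map x0).
have -> : sumn js = sumn (sumn (J b) :: J (~: b)).
  rewrite /= -sumn_cat /J -map_cat !sumnE [LHS](big_nth 0%N) sj big_mkord big_map.
  by rewrite [RHS](perm_big _ (perm_split_seq b)) big_enum.
apply: (good_filt hmu); rewrite /= ?size_map //.
  by apply: deg0_cons => //; apply: (good_homog hnu).
case=> [|i] /=; last exact: hJ.
by apply: (good_filt hnu); rewrite ?size_map.
Qed.

End Good.

(** * The flow of a symmetric operation *)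

Section Evaluation.

Variables (k : fieldType) (char0 : [pchar k] =i pred0) (W : gradedModule k).
Variables (F : nat -> W -> Prop) (N : nat).
Hypothesis hF : filtration F.
Hypothesis F1 : forall x, F 1 x.
Implicit Types (mu nu : multiop W) (x y : W).

Let sF n : submod (F n) := fl_sub hF n.

(* Truncations of sum_n mu_n(x, ..., x) / n! and of its derivative in the direction y. *)
Definition meval mu x : W := \sum_(n < N) n`!%:R^-1 *: mu (nseq n x).

Definition mderiv mu y x : W := \sum_(p < N.-1) p`!%:R^-1 *: mu (y :: nseq p x).

Lemma meval_submod (E : W -> Prop) mu x : submod E ->
  (forall n, E (mu (nseq n x))) -> E (meval mu x).
Proof.
move=> hE h; apply: (submod_sum hE) => n _ _; exact: (submodZ hE).
Qed.

(** The part of [good] that is stable under fixing the first argument, as the induction in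
    [pfderiv_nseq] requires. *)
Definition symlin mu :=
  (forall l1 l2 a x y, deg0 l1 -> deg0 l2 -> homog 0 x -> homog 0 y ->
    mu (l1 ++ (a *: x + y) :: l2) = a *: mu (l1 ++ x :: l2) + mu (l1 ++ y :: l2)) /\
  (forall l l', deg0 l -> perm_eq l l' -> mu l = mu l').

Lemma symlin_cons mu v : symlin mu -> homog 0 v -> symlin (fun l => mu (v :: l)).
Proof.
move=> [hl hs] hv; split=> [l1 l2 a x y h1 h2 hx hy|l l' dl ll'].
  by apply: (hl (v :: l1) l2 a x y) => //; apply: deg0_cons.
by apply: hs; [apply: deg0_cons | rewrite perm_cons].
Qed.

Lemma good_symlin c mu : good F c mu -> symlin mu.
Proof. by move=> h; split; [apply: good_linear h | apply: good_sym h]. Qed.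

(** One argument is varied by [pfderiv_app] while the induction handles the others; by symmetry the
    n slots contribute equally. *)
Lemma pfderiv_nseq mu n (x x' : k -> W) : symlin mu -> pfderiv x x' ->
  (forall t, homog 0 (x t)) ->
  pfderiv (fun t => mu (nseq n (x t)))
    (fun t => n%:R *: mu (x' t :: nseq n.-1 (x t))).
Proof.
move=> + hx h0; elim: n mu => [|n IH] mu hmu.
  by apply: pfderiv_ext (pfderiv_cst (mu [::])) => t; rewrite ?scale0r.
have h0' := pfderiv_submod char0 (homog_submod W 0) hx h0.
have := @pfderiv_app _ char0 _ _ (homog 0) (fun v t => mu (v :: nseq n (x t)))
  (fun v t => n%:R *: mu (v :: x' t :: nseq n.-1 (x t))) x x' (homog_submod W 0) hx h0.
have [lin sym] := hmu; case.
- by move=> a u v t hu hv; apply: (lin [::] (nseq n (x t)) a u v) => //; apply: deg0_nseq.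
- move=> a u v t hu hv; rewrite (lin [::] (x' t :: nseq n.-1 (x t)) a u v) //; last by apply: deg0_cons => //; apply: deg0_nseq.
  by rewrite scalerDr !scalerA mulrC.
- by move=> v hv; exact: (IH (fun l => mu (v :: l)) (symlin_cons hmu hv)).
move=> m [w [hp hp']]; exists m, w; split=> // t; rewrite -hp'.
rewrite -natr1 addrC scalerDl scale1r /=; congr (_ + _).
case: n {IH hp hp'} => [|n]; first by rewrite !scale0r.
congr (_ *: _); apply: sym; first by do 2 apply: deg0_cons => //; apply: deg0_nseq.
exact: (permEl (perm_catCA [:: x' t] [:: x t] (nseq n (x t)))).
Qed.

Lemma pfderiv_meval mu (x x' : k -> W) : symlin mu -> pfderiv x x' ->
  (forall t, homog 0 (x t)) ->
  pfderiv (fun t => meval mu (x t)) (fun t => mderiv mu (x' t) (x t)).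
Proof.
move=> hmu hx h0.
have h (n : 'I_N) := pfderivZ n`!%:R^-1 (pfderiv_nseq n hmu hx h0).
apply: pfderiv_ext (pfderiv_sum (index_enum 'I_N) (P := xpredT) (fun i _ => h i)) => t //.
rewrite /mderiv; case: (N) => [|N']; first by rewrite !big_ord0.
rewrite big_ord_recl scale0r scaler0 add0r; apply: eq_bigr => i _.
by rewrite scalerA /= /bump /= add1n mulrC factVS.
Qed.

(** The factor 1/n! turns the pre-Lie product into the derivative of mu in the direction nu(x),
    since binom(n, q)/n! = 1/(q! (n-q)!); the two truncations differ by terms with p + q >= N.
    Linearity and filtration are assumed only for the terms that occur, because for [sd], [phi] and
    f the inner value nu(x) need not have degree 0. *)
Lemma meval_prelie mu nu x : vanishing mu -> vanishing nu -> homog 0 x ->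
  nu [::] = 0 ->
  (forall p, mu (meval nu x :: nseq p x) =
     \sum_(q < N) q`!%:R^-1 *: mu (nu (nseq q x) :: nseq p x)) ->
  (forall p q, F (q + p) (mu (nu (nseq q x) :: nseq p x))) ->
  F N (meval (prelie mu nu) x - mderiv mu (meval nu x) x).
Proof.
move=> mu0 nu0 hx nunil hlin hfilt.
pose G (q p : nat) : W := (q`!%:R^-1 * p`!%:R^-1) *: mu (nu (nseq q x) :: nseq p x).
have G0 p : G 0%N p = 0 by rewrite /G /= nunil (mu0 [::]) scaler0.
have -> : meval (prelie mu nu) x = \sum_(q < N) \sum_(p < N.-1 | (q + p < N)%N) G q p.
  transitivity (\sum_(n < N) \sum_(q < N | (q <= n)%N) G q (n - q)%N).
    apply: eq_bigr => n _; rewrite prelie_nseq // scaler_sumr.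
    have nN := ltn_ord n.
    rewrite -(big_mkord (fun q => (q <= n)%N) (fun q => G q (n - q)%N)).
    rewrite -[RHS](big_nat_widen 0 n.+1 N xpredT (fun q => G q (n - q)%N)) //.
    rewrite [RHS]big_ltn // G0 add0r; apply: eq_big_nat => q /andP[_ qn].
    rewrite /G -scaler_nat scalerA; congr (_ *: _).
    rewrite -(bin_fact (n := n) (m := q)) // !natrM !invfM mulrAC mulVf ?mul1r //.
    by rewrite ((GRing.pcharf0P _).1 char0) -lt0n bin_gt0.
  rewrite (exchange_big_dep xpredT) //=; apply: eq_bigr => q _.
  rewrite -(big_mkord (fun n => (q <= n)%N) (fun n => G q (n - q)%N)).
  transitivity (\sum_(q <= n < N) G q (n - q)%N).
    by rewrite [RHS](big_nat_widenl _ 0%N).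
  rewrite -{1}[val q]add0n big_addn.
  rewrite -(big_mkord (fun p => (q + p < N)%N) (fun p => G q p)).
  case: (posnP q) => [q0|q0].
    by rewrite !big1 // => p _; rewrite ?q0 G0.
  rewrite (big_nat_widen 0 (N - q) N.-1) /=; last first.
    by have := ltn_ord q; lia.
  by apply: eq_big => [p|p _]; rewrite ?addnK // ltn_subRL addnC.
have -> : mderiv mu (meval nu x) x = \sum_(q < N) \sum_(p < N.-1) G q p.
  rewrite exchange_big; apply: eq_bigr => p _ /=; rewrite hlin scaler_sumr.
  by apply: eq_bigr => q _; rewrite scalerA mulrC.
rewrite -sumrB; apply: (submod_sum (@sF N)) => q _ _.
rewrite [X in _ - X](bigID (fun p : 'I_N.-1 => (q + p < N)%N)) /= opprD addrA subrr add0r.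
apply: (submodN (@sF N)); apply: (submod_sum (@sF N)) => p _ qp.
apply: (submodZ (@sF N)); apply: (fl_leq hF _ (hfilt p q)).
by rewrite leqNgt.
Qed.

Lemma good_nseq_filt c mu x n : good F c mu -> homog 0 x -> F n (mu (nseq n x)).
Proof.
move=> h hx; have := good_filt h (l := nseq n x) (js := nseq n 1%N).
rewrite !size_nseq sumn_nseq mul1n; apply=> //; first exact: deg0_nseq.
move=> i; rewrite !nth_nseq; case: ifP => // _; exact: (submod0 (@sF 0)).
Qed.

Lemma good_cons_filt c mu x y n m : good F c mu -> homog 0 x -> homog 0 y -> F m y ->
  F (m + n) (mu (y :: nseq n x)).
Proof.
move=> h hx hy Fy; have := good_filt h (l := y :: nseq n x) (js := m :: nseq n 1%N).
rewrite /= !size_nseq sumn_nseq mul1n; apply=> //.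
  by apply: deg0_cons => //; apply: deg0_nseq.
case=> //= i; rewrite !nth_nseq; case: ifP => // _; exact: (submod0 (@sF 0)).
Qed.

Lemma good_lin_head c mu x (c_ : nat -> k) (y_ : nat -> W) n p : good F c mu ->
  homog 0 x -> (forall q, homog 0 (y_ q)) ->
  mu (\sum_(q < n) c_ q *: y_ q :: nseq p x) =
  \sum_(q < n) c_ q *: mu (y_ q :: nseq p x).
Proof.
move=> h hx hy; have [_ //] : homog 0 (\sum_(q < n) c_ q *: y_ q) /\
  mu (\sum_(q < n) c_ q *: y_ q :: nseq p x) =
  \sum_(q < n) c_ q *: mu (y_ q :: nseq p x).
elim/big_rec2: _ => [|i u v _ [hu IH]].
  by split; [apply: (submod0 (homog_submod W 0)) | apply: (good_vanishing h [::])].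
split; first by apply: (homog_submod W 0).2.
by rewrite (good_linear h (l1 := [::])) //= ?IH //; apply: deg0_nseq.
Qed.

Lemma meval_prelie_good c mu nu x : good F c mu -> good F 0 nu -> nu [::] = 0 ->
  homog 0 x -> F N (meval (prelie mu nu) x - mderiv mu (meval nu x) x).
Proof.
move=> hmu hnu nunil hx.
have hy q : homog 0 (nu (nseq q x)) by apply: (good_homog hnu); apply: deg0_nseq.
apply: meval_prelie => //; try exact: good_vanishing.
- exact: good_vanishing hmu.
- exact: good_vanishing hnu.
- move=> p; exact: (good_lin_head (fun q => q`!%:R^-1) N p hmu hx hy).
by move=> p q; exact: (good_cons_filt p hmu hx (hy q) (good_nseq_filt q hnu hx)).
Qed.

Lemma mderiv_cong c mu x y y' : good F c mu -> homog 0 x -> homog 0 y -> homog 0 y' ->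
  F N (y - y') -> F N (mderiv mu y x - mderiv mu y' x).
Proof.
move=> h hx hy hy' Fyy; rewrite -sumrB; apply: (submod_sum (@sF N)) => p _ _.
rewrite -scalerBr; apply: (submodZ (@sF N)).
have hz : homog 0 (y - y') by apply: (submodB (homog_submod W 0)).
have -> : mu (y :: nseq p x) - mu (y' :: nseq p x) = mu ((y - y') :: nseq p x).
  have := good_linear h (l1 := [::]) (l2 := nseq p x) (-1) (x := y') (y := y).
  by rewrite scaleN1r /= addrC scaleN1r addrC => -> //=; rewrite ?(addrC (- _)) //; apply: deg0_nseq.
by apply: (fl_leq hF) (good_cons_filt p h hx hz Fyy); rewrite leq_addr.
Qed.

Lemma good_lipschitz c mu n m l x y : good F c mu -> deg0 l -> homog 0 x -> homog 0 y ->
  F n (x - y) -> F (n + (size l + m).-1) (mu (l ++ nseq m x) - mu (l ++ nseq m y)).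
Proof.
move=> h + hx hy Fxy; elim: m l => [|m IH] l hl; first by rewrite subrr; apply: (submod0 (@sF _)).
have hz : homog 0 (x - y) by apply: (submodB (homog_submod W 0)).
have -> : mu (l ++ nseq m.+1 x) = mu (l ++ (x - y) :: nseq m x) + mu (l ++ y :: nseq m x).
  have := good_linear h (l1 := l) (l2 := nseq m x) 1 (x := x - y) (y := y).
  by rewrite !scale1r subrK => -> //; apply: deg0_nseq.
rewrite -addrA; apply: (submodD (@sF _)).
  have := good_filt h (l := l ++ (x - y) :: nseq m x) (js := nseq (size l) 1%N ++ n :: nseq m 1%N).
  rewrite sumn_cat /= !sumn_nseq !mul1n !size_cat /= !size_nseq addnS /= addnCA.
  apply => //; first by apply: deg0_cat => //; apply: deg0_cons => //; apply: deg0_nseq.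
  move=> i; rewrite !nth_cat size_nseq; case: ltnP => il; first by rewrite nth_nseq il.
  case: (i - size l)%N => //= j; rewrite !nth_nseq; case: ifP => // _; exact: (submod0 (@sF 0)).
have := IH (rcons l y); rewrite size_rcons addSnnS -!cats1 -!catA; apply.
by apply: deg0_cat => //; apply: deg0_cons.
Qed.

(** A contraction: in arity at least two, a difference lying in F n is always accompanied by another
    argument, lying in F 1. *)
Lemma meval_lipschitz c mu n x y : good F c mu -> (forall l, (size l < 2)%N -> mu l = 0) ->
  homog 0 x -> homog 0 y -> F n (x - y) -> F n.+1 (meval mu x - meval mu y).
Proof.
move=> h mu2 hx hy Fxy; rewrite -sumrB; apply: (submod_sum (@sF _)) => m _ _.
rewrite -scalerBr; apply: (submodZ (@sF _)).
case: (ltnP m 2) => m2; first by rewrite !mu2 ?size_nseq // subrr; apply: (submod0 (@sF _)).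
apply: (fl_leq hF) (@good_lipschitz c mu n m [::] x y h _ hx hy Fxy) => //.
by rewrite add0n -addn1 leq_add2l; case: (val m) m2 => [|[]].
Qed.

Variable lambda : multiop W.
Hypothesis hlam : good F 0 lambda.
Hypothesis lam2 : forall l, (size l < 2)%N -> lambda l = 0.

Lemma meval_homog c mu x : good F c mu -> homog 0 x -> homog c (meval mu x).
Proof.
move=> h hx; apply: meval_submod; first exact: homog_submod.
by move=> n; apply: (good_homog h); apply: deg0_nseq.
Qed.

(** Picard iteration. Replacing x by the primitive of λ(x) improves the equation by one step of the
    filtration and keeps x polynomial in t. *)
Lemma picard alpha : homog 0 alpha -> exists x x' : k -> W,
  [/\ pfderiv x x', x 0 = alpha, forall t, homog 0 (x t) &
      forall t, F N (x' t - meval lambda (x t))].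
Proof.
(* The induction is on the precision only; the truncation order N of [meval] stays fixed. *)
move=> ha; elim: {1}N => [|n [x [x' [hx x0 hom hxx]]]].
  exists (fun=> alpha), (fun=> 0); split=> //; first exact: pfderiv_cst.
  by move=> t; apply: (fl_desc hF); apply: F1.
have hm := pfderiv_meval (good_symlin hlam) hx hom.
have hmom t : homog 0 (meval lambda (x t)) by apply: meval_homog hlam _.
have [y [hy y0 ymom]] := pfderiv_prim char0 (homog_submod W 0) hm ha hmom.
exists y, (fun t => meval lambda (x t)); split=> // t.
apply: meval_lipschitz hlam lam2 _ _ _ => //.
have := pfderiv_cst_mod char0 (@sF n) (pfderivB hx hy) hxx t.
by rewrite x0 y0 subrr subr0.
Qed.

Lemma good_iter c mu j : good F c mu -> good F c (iter j (fun mu => prelie mu lambda) mu).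
Proof. by move=> h; elim: j => //= j IH; apply: good_prelie. Qed.

(** As λ starts in arity two, each product with it raises the lowest arity by one. *)
Lemma iter_arity c mu a j l : good F c mu ->
  (forall l', deg0 l' -> (size l' < a)%N -> mu l' = 0) ->
  deg0 l -> (size l < a + j)%N ->
  iter j (fun mu => prelie mu lambda) mu l = 0.
Proof.
move=> h ha; elim: j l => [|j IH] l hl lj /=; first by apply: ha; rewrite // -[a]addn0.
have hj := good_iter j h.
rewrite prelie_deg0 //; [|exact: good_vanishing hj|exact: good_vanishing hlam].
rewrite big_nat big1 // => q /andP[q0 ql]; rewrite big1 // => b /eqP bq.
have d0 (b' : {set 'I_(size l)}) : deg0 [seq nth 0 l (val i) | i <- enum b'].
  by apply: deg0_map => i; apply: hl; apply: mem_nth; apply: ltn_ord.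
case: (ltnP q 2) => q2.
  by rewrite lam2 ?size_map -?cardE ?bq //; apply: (good_vanishing hj [::]).
apply: IH; first by apply: deg0_cons => //; apply: (good_homog hlam).
by rewrite /= size_map -cardE cardsCs finset.setCK card_ord bq; lia.
Qed.

Variables (alpha : W) (x x' : k -> W).
Hypotheses (hx : pfderiv x x') (x0 : x 0 = alpha) (xhom : forall t, homog 0 (x t)).
Hypothesis flow : forall t, F N (x' t - meval lambda (x t)).

(** Along the flow the derivative of μ(x(t)) is (μ ⋆ λ)(x(t)), so the iterates of r_λ are the
    successive derivatives. The N-th one lies in F N since it starts in arity N. *)
Lemma taylor_flow c mu t : good F c mu ->
  F N (meval mu (x t) - \sum_(j < N) (t ^+ j / j`!%:R) *:
    meval (iter j (fun mu => prelie mu lambda) mu) alpha).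
Proof.
move=> h; have x'hom := pfderiv_submod char0 (homog_submod W 0) hx xhom.
have := @taylor_mod _ char0 _ (F N) N
  (fun j u => meval (iter j (fun mu => prelie mu lambda) mu) (x u)) (@sF N).
rewrite x0 => /=; apply => [j|u]; last first.
  apply: meval_submod => // n; have [nN|nN] := ltnP n N.
    rewrite (iter_arity (a := 0) h) ?size_nseq //; first exact: (submod0 (@sF N)).
    exact: deg0_nseq.
  apply: (fl_leq hF nN); exact: (good_nseq_filt _ (good_iter N h)).
have hj := good_iter j h.
exists (fun u => mderiv (iter j (fun mu => prelie mu lambda) mu) (x' u) (x u)).
  exact: pfderiv_meval (good_symlin hj) hx xhom.
move=> u; apply: (submod_trans (@sF N)
  (y := mderiv (iter j (fun mu => prelie mu lambda) mu) (meval lambda (x u)) (x u))).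
  by apply: mderiv_cong hj _ _ _ _ => //; apply: meval_homog hlam _.
apply: (submodC (@sF N)); apply: meval_prelie_good hj hlam _ _ => //.
exact: lam2.
Qed.

End Evaluation.

Lemma sum_ord_single (V : nmodType) n m (u : nat -> V) : (m < n)%N ->
  (forall i, i != m -> u i = 0) -> \sum_(i < n) u i = u m.
Proof.
move=> mn h; rewrite (bigD1 (Ordinal mn)) //= big1 ?addr0 // => i im.
by apply: h; apply: contra im => /eqP im; apply/eqP/val_inj.
Qed.

(** * The relation λ = ∂^φ f along the flow, and the curvature *)

Section Flow.

Variables (k : fieldType) (char0 : [pchar k] =i pred0) (g : completeDgLie k).
(** The truncation order is at least 3, so that [meval] and [mderiv] keep arity two, where φ
    lives. *)
Variable n0 : nat.
Notation N := n0.+3.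
Notation W := (susp g).
Notation F := (@sfilt k g).
Notation meval := (meval N).
Notation mderiv := (mderiv N).
Notation sdg := (@sd k g).
Notation phig := (@phi k g).
Implicit Types (x y z : W).

(** Differential and bracket of g on the space of sg without any sign; the signs of [sd] and [phi]
    are made explicit by the evaluation lemmas below. *)
Definition sdiff x : W := dgd g x.
Definition sbrac x y : W := @lie k g x y.

Lemma sfilt_filtration : filtration F.
Proof. exact: filt_filtration. Qed.

Let sF n : submod (F n) := fl_sub sfilt_filtration n.

Lemma sfilt1 x : F 1 x.
Proof. exact: filt_top. Qed.

Lemma sdiffP a x y : sdiff (a *: x + y) = a *: sdiff x + sdiff y.
Proof. exact: linearP. Qed.
Lemma sdiff0 : sdiff 0 = 0. Proof. exact: linear0. Qed.
Lemma sdiffD x y : sdiff (x + y) = sdiff x + sdiff y. Proof. exact: linearD. Qed.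
Lemma sdiffN x : sdiff (- x) = - sdiff x. Proof. exact: linearN. Qed.
Lemma sbracPl a x y z : sbrac (a *: x + y) z = a *: sbrac x z + sbrac y z.
Proof. exact: (lie_linearl z). Qed.
Lemma sbracPr a x y z : sbrac z (a *: x + y) = a *: sbrac z x + sbrac z y.
Proof. exact: (lie_linearr z). Qed.
Lemma sbrac0l z : sbrac 0 z = 0.
Proof. by have := sbracPl (-1) 0 0 z; rewrite scaler0 addr0 scaleN1r addNr. Qed.
Lemma sbrac0r z : sbrac z 0 = 0.
Proof. by have := sbracPr (-1) 0 0 z; rewrite scaler0 addr0 scaleN1r addNr. Qed.
Lemma sbracZl a x z : sbrac (a *: x) z = a *: sbrac x z.
Proof. by rewrite -[a *: x]addr0 sbracPl sbrac0l addr0. Qed.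
Lemma sbracZr a x z : sbrac z (a *: x) = a *: sbrac z x.
Proof. by rewrite -[a *: x]addr0 sbracPr sbrac0r addr0. Qed.
Lemma sbracDl x y z : sbrac (x + y) z = sbrac x z + sbrac y z.
Proof. by rewrite -[x]scale1r sbracPl !scale1r. Qed.
Lemma sbracDr x y z : sbrac z (x + y) = sbrac z x + sbrac z y.
Proof. by rewrite -[x]scale1r sbracPr !scale1r. Qed.
Lemma sbracNl x z : sbrac (- x) z = - sbrac x z.
Proof. by rewrite -scaleN1r sbracZl scaleN1r. Qed.
Lemma sbracNr x z : sbrac z (- x) = - sbrac z x.
Proof. by rewrite -scaleN1r sbracZr scaleN1r. Qed.

Lemma sdiff_sum n (c_ : nat -> k) (u : nat -> W) :
  sdiff (\sum_(q < n) c_ q *: u q) = \sum_(q < n) c_ q *: sdiff (u q).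
Proof. by elim/big_rec2: _ => [|i a b _ <-]; rewrite ?sdiff0 ?sdiffP. Qed.

Lemma sbrac_sum n (c_ : nat -> k) (u : nat -> W) z :
  sbrac (\sum_(q < n) c_ q *: u q) z = \sum_(q < n) c_ q *: sbrac (u q) z.
Proof. by elim/big_rec2: _ => [|i a b _ <-]; rewrite ?sbrac0l ?sbracPl. Qed.

Lemma sfilt_sdiff n x : F n x -> F n (sdiff x).
Proof. exact: filt_dgd. Qed.
Lemma sfilt_sbrac m n x y : F m x -> F n y -> F (m + n) (sbrac x y).
Proof. exact: filt_lie. Qed.

(* In the degrees of sg, the bracket has degree -1. *)
Lemma homog_sdiff i x : homog i x -> homog (i - 1) (sdiff x).
Proof. exact: dgd_homog. Qed.

Lemma homog_sbrac i j x y : homog i x -> homog j y -> homog (i + j - 1) (sbrac x y).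
Proof.
move=> hx hy; have := @lie_homog k g (i - 1) (j - 1) x y hx hy.
by rewrite /homog /= (_ : i - 1 + (j - 1) = i + j - 1 - 1) //; ring.
Qed.

Lemma phi_pair x y i : homog i x -> phig [:: x; y] = (-1 : k) ^ (i - 1) *: sbrac x y.
Proof.
move=> hx; rewrite /phi /= (@sgn_deg_homog k g (i - 1)) //.
exact: sbracZl.
Qed.

Lemma phi_vanishing : vanishing phig.
Proof.
have s0 : @sgn_deg k g 0 = 0.
  by rewrite (@sgn_deg_homog k g 0) ?scaler0 //; apply: (submod0 (homog_submod _ _)).
case=> [|x [|y [|? ?]]] [|z [|? ?]] //=; last exact: sbrac0r.
by rewrite s0; apply: sbrac0l.
Qed.

Lemma sd_vanishing : vanishing sdg.
Proof.
case=> [|x [|? ?]] [|? ?] //=.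
by rewrite -[dgd g _]/(sdiff 0) sdiff0 oppr0.
Qed.

Lemma phi_size l : size l != 2%N -> phig l = 0.
Proof. by case: l => [|? [|? [|? ?]]]. Qed.

Lemma sd_size l : size l != 1%N -> sdg l = 0.
Proof. by case: l => [|? [|? ?]]. Qed.

Lemma meval_sd x : meval sdg x = - sdiff x.
Proof.
rewrite /meval (sum_ord_single (m := 1) (u := fun n => n`!%:R^-1 *: sdg (nseq n x))) //.
  by rewrite invr1 scale1r.
by move=> i i1; rewrite sd_size ?scaler0 // size_nseq.
Qed.

Lemma meval_phi x : homog 0 x -> meval phig x = - (2%:R^-1 *: sbrac x x).
Proof.
move=> hx; rewrite /meval (sum_ord_single (m := 2) (u := fun n => n`!%:R^-1 *: phig (nseq n x))) //.
  by rewrite (phi_pair _ hx) sub0r exprN1 invrN1 scaleN1r scalerN.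
by move=> i i2; rewrite phi_size ?scaler0 // size_nseq.
Qed.

Lemma mderiv_sd y x : mderiv sdg y x = - sdiff y.
Proof.
rewrite /mderiv (sum_ord_single (m := 0) (u := fun n => n`!%:R^-1 *: sdg (y :: nseq n x))) //.
  by rewrite invr1 scale1r.
by move=> i i0; rewrite sd_size ?scaler0 //= size_nseq.
Qed.

Lemma mderiv_phi y x : homog 1 y -> mderiv phig y x = sbrac y x.
Proof.
move=> hy; rewrite /mderiv (sum_ord_single (m := 1) (u := fun n => n`!%:R^-1 *: phig (y :: nseq n x))) //.
  by rewrite (phi_pair _ hy) subrr expr0z invr1 !scale1r.
by move=> i i1; rewrite phi_size ?scaler0 //= size_nseq.
Qed.

(** The value at x of [sd] plus [phi], hence the opposite of the usual Maurer-Cartan expression. *)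
Definition curvature x : W := - sdiff x - 2%:R^-1 *: sbrac x x.

Variables (lambda f : multiop W).
Hypotheses (lambda_b : in_b 0 lambda) (f_b : in_b 1 f).
Hypothesis df : forall v, twisted_diff 1 f v = lambda v.

Let lam_good : good F 0 lambda := symop_good lambda_b.
Let f_good : good F 1 f := symop_good f_b.

Lemma f_head (c_ : nat -> k) (y_ : nat -> W) n l :
  f (\sum_(q < n) c_ q *: y_ q :: l) = \sum_(q < n) c_ q *: f (y_ q :: l).
Proof.
elim/big_rec2: _ => [|i u v _ <-]; first exact: (symop_vanishing f_b [::]).
exact: (symop_linear f_b [::]).
Qed.

Lemma f_headP a x y l : f (a *: x + y :: l) = a *: f (x :: l) + f (y :: l).
Proof. exact: (symop_linear f_b [::]). Qed.

Lemma f_head_filt y x n m : F m y -> F (m + n) (f (y :: nseq n x)).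
Proof.
move=> Fy; have := symop_filt_seq (l := y :: nseq n x) (js := m :: nseq n 1%N) f_b.
rewrite /= !size_nseq sumn_nseq mul1n; apply=> //.
case=> //= i; rewrite !nth_nseq; case: ifP => // _; first exact: sfilt1.
exact: (submod0 (@sF 0)).
Qed.

Lemma mderiv_f_filt y x m : F m y -> F m.+1 (mderiv f y x).
Proof.
move=> Fy; apply: (submod_sum (@sF _)) => -[[|p] pN] _ _; apply: (submodZ (@sF _)).
  by rewrite (symop_arity f_b) //; apply: (submod0 (@sF _)).
by apply: (fl_leq sfilt_filtration _ (f_head_filt x p.+1 Fy)); rewrite addnS ltnS leq_addr.
Qed.

Lemma mderiv_fD y z x : mderiv f (y + z) x = mderiv f y x + mderiv f z x.
Proof.
rewrite -big_split; apply: eq_bigr => p _ /=.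
by rewrite -scalerDr -[y]scale1r f_headP !scale1r.
Qed.

(** The four products in ∂^φ f are evaluated by [meval_prelie]: those with f on the right give -dη
    and [η, x], those with f on the left combine into the derivative of f along the curvature. *)
Lemma lambda_eval x : homog 0 x ->
  let eta := meval f x in
  F N (meval lambda x - (sbrac eta x - sdiff eta + mderiv f (curvature x) x)).
Proof.
move=> hx eta.
have heta : homog 1 eta by apply: (meval_homog N f_good).
have f0 := good_vanishing f_good.
have ffilt q : F q (f (nseq q x)) by apply: (good_nseq_filt sfilt_filtration sfilt1 _ f_good).
have fhom q : homog 1 (f (nseq q x)) by apply: (good_homog f_good); apply: deg0_nseq.
have E : meval lambda x = meval (prelie sdg f) x + meval (prelie f sdg) x +
    (meval (prelie phig f) x + meval (prelie f phig) x).
  rewrite -!big_split; apply: eq_bigr => n _ /=.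
  rewrite -!scalerDr -df; congr (_ *: _).
  (* The graded commutator of degrees -1 and 1 is an anticommutator. *)
  have sgn (a b : W) : a - (-1 : k) ^ (-1 * 1) *: b = a + b.
    by rewrite mulr1 exprN1 invrN1 scaleN1r opprK.
  by congr (_ + _); apply: sgn.
have e1 : F N (meval (prelie sdg f) x - mderiv sdg eta x).
  apply: (meval_prelie char0 sfilt_filtration sd_vanishing f0 hx).
  - by rewrite (symop_arity f_b).
  - case=> [|p] /=; last by rewrite big1 // => q _; rewrite scaler0.
    rewrite -[LHS]/(- sdiff eta) /eta /meval.
    rewrite (sdiff_sum N (fun q => q`!%:R^-1) (fun q => f (nseq q x))).
    by rewrite -sumrN; apply: eq_bigr => q _; rewrite -scalerN.
  case=> [|p] q; last exact: (submod0 (@sF _)).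
  by rewrite addn0; apply: (submodN (@sF _)); apply: sfilt_sdiff.
have e2 : F N (meval (prelie f sdg) x - mderiv f (meval sdg x) x).
  apply: (meval_prelie char0 sfilt_filtration f0 sd_vanishing hx) => //.
    by move=> p; exact: (f_head (fun q => q`!%:R^-1) (fun q => sdg (nseq q x)) N (nseq p x)).
  move=> p q; apply: f_head_filt; case: q => [|[|q]] /=; try exact: (submod0 (@sF _)).
  by apply: (submodN (@sF _)); apply: sfilt_sdiff; apply: sfilt1.
have e3 : F N (meval (prelie phig f) x - mderiv phig eta x).
  apply: (meval_prelie char0 sfilt_filtration phi_vanishing f0 hx).
  - by rewrite (symop_arity f_b).
  - case=> [|[|p]] /=; try by rewrite big1 // => q _; rewrite scaler0.
    rewrite -[LHS]/(phig [:: eta; x]) (phi_pair _ heta) subrr expr0z scale1r.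
    rewrite (sbrac_sum N (fun q => q`!%:R^-1) (fun q => f (nseq q x))).
    apply: eq_bigr => q _; congr (_ *: _).
    by rewrite -[RHS]/(phig [:: f (nseq q x); x]) (phi_pair _ (fhom q)) subrr expr0z scale1r.
  case=> [|[|p]] q; try exact: (submod0 (@sF _)).
  rewrite (phi_pair _ (fhom q)); apply: (submodZ (@sF _)).
  by apply: sfilt_sbrac => //; apply: sfilt1.
have e4 : F N (meval (prelie f phig) x - mderiv f (meval phig x) x).
  apply: (meval_prelie char0 sfilt_filtration f0 phi_vanishing hx) => //.
    by move=> p; exact: (f_head (fun q => q`!%:R^-1) (fun q => phig (nseq q x)) N (nseq p x)).
  move=> p q; apply: f_head_filt; case: q => [|[|[|q]]] /=; try exact: (submod0 (@sF _)).
  rewrite -[s_ _]/(phig [:: x; x]) (phi_pair _ hx); apply: (submodZ (@sF _)).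
  by apply: (@sfilt_sbrac 1 1); apply: sfilt1.
rewrite E; apply: (submod_trans (@sF N) (y := mderiv sdg eta x + mderiv f (meval sdg x) x +
  (mderiv phig eta x + mderiv f (meval phig x) x))).
  by do 3 apply: (submod_congD (@sF N)) => //.
apply: (submod_eq (@sF N)); rewrite mderiv_sd mderiv_phi // /curvature meval_sd meval_phi //.
by rewrite mderiv_fD addrACA [- sdiff eta + _]addrC.
Qed.

Variable alpha : g.
Hypothesis alpha_mc : maurer_cartan alpha.

Let alpha_hom : homog 0 (alpha : W).
Proof. exact: alpha_mc.1. Qed.

Lemma curvature_alpha : curvature alpha = 0.
Proof.
have := alpha_mc.2; rewrite -[dgd g alpha]/(sdiff alpha) -[lie _ _]/(sbrac alpha alpha) => h.
by rewrite /curvature -opprD (_ : _ + _ = 0) ?oppr0.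
Qed.

Lemma sbracC x y : homog 0 x -> homog 0 y -> sbrac x y = sbrac y x.
Proof.
move=> hx hy; rewrite /sbrac (@lie_antisym k g (-1) (-1)) //.
by rewrite (_ : (-1 : k) ^ (-1 * -1) = -1) ?scaleN1r ?opprK // mulrNN mulr1 expr1z.
Qed.

Lemma sbrac_leibniz eta x : homog 1 eta -> homog 0 x ->
  sdiff (sbrac eta x) = sbrac (sdiff eta) x + sbrac eta (sdiff x).
Proof.
move=> he hx; rewrite /sdiff /sbrac (@lie_leibniz k g 0) // expr0z scale1r //.
Qed.

Lemma sbrac_jacobi eta x y : homog 1 eta -> homog 0 x ->
  sbrac eta (sbrac x y) = sbrac (sbrac eta x) y + sbrac x (sbrac eta y).
Proof.
move=> he hx; rewrite /sbrac (@lie_jacobi k g 0 (-1) eta x y) //.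
by rewrite mul0r expr0z scale1r.
Qed.

(** Equivariance of the curvature under the infinitesimal gauge action z = [η, x] - dη. The terms in
    [dη, x] cancel by the Leibniz rule, and [η, [x, x]] = 2 [[η, x], x] by the Jacobi identity. *)
Lemma curvature_deriv eta x : homog 1 eta -> homog 0 x ->
  let z := sbrac eta x - sdiff eta in
  - sdiff z - 2%:R^-1 *: (sbrac z x + sbrac x z) = sbrac eta (curvature x).
Proof.
move=> he hx z.
have hz : homog 0 z.
  apply: (submodB (homog_submod W 0)); first exact: (homog_sbrac he hx).
  exact: (homog_sdiff he).
have two0 : (2%:R : k) != 0 by apply: (natr_neq0 char0 1).
have -> : sbrac z x + sbrac x z = 2%:R *: sbrac z x.
  by rewrite (sbracC hx hz) scaler_nat.
rewrite scalerA mulVf // scale1r /curvature sbracDr !sbracNr sbracZr.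
have -> : sbrac eta (sbrac x x) = 2%:R *: sbrac (sbrac eta x) x.
  rewrite sbrac_jacobi // (sbracC hx) ?scaler_nat //.
  exact: (homog_sbrac he hx).
rewrite scalerA mulVf // scale1r /z sdiffD sdiffN sbrac_leibniz // sbracDl sbracNl.
rewrite (_ : sdiff (sdiff eta) = 0); last exact: dgdK.
by rewrite oppr0 addr0 opprB opprD addrACA addNr add0r.
Qed.

Lemma pfderiv_curvature (x x' : k -> W) : pfderiv x x' ->
  pfderiv (fun t => curvature (x t))
    (fun t => - sdiff (x' t) - 2%:R^-1 *: (sbrac (x' t) (x t) + sbrac (x t) (x' t))).
Proof.
move=> h; apply: pfderivB.
  by apply: pfderivN; apply: (pfderiv_lin sdiffP).
apply: pfderivZ; apply: (pfderiv_bilin char0) => //.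
  exact: sbracPl.
exact: sbracPr.
Qed.

(* The curvature q satisfies q' = [eta, q] + (terms linear in q), where every term on
   the right raises the filtration; as q(0) = 0, it vanishes. *)
Lemma curvature_flow (x x' : k -> W) : pfderiv x x' -> x 0 = alpha ->
  (forall t, homog 0 (x t)) -> (forall t, F N (x' t - meval lambda (x t))) ->
  forall t, F N (curvature (x t)).
Proof.
move=> hx x0 hom flow.
have hom' := pfderiv_submod char0 (homog_submod W 0) hx hom.
suff h n : (n <= N)%N -> forall t, F n (curvature (x t)) by apply: h.
elim: n => [|n IH] nN t; first by apply: (fl_desc sfilt_filtration); apply: sfilt1.
have {}IH := IH (ltnW nN).
have := pfderiv_cst_mod char0 (@sF n.+1) (pfderiv_curvature hx) _ t.
rewrite x0 curvature_alpha subr0; apply=> u.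
set eta := meval f (x u).
have heta : homog 1 eta by apply: (meval_homog N f_good).
pose z := sbrac eta (x u) - sdiff eta; pose r := x' u - z.
have Fr : F n.+1 r.
  have -> : r = (x' u - (z + mderiv f (curvature (x u)) (x u))) + mderiv f (curvature (x u)) (x u).
    by rewrite /r; move: (mderiv _ _ _) (z) (x' u) => m1 m2 m3; rewrite opprD addrA subrK.
  apply: (submodD (@sF _)); last exact: mderiv_f_filt.
  apply: (fl_leq sfilt_filtration nN); apply: (submod_trans (@sF _) (flow u)).
  exact: lambda_eval.
have -> : x' u = z + r by rewrite /r [RHS]addrC subrK.
rewrite sdiffD sbracDl sbracDr opprD addrACA.
have -> : - sdiff z - sdiff r - 2%:R^-1 *: (sbrac z (x u) + sbrac (x u) z + (sbrac r (x u) + sbrac (x u) r)) =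
   (- sdiff z - 2%:R^-1 *: (sbrac z (x u) + sbrac (x u) z)) +
   (- sdiff r - 2%:R^-1 *: (sbrac r (x u) + sbrac (x u) r)).
  by rewrite scalerDr opprD addrACA.
rewrite curvature_deriv //; apply: (submodD (@sF _)).
  by rewrite -add1n; apply: sfilt_sbrac => //; apply: sfilt1.
apply: (submodB (@sF _)); first by apply: (submodN (@sF _)); apply: sfilt_sdiff.
apply: (submodZ (@sF _)); apply: (submodD (@sF _)).
  by apply: (fl_leq sfilt_filtration (leq_addr 1 _)); apply: sfilt_sbrac => //; apply: sfilt1.
by apply: (fl_leq sfilt_filtration (leq_addl 1 _)); apply: sfilt_sbrac => //; apply: sfilt1.
Qed.

End Flow.

(** * The flow through α in terms of f_i and λ.α *)

Section AmbientFlow.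

Variables (k : fieldType) (char0 : [pchar k] =i pred0) (g : completeDgLie k).
Variables (lambda f : multiop (susp g)).
Hypotheses (lambda_b : in_b 0 lambda) (f_b : in_b 1 f).
Hypothesis df : forall v, twisted_diff 1 f v = lambda v.
Variable alpha : g.
Hypothesis alpha_mc : maurer_cartan alpha.
Notation W := (susp g).
Notation F := (@sfilt k g).

Let hF := sfilt_filtration g.
Let F1 := @sfilt1 k g.
Let lam_good : good F 0 lambda := symop_good lambda_b.
Let f_good : good F 1 f := symop_good f_b.
Let lam2 : forall l, (size l < 2)%N -> lambda l = 0 := symop_arity lambda_b.
Let alpha_hom : homog 0 (alpha : W).
Proof. exact: alpha_mc.1. Qed.
Let id_good : good F 0 (unary id).
Proof. by apply: good_unary_id => n; apply: (submod0 (fl_sub hF n)). Qed.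
Let alphan n : deg0 (nseq n (alpha : W)). Proof. exact: deg0_nseq. Qed.

Notation it j mu := (iter j (rmul lambda) mu).

Lemma iter_good c mu j : good F c mu -> good F c (it j mu).
Proof. exact: good_iter. Qed.

Lemma iter_f_arity j n : (n < 2 + j)%N -> it j f (nseq n (alpha : W)) = 0.
Proof.
move=> n2; apply: (iter_arity (a := 2) hF lam_good lam2 f_good) => //.
  by move=> l' _; apply: (symop_arity f_b).
by rewrite size_nseq.
Qed.

Lemma iter_id_arity j n : (n < j.+1)%N -> it j (unary id) (nseq n (alpha : W)) = 0.
Proof.
move=> n2; apply: (iter_arity (a := 1) hF lam_good lam2 id_good) => //.
  by case.
by rewrite size_nseq.
Qed.

Lemma iota_small (t : nat -> g) (P : pred nat) N :
  (forall n, P n -> filt n (t n)) -> forall i, i \notin iota 0 N -> P i -> filt N (t i).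
Proof.
move=> h i; rewrite mem_iota add0n /= -leqNgt => Ni Pi.
exact: (fl_leq (filt_filtration g) Ni (h i Pi)).
Qed.

Lemma homog_susp1 (x : W) : homog 1 x -> @homog k g 0 x.
Proof. by []. Qed.

Lemma homog_susp0 (x : W) : homog 0 x -> @homog k g (-1) x.
Proof. by []. Qed.

Section FSeries.
Variable j : nat.
Let t (n : nat) : g := n`!%:R^-1 *: it j f (nseq n (alpha : W)).
Let P (n : nat) := (2 <= n)%N.

Let thom n : P n -> homog 0 (t n).
Proof.
move=> _; apply: (submodZ (homog_submod g 0)).
exact: (homog_susp1 (good_homog (iter_good j f_good) (@alphan n))).
Qed.

Let tfilt n : P n -> filt n (t n).
Proof.
move=> _; apply: (submodZ (filt_submod g n)).
exact: (good_nseq_filt hF F1 n (iter_good j f_good) alpha_hom).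
Qed.

Lemma f_homog : homog 0 (f_ lambda f alpha j.+1).
Proof.
apply: (submodZ (homog_submod g 0)); apply: (infsum_homog thom) => N.
by exists (iota 0 N); apply: iota_small tfilt.
Qed.

Lemma f_cong N :
  filt N (f_ lambda f alpha j.+1 - j`!%:R^-1 *: meval N (it j f) (alpha : W)).
Proof.
rewrite -[X in filt N X]scalerBr; apply: (submodZ (filt_submod g N)).
have := @infsum_cong k g nat P 0 t thom _ N (iota 0 N) (iota_uniq 0 N) (iota_small tfilt).
move=> /(_ (fun N => ex_intro _ (iota 0 N) (iota_small tfilt))).
congr (filt N (_ - _)).
rewrite -[RHS](big_mkord xpredT (fun n => n`!%:R^-1 *: it j f (nseq n (alpha : W)))).
rewrite /index_iota subn0 [LHS]big_mkcond; apply: eq_bigr => n _.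
case: ifP => // /negbT; rewrite /P -ltnNge => n2.
by rewrite iter_f_arity ?scaler0 // ltn_addr.
Qed.

Lemma f_small : filt j.+1 (f_ lambda f alpha j.+1).
Proof.
apply: (submod_congl (filt_submod g _) (f_cong j.+1)).
apply: (submodZ (filt_submod g _)); rewrite [X in filt _ X](_ : _ = 0); first exact: (submod0 (filt_submod g _)).
rewrite /meval big1 // => n _; rewrite iter_f_arity ?scaler0 //.
by apply: ltn_trans (ltn_ord n) _; rewrite addSn ltnS.
Qed.

End FSeries.

(** In arity n the terms with j >= n vanish, so the infinite sum defining e^λ is finite there. *)
Lemma prelie_exp_nseq n J : (n <= J)%N ->
  prelie_exp lambda (nseq n (alpha : W)) =
  \sum_(j < J) j`!%:R^-1 *: it j (unary id) (nseq n (alpha : W)).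
Proof.
move=> nJ; pose t (j : nat) : g := j`!%:R^-1 *: it j (unary id) (nseq n (alpha : W)).
have thom j : xpredT j -> homog (-1) (t j).
  move=> _; apply: (submodZ (homog_submod g (-1))).
  exact: (homog_susp0 (good_homog (iter_good j id_good) (@alphan n))).
have t0 N j : j \notin iota 0 J -> xpredT j -> filt N (t j).
  rewrite mem_iota add0n /= -leqNgt => Jj _.
  rewrite /t iter_id_arity ?scaler0; first exact: filt0.
  by rewrite ltnS (leq_trans nJ).
have E : prelie_exp lambda (nseq n (alpha : W)) - \sum_(j <- iota 0 J) t j = 0 :> g.
  apply: filt_separated => N.
  by apply: (infsum_cong thom) => [N'||]; [exists (iota 0 J) => j; apply: t0 | apply: iota_uniq | apply: t0].
have := subr0_eq E => ->.
by rewrite -[RHS](big_mkord xpredT t) /index_iota subn0.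
Qed.

Lemma ambient_cong N : filt N (ambient_act lambda alpha -
  \sum_(j < N) j`!%:R^-1 *: meval N (it j (unary id)) (alpha : W)).
Proof.
pose t (n : nat) : g := n`!%:R^-1 *: prelie_exp lambda (nseq n (alpha : W)).
pose P (n : nat) := (1 <= n)%N.
have thom n : P n -> homog (-1) (t n).
  move=> _; apply: (submodZ (homog_submod g (-1))); rewrite (prelie_exp_nseq (leqnn n)).
  apply: (submod_sum (homog_submod g (-1))) => j _ _; apply: (submodZ (homog_submod g (-1))).
  exact: (homog_susp0 (good_homog (iter_good j id_good) (@alphan n))).
have tfilt n : P n -> filt n (t n).
  move=> _; apply: (submodZ (filt_submod g n)); rewrite (prelie_exp_nseq (leqnn n)).
  apply: (submod_sum (filt_submod g n)) => j _ _; apply: (submodZ (filt_submod g n)).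
  exact: (good_nseq_filt hF F1 n (iter_good j id_good) alpha_hom).
have := @infsum_cong k g nat P (-1) t thom (fun N => ex_intro _ (iota 0 N) (iota_small tfilt))
  N (iota 0 N) (iota_uniq 0 N) (iota_small tfilt).
congr (filt N (_ - _)).
transitivity (\sum_(n < N) n`!%:R^-1 *: \sum_(j < N) j`!%:R^-1 *:
    it j (unary id) (nseq n (alpha : W)) : W).
  rewrite -[RHS](big_mkord xpredT (fun n => n`!%:R^-1 *: \sum_(j < N) j`!%:R^-1 *:
    it j (unary id) (nseq n (alpha : W)))).
  rewrite /index_iota subn0 [LHS]big_mkcond big_seq [RHS]big_seq; apply: eq_bigr => n.
  rewrite mem_iota add0n /= => nN; rewrite /P /t (prelie_exp_nseq (ltnW nN)).
  case: n nN => // nN; rewrite big1 ?scaler0 // => j _.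
  by rewrite iter_id_arity // scaler0.
under eq_bigr => n _ do rewrite scaler_sumr.
rewrite exchange_big; apply: eq_bigr => j _ /=; rewrite scaler_sumr.
by apply: eq_bigr => n _; rewrite !scalerA mulrC.
Qed.

Lemma flow_exists n0 : let N := n0.+3 in exists x x' : k -> g,
  [/\ pfderiv x x', x 0 = alpha,
      forall t, filt N (x' t - \sum_(j < N) t ^+ j *:
        (lie (f_ lambda f alpha j.+1) (x t) - dgd g (f_ lambda f alpha j.+1))) &
      filt N (x 1 - ambient_act lambda alpha)].
Proof.
move=> N.
have [x [x' [hx x0 hom flow]]] := picard char0 N hF F1 lam_good lam2 alpha_hom.
exists x, x'; split=> //.
- move=> t; have heta := f_cong ^~ N.
  set eta := meval N f (x t).
  have Eeta : F N (eta - \sum_(j < N) t ^+ j *: (f_ lambda f alpha j.+1 : W)).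
    apply: (submod_trans (fl_sub hF N) (taylor_flow char0 hF F1 lam_good lam2 hx x0 hom flow t f_good)).
    apply: (submod_congsum (fl_sub hF N)) => j _ _.
    rewrite -scalerA; apply: (submod_congZ (fl_sub hF N)).
    apply: (submodC (fl_sub hF N)); exact: f_cong.
  pose z e : W := sbrac e (x t) - sdiff e.
  have zP a e e' : z (a *: e + e') = a *: z e + z e'.
    by rewrite /z sbracPl sdiffP opprD addrACA scalerBr.
  have e1 : F N (x' t - z eta).
    (* This removes the term in which λ(x) differs from the gauge action of η. *)
    have q0 := curvature_flow char0 f_b df alpha_mc hx x0 hom flow t.
    apply: (submod_trans (fl_sub hF N) (flow t)).
    apply: (submod_trans (fl_sub hF N) (lambda_eval char0 n0 f_b df (hom t))).
    rewrite addrAC subrr add0r.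
    apply: (fl_leq hF (leqnSn N)); exact: (mderiv_f_filt n0 f_b (x t) q0).
  have e2 : F N (z eta - z (\sum_(j < N) t ^+ j *: (f_ lambda f alpha j.+1 : W))).
    set S := \sum_(_ < N) _ in Eeta *.
    have -> : z eta - z S = z (eta - S).
      by have := zP (-1) S eta; rewrite !scaleN1r addrC => ->; rewrite addrC.
    apply: (submodB (fl_sub hF N)).
      by apply: (fl_leq hF (leq_addr 1 N)); apply: sfilt_sbrac => //; apply: F1.
    exact: sfilt_sdiff.
  have e3 : z (\sum_(j < N) t ^+ j *: (f_ lambda f alpha j.+1 : W)) =
      \sum_(j < N) t ^+ j *: z (f_ lambda f alpha j.+1).
    elim/big_rec2: _ => [|j a b _ <-]; last by rewrite zP.
    by rewrite /z sbrac0l sdiff0 subrr.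
  rewrite e3 in e2.
  exact: (submod_trans (fl_sub hF N) e1 e2).
(* For the identity operation, whose iterates are the r_λ^j(𝟙), Taylor's formula at t = 1 is the
   evaluation of e^λ at α. *)
have h1 := taylor_flow char0 hF F1 lam_good lam2 hx x0 hom flow 1 id_good.
have ex : meval N (unary id) (x 1) = x 1.
  rewrite /meval (sum_ord_single (m := 1) (u := fun n => n`!%:R^-1 *: unary id (nseq n (x 1 : W)))) //.
    by rewrite invr1 scale1r.
  by case=> [|[|i]] //= _; rewrite scaler0.
rewrite ex in h1.
apply: (submod_trans (filt_submod g N) h1).
apply: (submodC (filt_submod g N)).
apply: (submod_trans (filt_submod g N) (ambient_cong N)).
apply: (submod_eq (filt_submod g N)); apply: eq_bigr => j _.
by rewrite expr1n mul1r.
Qed.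

End AmbientFlow.

(** * The extended Lie algebra *)

Section PfderivEv.
Variables (k : fieldType) (char0 : [pchar k] =i pred0) (I : finType).
Variables (V : lmodType k) (X : I -> {linear V -> V}).

Lemma pfderiv_ev n (c : ncs I {poly k}) (p p' : k -> V) : pfderiv p p' ->
  pfderiv (fun u => ev X n (neval u c) (p u))
    (fun u => ev X n (neval u (nderiv c)) (p u) + ev X n (neval u c) (p' u)).
Proof.
elim: n c p p' => [|n IH] c p p' hp /=.
  by apply: pfderiv_ext (pfderiv_cst 0) => u; rewrite ?addr0.
have h j := IH (shift j c) _ _ (pfderiv_lin (linearP (X j)) hp).
apply: pfderiv_ext (pfderivD (pfderiv_pscale (c [::]) hp)
  (pfderiv_sum (index_enum I) (P := xpredT) (fun j _ => h j))) => u //=.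
by rewrite big_split addrACA.
Qed.

End PfderivEv.

Section Assembly.

Variables (k : fieldType) (char0 : [pchar k] =i pred0) (g : completeDgLie k).
Notation V := (gbar g).

(* The bracket of gbar with an element a of degree 0 of g. *)
Definition act (a : g) (y : V) : V := (lie a y.1 - y.2 *: dgd g a, 0).

(** Unlike in [filt_bar], the term n = 0 is the whole extended algebra: δ then belongs to the
    filtration, and every bracket with an element of g of degree 0 raises it by one. *)
Definition filtbar (n : nat) (y : V) := filt n y.1 /\ ((0 < n)%N -> y.2 = 0).

Lemma lie_bar_act a y : homog 0 a -> lie_bar (to_gbar a) y = act a y.
Proof.
move=> ha; rewrite /lie_bar /act /= scale0r addr0 (sgn_deg_homog ha).
by rewrite expr0z scale1r.
Qed.

Lemma liePl (a : k) (x y z : g) : lie (a *: x + y) z = a *: lie x z + lie y z.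
Proof. exact: (lie_linearl z). Qed.
Lemma liePr (a : k) (x y z : g) : lie z (a *: x + y) = a *: lie z x + lie z y.
Proof. exact: (lie_linearr z). Qed.
Lemma lie0r (z : g) : lie z 0 = 0.
Proof. by have := liePr (-1) 0 0 z; rewrite scaler0 addr0 scaleN1r addNr. Qed.
Lemma lieZr (a : k) (x z : g) : lie z (a *: x) = a *: lie z x.
Proof. by rewrite -[a *: x]addr0 liePr lie0r addr0. Qed.
Lemma lieBr (x y z : g) : lie z (x - y) = lie z x - lie z y.
Proof. by rewrite -scaleN1r addrC liePr scaleN1r addrC. Qed.

Lemma act_linearr a : linear (act a).
Proof.
move=> c y z; congr pair => /=; last by rewrite /= scaler0 addr0.
by rewrite liePr scalerDl -scalerA opprD addrACA -scalerBr.
Qed.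

Lemma act_linearl c a b y : act (c *: a + b) y = c *: act a y + act b y.
Proof.
congr pair => /=; last by rewrite /= scaler0 addr0.
rewrite liePl linearP scalerDr opprD addrACA scalerA mulrC -scalerA -scalerBr.
by [].
Qed.

Lemma actB a b y : act (a - b) y = act a y - act b y.
Proof. by rewrite -[- b]scaleN1r addrC act_linearl scaleN1r addrC. Qed.

Lemma actBr a y z : act a (y - z) = act a y - act a z.
Proof. by rewrite -[- z]scaleN1r addrC act_linearr scaleN1r addrC. Qed.

Lemma filtbar_filtration : filtration filtbar.
Proof.
split=> [n|n y [h h2]].
  split; first by split=> //; apply: filt0.
  move=> a x y [hx hx2] [hy hy2]; split; first exact: filt_linear.
  by move=> n0 /=; rewrite hx2 // hy2 // scaler0 addr0.
by split; [apply: filt_desc | move=> _; apply: h2].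
Qed.

Let hF := filtbar_filtration.
Let sF n : submod (filtbar n) := fl_sub hF n.

Lemma filtbar0 y : filtbar 0 y.
Proof. by split=> //; apply: filt_top. Qed.

Lemma filtbar_act a n y : filtbar n y -> filtbar n.+1 (act a y).
Proof.
move=> [h h2]; split=> //=; case: n h h2 => [|n] h h2; first exact: filt_top.
rewrite h2 // scale0r subr0 -add1n; apply: filt_lie => //; exact: filt_top.
Qed.

Lemma filtbar_actl n a y : filt n a -> filtbar n (act a y).
Proof.
move=> h; split=> //=; apply: (submodB (filt_submod g n)).
  by apply: (fl_leq (filt_filtration g) (leq_addr 1 n)); apply: filt_lie => //; apply: filt_top.
by apply: (submodZ (filt_submod g n)); apply: filt_dgd.
Qed.

Lemma filtbar_act_same a n y : filtbar n y -> filtbar n (act a y).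
Proof. by move=> h; apply: (fl_desc hF); apply: filtbar_act. Qed.

(** The Jacobi identity of the extended algebra; on the component along δ it is the Leibniz rule of
    g. *)
Lemma act_lie x l y : homog 0 x -> homog 0 l ->
  act (lie x l) y = act x (act l y) - act l (act x y).
Proof.
move=> hx hl; congr pair => /=; last by rewrite subrr.
rewrite !scale0r !subr0.
have J := @lie_jacobi k g 0 0 x l y.1 hx hl; rewrite mulr0 expr0z scale1r in J.
rewrite !lieBr !lieZr J (@lie_leibniz k g 0 x l hx) expr0z scale1r.
have -> : lie (dgd g x) l = - lie l (dgd g x).
  by rewrite (@lie_antisym k g (0 - 1) 0 _ _ (dgd_homog hx) hl) mulr0 expr0z scale1r.
rewrite scalerDr scalerN opprD opprK opprB.
move: (lie (lie x l) y.1) (lie l (lie x y.1)) (y.2 *: _) (y.2 *: _) => u r p q.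
by rewrite [u + r - p]addrAC -[RHS]addrA [r + _]addrC subrK addrA addrAC.
Qed.

Section Letters.
Variables (n0 : nat) (fs : nat -> g).
Hypothesis fs_hom : forall j, homog 0 (fs j).
Notation N := n0.+3.
Notation I := 'I_N.

HB.instance Definition _ a := GRing.isLinear.Build k V V *:%R (act a) (act_linearr a).

Definition letter_act (j : I) : {linear V -> V} := act (fs j).
Fact lie_fs_linear (j : I) : linear (lie (fs j)).
Proof. exact: lie_linearr. Qed.
HB.instance Definition _ (j : I) := GRing.isLinear.Build k g g *:%R (lie (fs j)) (lie_fs_linear j).
Definition letter_lie (j : I) : {linear g -> g} := lie (fs j).

Let FX (j : I) n v : filtbar n v -> filtbar n.+1 (letter_act j v).
Proof. exact: filtbar_act. Qed.

Notation evb := (ev letter_act N).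
Notation evg := (ev letter_lie N).
Notation tail0 := (magnus_tail0 k (val : I -> nat) n0.+2).
Notation mag0 := (magnus0 k (val : I -> nat) n0.+2).

(** The image of [magnus0] in g: the same brackets and coefficients, with the elements [fs i] in
    place of the letters. *)
Definition lie_magnus : g := \sum_(i : I) evg (tail0 i) (fs i).

Lemma lie_magnus_rep m v : filtbar m v ->
  filtbar (m + N) (evb mag0 v - act lie_magnus v).
Proof.
move: m v; rewrite -/(represents letter_act filtbar act N mag0 lie_magnus).
have rho_linear a (l l' : g) v : act (a *: l + l') v = a *: act l v + act l' v.
  exact: act_linearl.
apply: (represents_sum hF rho_linear) => i.
apply: (represents_ev hF FX rho_linear (E := @homog k g 0)) => //.
- move=> j l hl; have := lie_homog (fs_hom j) hl; by rewrite addr0.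
- by move=> j l v hl; apply: act_lie.
by move=> m v Fv; rewrite ev_letter subrr; apply: (submod0 (@sF _)).
Qed.

Lemma lie_magnus_iter n v :
  filtbar N (evb (mag0 ^+ n) v - iter n (act lie_magnus) v).
Proof.
elim: n => [|n IH]; first by rewrite expr0 ev_one subrr; apply: (submod0 (@sF _)).
rewrite exprS iterS.
apply: (submod_trans (@sF N) (evM hF FX N mag0 (mag0 ^+ n) (filtbar0 v))).
apply: (submod_trans (@sF N) (y := evb mag0 (iter n (act lie_magnus) v))).
  by rewrite -evrB; apply: ev_filt0 IH.
exact: (lie_magnus_rep (filtbar0 _)).
Qed.

Lemma lie_magnus_exp v :
  filtbar N (\sum_(n < N) n`!%:R^-1 *: iter n (act lie_magnus) v -
    evb (neval 0 (chrono k (val : I -> nat))) v).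
Proof.
apply: (submod_trans (@sF N) (y := evb (\sum_(n < N) n`!%:R^-1 *: mag0 ^+ n) v)).
  rewrite ev_sum; apply: (submod_congsum (@sF N)) => n _ _; rewrite evZ.
  apply: (submod_congZ (@sF N)); apply: (submodC (@sF N)); exact: lie_magnus_iter.
rewrite -evB; apply: (ev_filt hF FX N _ (filtbar0 v)); exact: magnus0_exp.
Qed.

(* The derivative of Y(u) a(u) vanishes modulo the filtration. *)
Lemma chrono_flow (a a' : k -> V) : pfderiv a a' ->
  (forall t, filtbar N (a' t - \sum_(j : I) t ^+ j *: act (fs j) (a t))) ->
  filtbar N (a 1 - evb (neval 0 (chrono k (val : I -> nat))) (a 0)).
Proof.
move=> ha h; set Y := chrono k _.
have := pfderiv_cst_mod char0 (@sF N) (pfderiv_ev letter_act N Y ha) _ 1.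
rewrite neval1_chrono ev_one; apply=> u.
rewrite nderiv_chrono // (_ : neval u _ = - (neval u Y * neval u (generator k (val : I -> nat)))); last first.
  by rewrite -nevalM /neval; apply/funext => w; rewrite !ncsN hornerN.
rewrite evN; set G := neval u (generator _ _).
have eG : evb G (a u) = \sum_(j : I) u ^+ j *: act (fs j) (a u).
  rewrite /G generatorE neval_sum ev_sum; apply: eq_bigr => j _.
  by rewrite nevalZ neval_letter evZ ev_letter hornerXn.
apply: (submod_congl (@sF N) (y := - evb (neval u Y) (evb G (a u)) + evb (neval u Y) (evb G (a u)))).
  apply: (submod_congD (@sF N)).
    rewrite -opprD; apply: (submodN (@sF N)).
    exact: (evM hF FX N _ _ (filtbar0 _)).
  by rewrite -evrB eG; apply: ev_filt0 (h u).
rewrite addNr; exact: (submod0 (@sF N)).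
Qed.

End Letters.

End Assembly.

(** * Convergence of ξ and its comparison with the truncated logarithm *)

Section XiSum.

Variables (k : fieldType) (char0 : [pchar k] =i pred0) (g : completeDgLie k).
Variables (lambda f : multiop (susp g)) (alpha : g).
Notation Fi := (f_ lambda f alpha).
Hypothesis Fi_hom : forall j, homog 0 (Fi j.+1).
Hypothesis Fi_small : forall j, filt j.+1 (Fi j.+1).

Let sF n : submod (@filt k g n) := filt_submod g n.
Let hF := filt_filtration g.

Lemma filt_lie_same n (x y : g) : filt n y -> filt n (lie x y).
Proof.
move=> h; apply: (fl_leq hF (leq_addl 1 n)).
by apply: filt_lie => //; apply: filt_top.
Qed.

Lemma filt_lie_samel n (x y : g) : filt n x -> filt n (lie x y).
Proof.
move=> h; apply: (fl_leq hF (leq_addr 1 n)).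
by apply: filt_lie => //; apply: filt_top.
Qed.

Lemma foldl_lie_homog (s : seq nat) y : all (leq 1) s -> homog 0 y ->
  homog 0 (foldl (fun y l => lie (Fi l) y) y s).
Proof.
elim: s y => //= -[|l] s IH y //= hs hy; apply: IH => //.
exact: (lie_homog (Fi_hom l) hy).
Qed.

Lemma foldl_lie_filt (s : seq nat) n y : filt n y ->
  filt (n + size s) (foldl (fun y l => lie (Fi l) y) y s).
Proof.
elim: s n y => [|l s IH] n y hy /=; first by rewrite addn0.
rewrite addnS -addSn; apply: IH; rewrite -add1n; apply: filt_lie => //.
exact: filt_top.
Qed.

Lemma foldl_lie_small N (s : seq nat) y :
  filt N y \/ (exists2 l, l \in s & filt N (Fi l)) ->
  filt N (foldl (fun y l => lie (Fi l) y) y s).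
Proof.
elim: s y => [|l s IH] y /=; first by case=> // -[].
case=> [hy|[i]]; first by apply: IH; left; apply: filt_lie_same.
rewrite inE => /predU1P[->|si] hi; apply: IH; first by left; apply: filt_lie_samel.
by right; exists i.
Qed.

(** Index tuples with entries between 1 and N. For N > 0, every other term of ξ with positive
    indices contains some f_l with l > N, hence lies in F_N. *)
Definition small_tuples m N : seq (m.+1.-tuple nat) :=
  [seq [tuple of [seq (val j).+1 | j <- t]] | t : m.+1.-tuple 'I_N].

Lemma small_tuples_uniq m N : uniq (small_tuples m N).
Proof.
rewrite map_inj_uniq ?enum_uniq // => t t' /(congr1 val) /= h.
by apply: val_inj; apply: inj_map h => i j [] /val_inj.
Qed.

Lemma small_tuples_compl m N (i : m.+1.-tuple nat) : i \notin small_tuples m N ->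
  all (leq 1) i -> N = 0%N \/ exists2 l, l \in i & (N < l)%N.
Proof.
move=> iS i1; case: N iS => [|N] iS; [by left | right].
apply/hasP; apply: contraNT iS; rewrite -all_predC => /allP iN.
apply/mapP; exists [tuple of [seq inord l.-1 | l <- i]]; first by rewrite mem_enum.
apply: val_inj => /=; rewrite -map_comp -[LHS]map_id; apply/eq_in_map => l li /=.
have l1 := allP i1 l li; have := iN l li; rewrite /= -leqNgt => lN.
by rewrite inordK ?prednK.
Qed.

Section Inner.
Variable m : nat.
Let t (i : m.+1.-tuple nat) : g := xi_coef k i *: iterated_ad Fi i.
Let P (i : m.+1.-tuple nat) := all (leq 1) i.

Lemma xi_term_homog i : P i -> homog 0 (t i).
Proof.
case/tupleP: i => -[|i0] i; rewrite /P //= => hi.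
apply: (submodZ (homog_submod g 0)); rewrite /iterated_ad theadE /=.
exact: foldl_lie_homog.
Qed.

Lemma xi_term_small N i : i \notin small_tuples m N -> P i -> filt N (t i).
Proof.
move=> iS Pi; apply: (submodZ (@sF N)).
have [->|[l li Nl]] := small_tuples_compl iS Pi; first exact: filt_top.
have Fl : filt N (Fi l).
  case: l Nl {li} => // l Nl.
  exact: (fl_leq hF (ltnW Nl) (Fi_small l)).
case/tupleP: i iS Pi li => i0 i _ _; rewrite /iterated_ad theadE inE /= => li.
apply: foldl_lie_small; case/predU1P: li => [<-|li]; [by left | right].
by exists l.
Qed.

Lemma xi_term_filt i : filt m (t i).
Proof.
apply: (submodZ (@sF m)); case/tupleP: i => i0 i; rewrite /iterated_ad theadE /=.
by have := foldl_lie_filt i (n := 0) (@filt_top k g 0 (Fi i0) isT); rewrite add0n size_tuple.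
Qed.

Definition xi_part : g := infsum (@filt k g) P t.

Lemma xi_part_homog : homog 0 xi_part.
Proof.
by apply: (infsum_homog xi_term_homog) => N; exists (small_tuples m N) => i; apply: xi_term_small.
Qed.

Lemma xi_part_cong N : filt N (xi_part - \sum_(i <- small_tuples m N) t i).
Proof.
have E : \sum_(i <- small_tuples m N) t i = \sum_(i <- small_tuples m N | P i) t i.
  rewrite !big_map; apply: eq_bigl => u; rewrite /P all_map; apply/esym/allP => j _ //.
rewrite E; apply: (infsum_cong xi_term_homog).
- by move=> N'; exists (small_tuples m N') => i; apply: xi_term_small.
- exact: small_tuples_uniq.
by move=> i; apply: xi_term_small.
Qed.

Lemma xi_part_filt : filt m xi_part.
Proof.
apply: (submod_congl (@sF m) (xi_part_cong m)).
by apply: (submod_sum (@sF m)) => i _ _; apply: xi_term_filt.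
Qed.
End Inner.

Lemma xiE : xi lambda f alpha = infsum (@filt k g) predT xi_part.
Proof. by []. Qed.

Lemma xi_part_small N m : m \notin iota 0 N -> predT m -> filt N (xi_part m).
Proof.
rewrite mem_iota add0n /= -leqNgt => Nm _; exact: (fl_leq hF Nm (xi_part_filt m)).
Qed.

Lemma xi_homog : homog 0 (xi lambda f alpha).
Proof.
rewrite xiE; apply: (infsum_homog (fun m _ => xi_part_homog m)) => N.
by exists (iota 0 N) => m; apply: xi_part_small.
Qed.

(** A term of ξ with m + 1 indices is a word of length m acting on its innermost letter, so both
    sides run over the same tuples, and [magnus_tail0E] identifies the coefficients. *)
Lemma xi_cong n0 : filt n0.+3 (xi lambda f alpha - lie_magnus n0 (fun j => Fi j.+1)).
Proof.
set N := n0.+3; rewrite xiE.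
apply: (submod_trans (@sF N) (y := \sum_(m <- iota 0 N) xi_part m)).
  apply: (infsum_cong (fun m _ => xi_part_homog m)) => [N'||].
  - by exists (iota 0 N') => m; apply: xi_part_small.
  - exact: iota_uniq.
  by move=> m; apply: xi_part_small.
rewrite -[N in iota 0 N]subn0 -/(index_iota 0 N) big_mkord.
apply: (submod_trans (@sF N) (y := \sum_(m < N) \sum_(i <- small_tuples m N)
   xi_coef k i *: iterated_ad Fi i)).
  by apply: (submod_congsum (@sF N)) => m _ _; apply: xi_part_cong.
apply: (submod_eq (@sF N)); rewrite /lie_magnus.
under [RHS]eq_bigr => i _ do rewrite ev_words.
rewrite exchange_big; apply: eq_bigr => m _ /=.
rewrite /small_tuples big_map big_enum pair_big /=.
rewrite [RHS](reindex (fun w : (m.+1).-tuple 'I_N => (thead w, [tuple of behead w]))) /=; last first.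
  exists (fun p : 'I_N * m.-tuple 'I_N => [tuple of p.1 :: p.2]) => [w _|[j w] _] /=.
    by rewrite [RHS](tuple_eta w).
  by congr pair; apply: val_inj.
apply: eq_bigr => w _; case/tupleP: w => j w.
have mN : (m < n0.+2.+1)%N by apply: ltn_ord.
rewrite theadE (_ : [tuple of behead _] = w :> seq _) //.
rewrite (magnus_tail0E char0 (nat_of_ord (n:=n0.+3)) w j mN).
set T1 := (X in xi_coef k X *: _); set T2 := (X in _ = xi_coef k X *: _).
have -> : T2 = T1 by apply: val_inj.
congr (_ *: _).
rewrite /iterated_ad /thead (tnth_nth 0%N) /=.
by elim: (val w) (Fi j.+1) => //= a s IH y; rewrite IH.
Qed.

End XiSum.

(** * The exponential of ad ξ in the extended algebra *)

Lemma has_sum_bar_unique (k : fieldType) (g : completeDgLie k) (t : nat -> gbar g) x y :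
  has_sum (@filt_bar k g) predT t x -> has_sum (@filt_bar k g) predT t y -> x = y.
Proof.
move=> hx hy.
have h n : filt n (x - y).1 /\ (x - y).2 = 0.
  have [s1 h1] := hx n; have [s2 h2] := hy n; pose s := undup (s1 ++ s2).
  have [a1 a2] : filt_bar n (x - \sum_(i <- s) t i).
    by apply: h1; rewrite ?undup_uniq // => i is1; rewrite mem_undup mem_cat is1.
  have [b1 b2] : filt_bar n (y - \sum_(i <- s) t i).
    by apply: h2; rewrite ?undup_uniq // => i is1; rewrite mem_undup mem_cat is1 orbT.
  have -> : x - y = (x - \sum_(i <- s) t i) - (y - \sum_(i <- s) t i).
    by rewrite opprB addrA subrK.
  move: (x - _) (y - _) a1 a2 b1 b2 => u v a1 a2 b1 b2.
  by split; [apply: (submodB (filt_submod g n)) | rewrite /= a2 b2 subr0].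
apply/eqP; rewrite -subr_eq0; apply/eqP.
rewrite (surjective_pairing (x - y)) (h 0%N).2 (filt_separated (fun n => (h n).1)).
by [].
Qed.

Theorem theorem3p6 (k : fieldType) (char0 : [pchar k] =i pred0)
    (g : completeDgLie k) (lambda f : multiop (susp g))
    (lambda_b : in_b 0 lambda) (f_b : in_b 1 f)
    (df : forall v, twisted_diff 1 f v = lambda v)
    (alpha : g) (alpha_mc : maurer_cartan alpha) :
  exp_ad (xi lambda f alpha) (delta g + to_gbar alpha) =
    delta g + to_gbar (ambient_act lambda alpha).
Proof.
pose Fi := f_ lambda f alpha.
have Fi_hom j : homog 0 (Fi j.+1) := f_homog lambda_b f_b alpha_mc j.
have Fi_small j : filt j.+1 (Fi j.+1) := f_small lambda_b f_b alpha_mc j.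
set y0 := delta g + to_gbar alpha; set x := xi lambda f alpha.
have xh : homog 0 x by apply: xi_homog.
pose t n : gbar g := n`!%:R^-1 *: iter n (lie_bar (to_gbar x)) y0.
have tE n : t n = n`!%:R^-1 *: iter n (act x) y0.
  by congr (_ *: _); elim: n => //= n ->; rewrite lie_bar_act.
have hF := filtbar_filtration g; pose sF n := fl_sub hF n.
(* [infsum] chooses a sum, with default 0; exhibiting one sum and using uniqueness determines its
   value. *)
suff hs : has_sum (@filt_bar k g) predT t (delta g + to_gbar (ambient_act lambda alpha)).
  apply: (has_sum_bar_unique _ hs); apply: (@xgetPex _ 0 (has_sum (@filt_bar k g) predT t)).
  by exists (delta g + to_gbar (ambient_act lambda alpha)).
have key n0 : filtbar n0.+3 (\sum_(n < n0.+3) t n - (delta g + to_gbar (ambient_act lambda alpha))).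
  set N := n0.+3.
  have [z [z' [hz z0 hzz' hz1]]] := flow_exists char0 lambda_b f_b df alpha_mc n0.
  (* The flow lifted to δ + x(u), which satisfies a linear equation. *)
  pose a u : gbar g := (z u, 1); pose a' u : gbar g := (z' u, 0).
  have ha : pfderiv a a'.
    have h1 := pfderiv_lin (f := fun v : g => (v, 0) : gbar g) _ hz.
    have h2 := pfderivD (h1 _) (pfderiv_cst ((0, 1) : gbar g)).
    apply: pfderiv_ext (h2 _) => [u|u|c v w] /=.
    - by congr pair; rewrite ?addr0 ?add0r.
    - by rewrite addr0.
    by congr pair; rewrite /= ?scaler0 ?addr0.
  pose fs j := Fi j.+1.
  have h u : filtbar N (a' u - \sum_(j < N) u ^+ j *: act (fs j) (a u)).
    have -> : \sum_(j < N) u ^+ j *: act (fs j) (a u) =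
        (\sum_(j < N) u ^+ j *: (lie (fs j) (z u) - dgd g (fs j)), 0) :> gbar g.
      elim/big_rec2: _ => [//|j p q _ ->]; congr pair => /=; last by rewrite scaler0 addr0.
      by rewrite scale1r.
    by split=> [|_] /=; [apply: hzz' | rewrite subrr].
  have e3 := chrono_flow char0 ha h.
  have a0 : a 0 = y0 by rewrite /a z0 /y0; congr pair; rewrite /= ?add0r ?addr0.
  rewrite a0 in e3.
  have e2 := lie_magnus_exp char0 n0 (fs := fs) Fi_hom y0.
  set L := lie_magnus n0 fs in e2.
  (* Each occurrence of ξ may be replaced by the truncated logarithm, as both agree modulo F_N. *)
  have e1 : filtbar N (\sum_(n < N) t n - \sum_(n < N) n`!%:R^-1 *: iter n (act L) y0).
    apply: (submod_congsum (sF N)) => n _ _; rewrite tE; apply: (submod_congZ (sF N)).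
    elim: (val n) => [|m IH]; first by rewrite subrr; apply: (submod0 (sF N)).
    rewrite !iterS; apply: (submod_trans (sF N) (y := act L (iter m (act x) y0))).
      rewrite -actB; apply: filtbar_actl; exact: xi_cong.
    by rewrite -actBr; apply: filtbar_act_same.
  apply: (submod_trans (sF N) e1); apply: (submod_trans (sF N) e2).
  apply: (submod_trans (sF N) (submodC (sF N) e3)).
  split=> [|_] /=; first by rewrite add0r.
  by rewrite addr0 subrr.
move=> N'; exists (iota 0 N'.+3) => s us ss; set N := N'.+3.
have [h1 h2] : filtbar N (delta g + to_gbar (ambient_act lambda alpha) - \sum_(i <- s) t i).
  apply: (submod_trans (sF N) (y := \sum_(i <- iota 0 N) t i)).
    apply: (submodC (sF N)); rewrite -[N in iota 0 N]subn0 -/(index_iota 0 N) big_mkord.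
    exact: key.
  apply: (submodC (sF N)); rewrite sum_diff ?iota_uniq //.
  apply: (submod_sum (sF N)) => n _; rewrite mem_iota add0n /= -leqNgt => Nn.
  rewrite tE; apply: (submodZ (sF N)); apply: (fl_leq hF Nn).
  elim: n {Nn} => [|n IH]; first exact: filtbar0.
  by rewrite iterS; apply: filtbar_act.
split; last exact: h2.
by apply: (fl_leq (filt_filtration g) _ h1); rewrite /N -[N'.+3]addn3 leq_addr.
Qed.
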